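(* Let $d\ge1$ and fix an integer $k\ge2$. Let $\alpha>0$ and $\beta\le\frac d2$ satisfy $$\max\Big(\frac d2-\frac d{2k},\ \frac d2-\frac{\alpha}{2k}\Big)<\beta\le\frac d2$$ and $$\alpha>(k-1)\Big(\frac d2-\frac{k-1}{k}\beta\Big).$$ Furthermore, when $k\ge3$, assume that $$\alpha>(k-1)\frac d2-\frac{k^2-3k+3}{k-1}\beta.$$ Let $\Xi=\{\xi_{k_1,k_2}:\ 0\le k_1\le k-1,\ 0\le k_2\le k\}$ be a collection of deterministic space-time distributions with $\|\Xi\|_{\mathcal Z}<\infty$ (as defined in the context). Then there exists a unique local-in-time solution $v$ to $$v(t)=-\sum_{k_1=0}^{k-1}\ \sum_{k_2,k_3=0}^{k}\mathbf 1_{k=k_1+k_2+k_3}\frac{k!}{k_1!\,k_2!\,k_3!}\int_0^t\frac{\sin((t-\tau)\langle\nabla\rangle^\alpha)}{\langle\nabla\rangle^\alpha}\big(\xi_{k_1,k_2}\,v^{k_3}\big)(\tau)\,d\tau$$ in the class $C([0,T];H^\sigma(\mathbb T^d))$ for some $\sigma>0$ and $T=T(\|\Xi\|_{\mathcal Z})>0$. Moreover, the map $\Xi\in\mathcal Z\mapsto v\in C([0,T];H^\sigma(\mathbb T^d))$ is continuous.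
   Context: Notation: $\langle\nabla\rangle^\alpha=(1-\Delta)^{\alpha/2}$ is the Fourier multiplier $\langle n\rangle^\alpha=(1+|n|^2)^{\alpha/2}$ on $\mathbb T^d$; $W^{s,p}(\mathbb T^d)$ is the $L^p$-based Sobolev space with norm $\|\langle\nabla\rangle^sf\|_{L^p}$ and $H^\sigma=W^{\sigma,2}$. The entries $\xi_{k_1,k_2}$ play the role of the stochastic objects $:\!Z^{k_1}\!:\,(\mathcal I(:\!Z^k\!:))^{k_2}$, with $\xi_{0,0}=1$; they are viewed as given deterministic distributions, with the product $:\!Z^{k_1}\!:\,(\mathcal I(:\!Z^k\!:))^{k_2}$ replaced everywhere by $\xi_{k_1,k_2}$. (Here $Z$ is the solution of $\partial_t^2Z+(1-\Delta)^\alpha Z=0$ with random initial data $(\sum_n g_n\langle n\rangle^{-\beta}e^{in\cdot x},\sum_n h_n\langle n\rangle^{-\beta+\alpha}e^{in\cdot x})$, for independent standard complex Gaussians $g_n,h_n$ conditioned on $g_{-n}=\overline{g_n}$ and $h_{-n}=\overline{h_n}$; $:\!Z^{\ell}\!:$ is the Wick power and $\mathcal I$ is the Duhamel integral operator $\mathcal I(F)(t)=\int_0^t\frac{\sin((t-\tau)\langle\nabla\rangle^\alpha)}{\langle\nabla\rangle^\alpha}F(\tau)d\tau$. The equation in the claim is the Duhamel formulation, with zero initial data, of the equation for the remainder $v=u-Z+\mathcal I(:\!Z^k\!:)$ of the renormalized equation $\partial_t^2u+(1-\Delta)^\alpha u+:\!u^k\!:\ =0$.) Regularity exponents: $s_{k_1,k_2}<k_1(\beta-\frac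 d2)$ is fixed sufficiently close to $k_1(\beta-\frac d2)$ for $k_1\ge1$, and $s_{0,k_2}>0$ is fixed and small for $k_1=0$ (depending only on $d,k,\alpha,\beta$). The norm is $$\|\Xi\|_{\mathcal Z}=\sum_{k_1=0}^{k-1}\sum_{k_2=0}^k\|\xi_{k_1,k_2}\|_{C([0,1];W^{s_{k_1,k_2},\infty}(\mathbb T^d))},$$ and $\mathcal Z$ is the space of such collections with finite norm; local time means $T\le1$. *)

(* Defs.v *)
From HB Require Import structures.
From mathcomp Require Export all_boot all_order all_algebra.
From mathcomp Require Export all_classical all_reals all_analysis.
From mathcomp Require Export complex.

Set Implicit Arguments.
Unset Strict Implicit.
Unset Printing Implicit Defensive.

Import Order.TTheory GRing.Theory Num.Theory.
Import numFieldNormedType.Exports.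

Local Open Scope classical_set_scope.
Local Open Scope ring_scope.

Section complex_functions.
Context {R : realType}.

Definition cabs (z : R[i]) : R := ComplexField.Normc.normc z.

Context {dsp : measure_display} {X : measurableType dsp}.
Variables (mu : {measure set X -> \bar R}) (D : set X).

Definition cintegrable (f : X -> R[i]) : Prop :=
  mu.-integrable D (fun x => (complex.Re (f x))%:E) /\
  mu.-integrable D (fun x => (complex.Im (f x))%:E).

Definition cintegral (f : X -> R[i]) : R[i] :=
  Complex (\int[mu]_(x in D) complex.Re (f x)) (\int[mu]_(x in D) complex.Im (f x)).

End complex_functions.

Section torus.
Variable R : realType.

Lemma two_pi_gt0 : 0 < 2 * pi :> R.
Proof. by rewrite mulr_gt0 // pi_gt0. Qed.

Local Notation point d := (d.-tuple (measurableTypeR R)).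

Definition tcons (d : nat) (x : measurableTypeR R * point d) : point d.+1 :=
  [tuple of x.1 :: x.2].

Lemma measurable_tcons d : measurable_fun setT (@tcons d).
Proof. exact: measurable_cons. Qed.

HB.instance Definition _ d :=
  isMeasurableFun.Build _ _ _ _ (@tcons d) (@measurable_tcons d).

(* Normalized Lebesgue measure (2 pi)^-d dx on the fundamental domain
   [0, 2 pi]^d of the torus (R / 2 pi Z)^d, as a d-fold product measure. *)
Fixpoint torus_measure (d : nat) : probability (point d) R :=
  match d with
  | 0%N => dirac ([tuple] : point 0)
  | d'.+1 => distribution (uniform_prob two_pi_gt0 \x torus_measure d')%E
               (@tcons d')
  end.

Variable d : nat.

(* A distribution on the torus is given by its Fourier coefficients; as usual
   D'(T^d) corresponds to the families with polynomial growth.  Growth is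
   automatic for members of the Sobolev spaces below, and it is part of the
   definition of convergence. *)
Definition tdistr : Type := 'rV[int]_d -> R[i].

Definition freq_sqnorm (n : 'rV[int]_d) : R := \sum_(j < d) (n 0 j)%:~R ^+ 2.

Definition jap (n : 'rV[int]_d) (s : R) : R :=
  (1 + freq_sqnorm n) `^ (s / 2).

Definition tdistr_one : tdistr := fun n => (n == 0)%:R.

Definition tdistr_sub (f g : tdistr) : tdistr := fun n => f n - g n.

(* e^{- i n . x} *)
Definition char_conj (n : 'rV[int]_d) (x : point d) : R[i] :=
  let theta := \sum_(j < d) (n 0 j)%:~R * tnth x j in
  Complex (cos theta) (- sin theta).

Definition fourier_coef (g : point d -> R[i]) : tdistr :=
  fun n => cintegral (torus_measure d) setT (fun x => g x * char_conj n x).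

(* The distribution <nabla>^s f is the integrable function g. *)
Definition bessel_image (s : R) (f : tdistr) (g : point d -> R[i]) : Prop :=
  cintegrable (torus_measure d) setT g /\
  forall n, fourier_coef g n = real_complex R (jap n s) * f n.

(* || <nabla>^s f ||_{L^p}, equal to +oo when <nabla>^s f is not a function in
   L^p: the function g is unique up to a null set, so the infimum ranges over
   at most one value. *)
Definition sobolev_norm (s : R) (p : \bar R) (f : tdistr) : \bar R :=
  ereal_inf [set Lnorm (torus_measure d) p (fun x => (cabs (g x))%:E)
            | g in bessel_image s f].

(* u restricted to [0,T] belongs to C([0,T]; W^{s,p}); other times are ignored. *)
Definition continuous_sobolev (T s : R) (p : \bar R) (u : R -> tdistr) : Prop :=
  forall t, t \in `[0, T] ->
    (sobolev_norm s p (u t) < +oo)%E /\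
    (sobolev_norm s p (tdistr_sub (u t') (u t))
       @[t' --> within `[0, T]%classic (nbhs t)] --> 0%E).

Definition continuous_sobolev_norm (T s : R) (p : \bar R) (u : R -> tdistr)
    : \bar R :=
  ereal_sup [set sobolev_norm s p (u t) | t in `[0, T]%classic].

(* Convergence of a sequence in D'(T^d). *)
Definition cvg_tdistr (f : nat -> tdistr) (h : tdistr) : Prop :=
  (exists C m : R, forall N n, cabs (f N n) <= C * jap n m) /\
  (forall n, cabs (f N n - h n) @[N --> \oo] --> (0 : R)).

(* f * P_N v, where P_N v is the trigonometric polynomial obtained from v by
   keeping the frequencies |m| <= N; the index set of the sum is finite. *)
Definition mul_trunc (N : nat) (v f : tdistr) : tdistr :=
  fun n => \sum_(m \in [set m | freq_sqnorm m <= N%:R ^+ 2]) f (n - m) * v m.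

(* The product xi * v^j of a distribution with a power of a function is the
   limit in D' of xi * (P_N v)^j, that is, the extension by continuity of the
   product with trigonometric polynomials. *)
Definition is_product (xi v : tdistr) (j : nat) (h : tdistr) : Prop :=
  cvg_tdistr (fun N => iter j (mul_trunc N v) xi) h.

Definition noise : Type := nat -> nat -> R -> tdistr.

Definition noise_sub (Xi Xi' : noise) : noise :=
  fun k1 k2 t => tdistr_sub (Xi k1 k2 t) (Xi' k1 k2 t).

Variables (k : nat) (s : nat -> nat -> R).

Definition noise_norm (Xi : noise) : \bar R :=
  (\sum_(k1 < k) \sum_(k2 < k.+1)
     continuous_sobolev_norm 1 (s k1 k2) +oo (Xi k1 k2))%E.

Definition noise_space (Xi : noise) : Prop :=
  [/\ forall t, t \in `[0, 1] -> Xi 0%N 0%N t = tdistr_one,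
      forall k1 k2, (k1 < k)%N -> (k2 <= k)%N ->
        continuous_sobolev 1 (s k1 k2) +oo (Xi k1 k2)
    & (noise_norm Xi < +oo)%E].

(* "Sufficiently close" and "small" are measured by the threshold eps. *)
Definition regularities (beta eps : R) : Prop :=
  (forall k1 k2, (1 <= k1 < k)%N -> (k2 <= k)%N ->
     k1%:R * (beta - d%:R / 2) - eps < s k1 k2 < k1%:R * (beta - d%:R / 2)) /\
  (forall k2, (k2 <= k)%N -> 0 < s 0%N k2 < eps).

(* v solves the Duhamel equation on [0,T] in C([0,T]; H^sigma);
   F k1 k2 k3 tau is the product xi_{k1,k2}(tau) v(tau)^k3. *)
Definition is_solution (alpha sigma T : R) (Xi : noise) (v : R -> tdistr)
    : Prop :=
  continuous_sobolev T sigma 2%:E v /\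
  exists F : nat -> nat -> nat -> R -> tdistr,
    [/\ forall k1 k2 k3, (k1 < k)%N -> k = (k1 + k2 + k3)%N ->
          forall tau, tau \in `[0, T] ->
          is_product (Xi k1 k2 tau) (v tau) k3 (F k1 k2 k3 tau),
        forall k1 k2 k3, (k1 < k)%N -> k = (k1 + k2 + k3)%N ->
          forall n, cintegrable lebesgue_measure `[0, T]%classic
                      (fun tau => F k1 k2 k3 tau n)
      & forall t n, t \in `[0, T] ->
          v t n =
          - \sum_(k1 < k) \sum_(k2 < k.+1)
              \sum_(k3 < k.+1 | k == (k1 + k2 + k3)%N)
              (k`!)%:R / (k1`! * k2`! * k3`!)%:R *
              cintegral lebesgue_measure `[0, t]%classic (fun tau =>
                real_complex R (sin ((t - tau) * jap n alpha) / jap n alpha) *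
                F k1 k2 k3 tau n)].

Definition is_unique_solution (alpha sigma T : R) (Xi : noise)
    (v : R -> tdistr) : Prop :=
  is_solution alpha sigma T Xi v /\
  forall w, is_solution alpha sigma T Xi w ->
    forall t, t \in `[0, T] -> w t = v t.

End torus.

(* Main.v *)
Require Import Defs.
From mathcomp Require Import ring lra zify.
From mathcomp Require Import measurable_realfun ess_sup_inf.

Import Order.TTheory GRing.Theory Num.Theory.
Import numFieldNormedType.Exports.
Local Open Scope classical_set_scope.
Local Open Scope ring_scope.

Set Implicit Arguments.
Unset Strict Implicit.
Unset Printing Implicit Defensive.

(** The theorem holds because the Duhamel map of the equation is a contraction of a
   ball of C([0,T]; H^sigma).  Write [delta = d/2 - beta], so that [xi_{k1,k2}]
   has a regularity slightly below [- k1 delta], and let [b] be slightly above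
   [(k-1) delta].  Two facts are needed.

   The Duhamel integral gains alpha derivatives.  Each kernel [sin / <n>^alpha] is
   bounded by [<n>^-alpha], and Minkowski's inequality for integrals in time
   ([hs_cintegral]) carries this over to H^{-b} -> H^sigma whenever
   [sigma + b <= alpha]; a small surplus [alpha theta] gives Hoelder continuity in
   time ([duhamel_term_holder]).

   The product [xi v^j] maps W^{s,oo} x (H^sigma)^j into H^{-b}.  By duality this
   is a bound on the integral of [xi] times [j+1] functions of positive regularity
   ([multilinear_estimate]).  It rests on a single property of [xi]:
   multiplication by [<nabla>^s xi] is bounded on
   L2 ([sobolev_infty_mult_bounded]), that is, a bound on the matrix
   [<n+m>^s xi_{n+m}].  Cut every function into dyadic shells.  The functions in
   the two highest shells are paired through this matrix and the others are summed
   in l1.  The weight [<n+m>^{-s}] has to be removed from the matrix, and this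
   costs only [N^rho], for any [rho > max(0,-s)], on frequencies of size at most
   [N], because the weight is a Schur multiplier of that norm ([schur_jap]):
   stereographic projection turns [1 + |n+m|^2], up to factors in [n] and [m]
   separately, into one minus a Gram matrix, and entrywise powers of such a matrix
   are limits of iterated square roots and inverses computed by series with
   nonnegative coefficients ([near_one_sqrt], [schur_powR]).  The remaining powers
   of the shells form a convergent geometric series under the conditions collected
   in [admissible].

   Applied to tails and to differences, the product estimate also shows that
   [xi (P_N v)^j] converges, so that products exist, are unique and are Lipschitz
   in [xi] and in [v] ([limit_product_cauchy], [limit_product_lip]).  The conditions
   on the exponents can be met in the stated range of alpha and beta: they are
   affine in [k1], and at the two extreme values of [k1] they follow from the
   lower bounds on alpha and beta ([exponents_exist]).

   Picard iteration then gives a solution on a time interval that depends on the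
   size of the noise only ([life_span]); an exponential weight in time gives
   uniqueness among all continuous paths ([solution_unique]), and the solution is a
   Lipschitz function of the noise ([solution_lipschitz]).  H^s norms are expressed
   by Fourier coefficients throughout; Bessel's inequality and the Riesz-Fischer
   theorem translate between them and the norms of functions on the torus
   ([sobolev2_hs], [hs_sobolev2]). *)

(** * Complex numbers and finite l2 sums *)

Lemma le_of_eq (disp : Order.disp_t) (T : porderType disp) (x y : T) :
  x = y -> (x <= y)%O.
Proof. by move=> ->. Qed.

Section finite_l2.
Variable R : realType.
Implicit Types z w : R[i].

Lemma cabs_ge0 z : 0 <= cabs z.
Proof. by case: z => a b; rewrite /cabs /= sqrtr_ge0. Qed.

Lemma cabsM z w : cabs (z * w) = cabs z * cabs w.
Proof. exact: ComplexField.Normc.normcM. Qed.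

Lemma cabsD z w : cabs (z + w) <= cabs z + cabs w.
Proof. exact: le_normcD. Qed.

Lemma cabs0 : cabs (0 : R[i]) = 0.
Proof. exact: ComplexField.Normc.normc0. Qed.

Lemma cabsN z : cabs (- z) = cabs z.
Proof. exact: normcN. Qed.

Lemma cabs_real (x : R) : cabs (real_complex R x) = `|x|.
Proof. by rewrite /cabs /= expr0n addr0 sqrtr_sqr. Qed.

Lemma cabs_sqr z : cabs z ^+ 2 = complex.Re z ^+ 2 + complex.Im z ^+ 2.
Proof. by case: z => a b; rewrite /cabs /= sqr_sqrtr // addr_ge0 // sqr_ge0. Qed.

Lemma cabs_conj z : cabs (conjc z) = cabs z.
Proof. by case: z => a b; rewrite /cabs /= sqrrN. Qed.

Lemma mulc_conj z : z * conjc z = real_complex R (cabs z ^+ 2).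
Proof.
rewrite cabs_sqr; case: z => a b; apply/eqP; rewrite eq_complex /=.
by apply/andP; split; apply/eqP; ring.
Qed.

Lemma cabs_sum (I : Type) (s : seq I) (P : pred I) (f : I -> R[i]) :
  cabs (\sum_(i <- s | P i) f i) <= \sum_(i <- s | P i) cabs (f i).
Proof.
elim/big_ind2 : _ => [|a b c d ab cd|//]; first by rewrite cabs0.
by apply: le_trans (cabsD _ _) _; exact: lerD.
Qed.

Lemma norm_Re_le z : `|complex.Re z| <= cabs z.
Proof.
rewrite -(@ler_pXn2r _ 2) ?nnegrE ?cabs_ge0 // cabs_sqr real_normK ?num_real //.
by rewrite lerDl sqr_ge0.
Qed.

Lemma norm_Im_le z : `|complex.Im z| <= cabs z.
Proof.
rewrite -(@ler_pXn2r _ 2) ?nnegrE ?cabs_ge0 // cabs_sqr real_normK ?num_real //.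
by rewrite lerDr sqr_ge0.
Qed.

Lemma cabs_le_ReIm z : cabs z <= `|complex.Re z| + `|complex.Im z|.
Proof.
rewrite -(@ler_pXn2r _ 2) ?nnegrE ?cabs_ge0 ?addr_ge0 // cabs_sqr sqrrD.
rewrite !real_normK ?num_real // addrAC lerDl.
by rewrite mulrn_wge0 // mulr_ge0.
Qed.

Lemma cabs_eq0 z : cabs z = 0 -> z = 0.
Proof. exact: ComplexField.Normc.eq0_normc. Qed.

Lemma cReM z w : complex.Re (z * w) =
  complex.Re z * complex.Re w - complex.Im z * complex.Im w.
Proof. by case: z w => a b [c e]. Qed.

Lemma cImM z w : complex.Im (z * w) =
  complex.Re z * complex.Im w + complex.Im z * complex.Re w.
Proof. by case: z w => a b [c e]. Qed.

Lemma cauchy_schwarz_step (x y S a b : R) : 0 <= a -> 0 <= b -> S <= a * b ->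
  x * y + S <= Num.sqrt (x ^+ 2 + a ^+ 2) * Num.sqrt (y ^+ 2 + b ^+ 2).
Proof.
move=> a0 b0 Sab.
apply: (@le_trans _ _ (`|x * y + a * b|)).
  by apply: le_trans (ler_norm _); rewrite lerD2l.
rewrite -sqrtrM ?addr_ge0 ?sqr_ge0 // -sqrtr_sqr ler_wsqrtr //.
rewrite -subr_ge0 (_ : _ - _ = (x * b - y * a) ^+ 2) ?sqr_ge0 //; ring.
Qed.

Lemma cauchy_schwarz (I : Type) (s : seq I) (f g : I -> R) :
  \sum_(i <- s) f i * g i <=
  Num.sqrt (\sum_(i <- s) f i ^+ 2) * Num.sqrt (\sum_(i <- s) g i ^+ 2).
Proof.
elim: s => [|x s IH]; first by rewrite !big_nil sqrtr0 mul0r.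
rewrite !big_cons; apply: le_trans (cauchy_schwarz_step _ _ _ _ IH) _;
  rewrite ?sqrtr_ge0 //.
by rewrite !sqr_sqrtr //; apply: sumr_ge0 => i _; rewrite sqr_ge0.
Qed.

Definition l2 (I : Type) (s : seq I) (u : I -> R[i]) : R :=
  Num.sqrt (\sum_(i <- s) cabs (u i) ^+ 2).

Section l2.
Variable I : Type.
Implicit Types (s : seq I) (u v : I -> R[i]).

Lemma l2_ge0 s u : 0 <= l2 s u. Proof. exact: sqrtr_ge0. Qed.

Lemma l2_sqr s u : l2 s u ^+ 2 = \sum_(i <- s) cabs (u i) ^+ 2.
Proof. by rewrite sqr_sqrtr // sumr_ge0 // => i _; exact: sqr_ge0. Qed.

Lemma l2_leP s u A : 0 <= A ->
  (l2 s u <= A) = (\sum_(i <- s) cabs (u i) ^+ 2 <= A ^+ 2).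
Proof.
by move=> A0; rewrite -l2_sqr ler_pXn2r // nnegrE l2_ge0.
Qed.

Lemma cabs_dot_le s u v :
  cabs (\sum_(i <- s) u i * v i) <= l2 s u * l2 s v.
Proof.
apply: le_trans (cabs_sum _ _ _) _.
under eq_bigr do rewrite cabsM.
exact: cauchy_schwarz.
Qed.

(** Duality: the l2 norm is attained at the conjugate vector. *)
Lemma l2_dual s u A : 0 <= A ->
  (forall v, cabs (\sum_(i <- s) u i * v i) <= A * l2 s v) -> l2 s u <= A.
Proof.
move=> A0 H; have := H (fun i => conjc (u i)).
under eq_bigr do rewrite mulc_conj.
rewrite -rmorph_sum cabs_real -l2_sqr ger0_norm ?sqr_ge0 //.
rewrite {2}/l2; under eq_bigr do rewrite cabs_conj.
rewrite -/(l2 s u) expr2 => H2.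
have [<- //|l0] := eqVneq 0 (l2 s u).
by rewrite ler_pM2r // lt_neqAle l0 l2_ge0 in H2.
Qed.

Lemma l2D s u v : l2 s (fun i => u i + v i) <= l2 s u + l2 s v.
Proof.
apply: l2_dual => [|w]; first by rewrite addr_ge0 ?l2_ge0.
under eq_bigr do rewrite mulrDl.
rewrite big_split mulrDl; apply: le_trans (cabsD _ _) _.
by rewrite lerD // cabs_dot_le.
Qed.

Lemma l2_scale s (a : I -> R) u F : 0 <= F ->
  (forall i, `|a i| <= F) ->
  l2 s (fun i => real_complex R (a i) * u i) <= F * l2 s u.
Proof.
move=> F0 aF; rewrite l2_leP ?mulr_ge0 ?l2_ge0 // exprMn l2_sqr mulr_sumr.
apply: ler_sum => i _; rewrite cabsM exprMn cabs_real.
by rewrite ler_wpM2r ?sqr_ge0 // lerXn2r ?nnegrE.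
Qed.

End l2.

Lemma eq_l2 (I : eqType) (s : seq I) (u v : I -> R[i]) :
  {in s, u =1 v} -> l2 s u = l2 s v.
Proof. by move=> uv; congr Num.sqrt; apply: eq_big_seq => i /uv ->. Qed.

Lemma l2_scale_in (I : eqType) (s : seq I) (a : I -> R) u F : 0 <= F ->
  (forall i, i \in s -> `|a i| <= F) ->
  l2 s (fun i => real_complex R (a i) * u i) <= F * l2 s u.
Proof.
move=> F0 aF.
rewrite (@eq_l2 _ _ _ (fun i => real_complex R (if i \in s then a i else 0) * u i)).
  by apply: l2_scale => // i; case: ifPn => [/aF //|_]; rewrite normr0.
by move=> i si; rewrite si.
Qed.

End finite_l2.

(** * Schur multipliers on finite matrices *)

Section schur.
Variables (R : realType) (X Y : eqType) (s : seq X) (t : seq Y).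
Implicit Types (A : X -> Y -> R[i]) (f g : X -> Y -> R).

Definition op_bounded A (a : R) : Prop := forall u v,
  cabs (\sum_(x <- s) \sum_(y <- t) u x * A x y * v y) <= a * l2 s u * l2 t v.

(** [f] is a Schur multiplier of norm at most [c] for matrices indexed by [s]
   and [t]. *)
Definition schur f (c : R) : Prop := forall A a, 0 <= a -> op_bounded A a ->
  op_bounded (fun x y => real_complex R (f x y) * A x y) (c * a).

Lemma eq_op_bounded A A' a : (forall x y, x \in s -> y \in t -> A x y = A' x y) ->
  op_bounded A a -> op_bounded A' a.
Proof.
move=> AA' HA u v; apply: le_trans (HA u v).
apply: le_of_eq; congr cabs.
by apply: eq_big_seq => x xs; apply: eq_big_seq => y yt; rewrite AA'.
Qed.

Lemma op_bounded_le A a b : a <= b -> op_bounded A a -> op_bounded A b.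
Proof.
move=> ab HA u v; apply: le_trans (HA u v) _.
by rewrite -!mulrA ler_wpM2r // mulr_ge0 ?l2_ge0.
Qed.

Lemma eq_schur f g c : (forall x y, x \in s -> y \in t -> f x y = g x y) ->
  schur f c -> schur g c.
Proof.
move=> fg Hf A a a0 HA; apply: eq_op_bounded (Hf A a a0 HA) => x y xs yt.
by rewrite fg.
Qed.

Lemma schur_le f c c' : c <= c' -> schur f c -> schur f c'.
Proof.
move=> cc' Hf A a a0 HA; apply: op_bounded_le (Hf A a a0 HA).
by rewrite ler_wpM2r.
Qed.

Lemma schurM f g c c' : 0 <= c -> schur f c' -> schur g c ->
  schur (fun x y => f x y * g x y) (c' * c).
Proof.
move=> c0 Hf Hg A a a0 HA; rewrite -mulrA.
apply: eq_op_bounded (Hf _ _ _ (Hg A a a0 HA)); last exact: mulr_ge0.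
by move=> x y _ _; rewrite /= rmorphM mulrA.
Qed.

Lemma schurD f g c c' : schur f c -> schur g c' ->
  schur (fun x y => f x y + g x y) (c + c').
Proof.
move=> Hf Hg A a a0 HA u v.
under eq_bigr do under eq_bigr do rewrite rmorphD mulrDl mulrDr mulrDl.
under eq_bigr do rewrite big_split.
rewrite big_split !mulrDl; apply: le_trans (cabsD _ _) _.
by apply: lerD; [exact: Hf|exact: Hg].
Qed.

Lemma schur_tensor (p : X -> R) (q : Y -> R) a b : 0 <= a -> 0 <= b ->
  (forall x, x \in s -> `|p x| <= a) -> (forall y, y \in t -> `|q y| <= b) ->
  schur (fun x y => p x * q y) (a * b).
Proof.
move=> a0 b0 pa qb A e e0 HA u v.
have := HA (fun x => real_complex R (p x) * u x) (fun y => real_complex R (q y) * v y).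
move=> H; apply: (le_trans _ (le_trans H _)).
  apply: le_of_eq; congr cabs.
  by apply: eq_bigr => x _; apply: eq_bigr => y _; rewrite rmorphM; ring.
rewrite (_ : a * b * e * l2 s u * l2 t v = e * (a * l2 s u) * (b * l2 t v)); last by ring.
by rewrite ler_pM ?mulr_ge0 ?l2_ge0 ?ler_wpM2l // l2_scale_in.
Qed.

Lemma schur_cst c : schur (fun _ _ => c) `|c|.
Proof.
rewrite -[`|c|]mulr1; apply: eq_schur (@schur_tensor (fun=> c) (fun=> 1) _ 1 _ _ _ _) => //.
- by move=> x y _ _; rewrite mulr1.
- by move=> y _; rewrite normr1.
Qed.

Lemma schur1 : schur (fun _ _ => 1) 1.
Proof. by rewrite -{2}(@normr1 R); exact: schur_cst. Qed.

Lemma schur0 : schur (fun _ _ => 0) 0.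
Proof. by have := schur_cst 0; rewrite normr0. Qed.

Lemma schurN f c : schur f c -> schur (fun x y => - f x y) c.
Proof.
move=> Hf A a a0 HA u v; apply: le_trans (Hf A a a0 HA u v).
rewrite -cabsN -sumrN; apply: le_of_eq; congr cabs.
apply: eq_bigr => x _; rewrite -sumrN; apply: eq_bigr => y _.
by rewrite rmorphN /=; ring.
Qed.

Lemma schurB1 f c : schur f c -> schur (fun x y => 1 - f x y) (1 + c).
Proof. by move=> Hf; apply: schurD schur1 (schurN Hf). Qed.

Lemma schurX f c n : 0 <= c -> schur f c -> schur (fun x y => f x y ^+ n) (c ^+ n).
Proof.
move=> c0 Hf; elim: n => [|n IH].
  by apply: eq_schur schur1 => x y _ _; rewrite expr0.
rewrite exprS; apply: eq_schur (schurM _ Hf IH); last exact: exprn_ge0.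
by move=> x y _ _; rewrite exprS.
Qed.

(** Multiplying entrywise by a Gram matrix is a sum over [k] of a left and a
   right product with diagonal matrices; the Cauchy-Schwarz inequality in [k]
   recombines the pieces. *)
Lemma schur_gram (K : Type) (r : seq K) (p : X -> K -> R) (q : Y -> K -> R) a b :
  0 <= a -> 0 <= b ->
  (forall x, x \in s -> \sum_(k <- r) p x k ^+ 2 <= a ^+ 2) ->
  (forall y, y \in t -> \sum_(k <- r) q y k ^+ 2 <= b ^+ 2) ->
  schur (fun x y => \sum_(k <- r) p x k * q y k) (a * b).
Proof.
move=> a0 b0 pa qb A e e0 HA u v.
pose P k x := real_complex R (p x k) * u x.
pose Q k y := real_complex R (q y k) * v y.
have -> : \sum_(x <- s) \sum_(y <- t)
    u x * (real_complex R (\sum_(k <- r) p x k * q y k) * A x y) * v y =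
  \sum_(k <- r) \sum_(x <- s) \sum_(y <- t) P k x * A x y * Q k y.
  rewrite [RHS]exchange_big /=; apply: eq_bigr => x _.
  rewrite [RHS]exchange_big /=; apply: eq_bigr => y _.
  rewrite rmorph_sum mulr_suml mulr_sumr mulr_suml; apply: eq_bigr => k _.
  by rewrite rmorphM /P /Q; ring.
apply: le_trans (cabs_sum _ _ _) _.
apply: le_trans (ler_sum _ (fun k _ => HA (P k) (Q k))) _.
under eq_bigr do rewrite -mulrA.
rewrite -mulr_sumr (_ : a * b * e * l2 s u * l2 t v = e * ((a * l2 s u) * (b * l2 t v)));
  last by ring.
rewrite ler_wpM2l //; apply: le_trans (cauchy_schwarz _ _ _) _.
have aux (Z : eqType) (z : seq Z) (h : Z -> K -> R) (w : Z -> R[i]) c : 0 <= c ->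
    (forall x, x \in z -> \sum_(k <- r) h x k ^+ 2 <= c ^+ 2) ->
    Num.sqrt (\sum_(k <- r) l2 z (fun x => real_complex R (h x k) * w x) ^+ 2) <=
    c * l2 z w.
  move=> c0 hc; rewrite -[leRHS]ger0_norm ?mulr_ge0 ?l2_ge0 // -sqrtr_sqr.
  apply: ler_wsqrtr; rewrite exprMn l2_sqr.
  under eq_bigr do rewrite l2_sqr.
  rewrite exchange_big mulr_sumr /= big_seq [leRHS]big_seq; apply: ler_sum => x xz.
  under eq_bigr do rewrite cabsM exprMn cabs_real real_normK ?num_real //.
  by rewrite -mulr_suml ler_wpM2r ?sqr_ge0 // hc.
by apply: ler_pM; rewrite ?sqrtr_ge0 ?aux.
Qed.

(** Only finitely many entries occur, so that the effect of a uniform error is at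
   most its size times [K], the sum of the moduli of the terms. *)
Lemma schur_approx f c :
  (forall e, 0 < e -> exists2 g, schur g c &
     forall x y, x \in s -> y \in t -> `|f x y - g x y| <= e) -> schur f c.
Proof.
move=> H A a a0 HA u v.
pose K := \sum_(x <- s) \sum_(y <- t) cabs (u x * A x y * v y).
have K0 : 0 <= K by apply: sumr_ge0 => x _; apply: sumr_ge0 => y _; exact: cabs_ge0.
apply/ler_addgt0Pr => e e0.
have [g Hg fg] := H (e / (K + 1)) (divr_gt0 e0 (ltr_wpDl K0 ltr01)).
have -> : \sum_(x <- s) \sum_(y <- t) u x * (real_complex R (f x y) * A x y) * v y =
  (\sum_(x <- s) \sum_(y <- t) u x * (real_complex R (g x y) * A x y) * v y) +
  \sum_(x <- s) \sum_(y <- t) real_complex R (f x y - g x y) * (u x * A x y * v y).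
  rewrite -big_split; apply: eq_bigr => x _; rewrite -big_split; apply: eq_bigr => y _.
  by rewrite rmorphB /=; ring.
apply: le_trans (cabsD _ _) _; apply: lerD; first exact: Hg.
apply: (@le_trans _ _ (e / (K + 1) * K)); last first.
  by rewrite mulrAC ler_pdivrMr ?ltr_wpDl // ler_wpM2l ?ltW // ltrDl.
apply: le_trans (cabs_sum _ _ _) _.
rewrite mulr_sumr big_seq [leRHS]big_seq; apply: ler_sum => x xs.
apply: le_trans (cabs_sum _ _ _) _.
rewrite mulr_sumr big_seq [leRHS]big_seq; apply: ler_sum => y yt.
by rewrite cabsM cabs_real ler_wpM2r ?cabs_ge0 // fg.
Qed.

End schur.

(** * Fractional powers of Schur multipliers *)

Lemma near_seq_forall (I : eqType) (s : seq I) (P : I -> nat -> Prop) :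
  (forall x, x \in s -> \forall i \near \oo, P x i) ->
  \forall i \near \oo, forall x, x \in s -> P x i.
Proof.
elim: s => [|x s IH] H; first by apply: nearW => i y; rewrite in_nil.
have Hx : \forall i \near \oo, P x i by apply: H; rewrite mem_head.
have Hs : \forall i \near \oo, forall y, y \in s -> P y i.
  by apply: IH => y ys; apply: H; rewrite in_cons ys orbT.
near=> i => y; rewrite in_cons => /predU1P[->|ys].
  by near: i.
by move: y ys; near: i.
Unshelve. all: by end_near.
Qed.

Section schur_powers.
Variables (R : realType) (X Y : eqType) (s : seq X) (t : seq Y).
Implicit Types (f g : X -> Y -> R).

Lemma schur_lim (g : nat -> X -> Y -> R) f c : (forall i, schur s t (g i) c) ->
  (forall x y, x \in s -> y \in t -> g i x y @[i --> \oo] --> f x y) ->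
  schur s t f c.
Proof.
move=> Hg gf; apply: schur_approx => e e0.
have : \forall i \near \oo, forall x, x \in s -> forall y, y \in t ->
    `|f x y - g i x y| <= e.
  apply: near_seq_forall => x xs; apply: near_seq_forall => y yt.
  by have /cvgrPdist_le/(_ _ e0) := gf x y xs yt.
by case=> n _ /(_ n (leqnn n)) H; exists (g n) => // x y xs yt; exact: H.
Qed.

(** Stated as the one invariant that survives the square roots below: both the
   entries and the Schur norm of [1 - f] are bounded by some [q < 1]. *)
Definition near_one f (q : R) : Prop :=
  [/\ 0 <= q < 1, forall x y, x \in s -> y \in t -> `|1 - f x y| <= q
    & schur s t (fun x y => 1 - f x y) q].

Lemma near_one_ge f q x y : near_one f q -> x \in s -> y \in t ->
  1 - q <= f x y.
Proof.
by case=> _ + _ xs yt => /(_ x y xs yt); rewrite ler_distl => /andP[]; lra.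
Qed.

Lemma near_one_le f q x y : near_one f q -> x \in s -> y \in t ->
  f x y <= 1 + q.
Proof.
by case=> _ + _ xs yt => /(_ x y xs yt); rewrite ler_distl => /andP[]; lra.
Qed.

Lemma near_one_gt0 f q x y : near_one f q -> x \in s -> y \in t -> 0 < f x y.
Proof.
by move=> H xs yt; apply: lt_le_trans (near_one_ge H xs yt); case: H => /andP[]; lra.
Qed.

(** [1 - sqrt f] is the limit of the iteration [y := (x + y ^ 2) / 2] with
   [x = 1 - f].  Its coefficients are nonnegative, so the same iteration started
   from [x = q] is a majorant, and its limit is [1 - sqrt (1 - q)]. *)
Lemma near_one_sqrt f q : near_one f q ->
  near_one (fun x y => Num.sqrt (f x y)) (1 - Num.sqrt (1 - q)).
Proof.
move=> H; have [/andP[q0 q1] fq Sf] := H.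
set k := 1 - _.
have s0 : 0 < Num.sqrt (1 - q) by rewrite sqrtr_gt0 subr_gt0.
have sE : Num.sqrt (1 - q) ^+ 2 = 1 - q by rewrite sqr_sqrtr // subr_ge0 ltW.
have k1 : k < 1 by rewrite /k; lra.
have k0 : 0 <= k.
  by rewrite /k subr_ge0 -[leRHS]sqrtr1 ler_wsqrtr // gerBl.
have kE : k = (q + k ^+ 2) / 2 by rewrite /k; move: sE; set z := Num.sqrt _; nra.
pose y := fix y n a b : R := if n is n'.+1 then (1 - f a b + y n' a b ^+ 2) / 2 else 0.
have yk n a b : a \in s -> b \in t -> `|y n a b| <= k.
  move=> sa tb; elim: n => [|n IH] /=; first by rewrite normr0.
  rewrite normrM [X in _ * X]gtr0_norm // [leRHS]kE ler_wpM2r //.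
  apply: le_trans (ler_normD _ _) _; rewrite lerD ?fq // normrX.
  by rewrite lerXn2r ?nnegrE.
have Sy n : schur s t (y n) k.
  elim: n => [|n IH] /=.
    by apply: schur_le k0 _; exact: schur0.
  have := schurM _ (schurD Sf (schurX 2 k0 IH)) (@schur_cst R X Y s t 2^-1).
  by rewrite [`|2^-1|]gtr0_norm // -kE; apply.
have lim_k a b : a \in s -> b \in t -> `|1 - Num.sqrt (f a b)| <= k.
  move=> sa tb; have f0 := near_one_gt0 H sa tb.
  have fl := near_one_ge H sa tb; have fu := near_one_le H sa tb.
  have lo : Num.sqrt (1 - q) <= Num.sqrt (f a b) by rewrite ler_wsqrtr.
  have up : Num.sqrt (f a b) <= 1 + k.
    have k2 : 0 <= 1 + k by rewrite addr_ge0.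
    rewrite -[leRHS](ger0_norm k2) -sqrtr_sqr ler_wsqrtr //.
    by apply: le_trans fu _; have := sqr_ge0 k; nra.
  by rewrite ler_distl; apply/andP; split; [move: up|move: lo; rewrite /k]; lra.
split => //; first by rewrite k0.
apply: schur_lim Sy _ => a b sa tb.
have f0 := near_one_gt0 H sa tb.
have yl n : `|1 - Num.sqrt (f a b) - y n a b| <= k ^+ n.+1.
  elim: n => [|n IH] /=; first by rewrite subr0 expr1 lim_k.
  have -> : 1 - Num.sqrt (f a b) - (1 - f a b + y n a b ^+ 2) / 2 =
     (1 - Num.sqrt (f a b) - y n a b) * ((1 - Num.sqrt (f a b) + y n a b) / 2).
    by have := sqr_sqrtr (ltW f0); set z := Num.sqrt _ => <-; field.
  rewrite normrM exprSr ler_pM // normrM [X in _ * X]gtr0_norm //.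
  rewrite ler_pdivrMr //; apply: le_trans (ler_normD _ _) _.
  by have := lim_k a b sa tb; have := yk n a b sa tb; lra.
apply/cvgrPdist_le => e e0.
have /cvgrPdist_le/(_ _ e0) : k ^+ n @[n --> \oo] --> 0.
  by apply: cvg_expr; rewrite ger0_norm.
apply: filterS => n; rewrite sub0r normrN ger0_norm ?exprn_ge0 // => kn.
apply: le_trans (yl n) _; apply: le_trans kn.
by rewrite exprS ler_piMl ?exprn_ge0 // ltW.
Qed.

Definition dyad (i : nat) : R := (2 ^+ i)^-1.

Lemma dyad_gt0 i : 0 < dyad i. Proof. by rewrite invr_gt0 exprn_gt0. Qed.

Lemma cvg_dyad : dyad i @[i --> \oo] --> 0.
Proof.
under eq_fun do rewrite /dyad -exprVn.
by apply: cvg_expr; rewrite ger0_norm ?invr_ge0 // invf_lt1 // ltr1n.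
Qed.

Lemma near_one_ext f g q : (forall x y, x \in s -> y \in t -> f x y = g x y) ->
  near_one f q -> near_one g q.
Proof.
move=> fg [q01 fq Sf]; split => //; first by move=> x y xs yt; rewrite -fg // fq.
by apply: eq_schur Sf => x y xs yt; rewrite fg.
Qed.

Lemma near_one_dyad f q i : near_one f q ->
  near_one (fun x y => f x y `^ dyad i) (1 - (1 - q) `^ dyad i).
Proof.
move=> H; have [/andP[q0 q1] _ _] := H.
elim: i => [|i IH].
  rewrite /dyad expr0 invr1 powRr1 ?subr_ge0 ?ltW // subKr.
  apply: (near_one_ext _ H) => x y xs yt; rewrite powRr1 //.
  exact/ltW/(near_one_gt0 H).
have E a : 0 <= a -> a `^ dyad i.+1 = Num.sqrt (a `^ dyad i).
  move=> a0; rewrite -powR12_sqrt ?powR_ge0 // -powRrM /dyad exprSr invfM //.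
have := near_one_sqrt IH; rewrite subKr -E ?subr_ge0 ?ltW //.
by apply: near_one_ext => x y xs yt; rewrite E // ltW // (near_one_gt0 H).
Qed.

(** Neumann series in [1 - f]. *)
Lemma schur_inv f q : near_one f q -> schur s t (fun x y => (f x y)^-1) (1 - q)^-1.
Proof.
move=> H; have [/andP[q0 q1] fq Sf] := H.
pose y := fix y n a b : R := if n is n'.+1 then 1 + (1 - f a b) * y n' a b else 0.
have q1' : 0 < 1 - q by rewrite subr_gt0.
have Sy n : schur s t (y n) (1 - q)^-1.
  elim: n => [|n IH] /=.
    apply: (@schur_le _ _ _ _ _ _ 0); first by rewrite invr_ge0 ltW.
    exact: schur0.
  have -> : (1 - q)^-1 = 1 + q * (1 - q)^-1 by field; rewrite gt_eqF.
  by apply: schurD (@schur1 _ _ _ _ _) (schurM _ Sf IH); rewrite invr_ge0 ltW.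
apply: schur_lim Sy _ => a b sa tb.
have f0 := near_one_gt0 H sa tb.
have yl n : `|(f a b)^-1 - y n a b| <= q ^+ n * (f a b)^-1.
  elim: n => [|n IH] /=; first by rewrite subr0 mul1r ger0_norm // invr_ge0 ltW.
  have -> : (f a b)^-1 - (1 + (1 - f a b) * y n a b) =
     (1 - f a b) * ((f a b)^-1 - y n a b).
    by field; rewrite gt_eqF.
  by rewrite normrM exprS -mulrA ler_pM // fq.
apply/cvgrPdist_le => e e0.
have /cvgrPdist_le/(_ _ (mulr_gt0 e0 f0)) : q ^+ n @[n --> \oo] --> 0.
  by apply: cvg_expr; rewrite ger0_norm.
apply: filterS => n; rewrite sub0r normrN ger0_norm ?exprn_ge0 // => kn.
by apply: le_trans (yl n) _; rewrite ler_pdivrMr.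
Qed.

(** Approximate [k] from below by dyadic numbers [m / 2 ^ i]: the corresponding
   powers are obtained by iterated square roots, an inverse and an integer
   power, with constants that stay below the expected one. *)
Lemma schur_powRN f q (k : R) : near_one f q -> 0 <= k ->
  schur s t (fun x y => f x y `^ (- k)) ((1 - q) `^ (- k)).
Proof.
move=> H k0; have [/andP[q0 q1] _ _] := H.
have q1' : 0 < 1 - q by rewrite subr_gt0.
pose m i := Num.truncn (k * 2 ^+ i).
have mk i : (m i)%:R * dyad i <= k.
  by rewrite ler_pdivrMr ?exprn_gt0 // truncn_le ?mulr_ge0 // exprn_ge0.
have km i : k - (m i)%:R * dyad i <= dyad i.
  rewrite -[X in _ <= X]mul1r lerBlDr -mulrDl ler_pdivlMr ?exprn_gt0 //.
  by rewrite addrC natr1 ltW // truncnS_gt.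
have powE (a : R) i : 0 < a -> (a `^ dyad i)^-1 ^+ m i = a `^ (- ((m i)%:R * dyad i)).
  move=> a0; rewrite -powRN -powR_mulrn ?powR_ge0 // -powRrM mulrC.
  by rewrite mulrN.
apply: (@schur_lim (fun i x y => (f x y `^ dyad i)^-1 ^+ m i)).
  move=> i; have := schur_inv (near_one_dyad i H); rewrite subKr => Si.
  apply: schur_le (schurX (m i) _ Si); last by rewrite invr_ge0 powR_ge0.
  by rewrite powE // ger_powR ?q1' ?gerBl //= lerN2 mk.
move=> a b sa tb; have f0 := near_one_gt0 H sa tb.
under eq_fun do rewrite powE //.
have -> : (fun n => f a b `^ (- ((m n)%:R * dyad n))) =
    expR \o (fun n => (- ((m n)%:R * dyad n)) * ln (f a b)).
  by apply/funext => n /=; rewrite /powR gt_eqF.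
rewrite /powR gt_eqF //.
apply: continuous_cvg; first exact: continuous_expR.
apply: cvgMl; apply: cvgN.
apply/cvgrPdist_le => e e0.
have /cvgrPdist_le/(_ _ e0) := cvg_dyad; apply: filterS => n.
rewrite sub0r normrN (ger0_norm (ltW (dyad_gt0 n))).
by rewrite ger0_norm ?subr_ge0 ?mk //; exact: le_trans.
Qed.

End schur_powers.

(** A positive power is a dyadic power, bounded by iterated square roots, times
   a small negative power. *)
Lemma schur_powR (R : realType) (a r : R) : 0 < r -> a < r ->
  exists2 C : R, 0 <= C &
  forall (X Y : eqType) (s : seq X) (t : seq Y) f q, near_one s t f q ->
    schur s t (fun x y => f x y `^ a) (C * (1 - q) `^ (a - r)).
Proof.
move=> r0 ar; pose g := Num.min r (r - a).
have g0 : 0 < g by rewrite lt_min r0 subr_gt0.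
have [i ig] : exists i, @dyad R i < g.
  have /cvgrPdist_lt/(_ _ g0) [i _ /(_ i (leqnn i))] := @cvg_dyad R.
  by rewrite sub0r normrN (ger0_norm (ltW (dyad_gt0 R i))) => ig; exists i.
pose m := Num.truncn (r * 2 ^+ i).
have mr : m%:R * dyad R i <= r.
  by rewrite ler_pdivrMr ?exprn_gt0 // truncn_le ?mulr_ge0 ?exprn_ge0 // ltW.
have rm : r < m%:R * dyad R i + dyad R i.
  rewrite -[X in _ + X]mul1r -mulrDl ltr_pdivlMr ?exprn_gt0 //.
  by rewrite natr1 truncnS_gt.
have am : 0 <= m%:R * dyad R i - a.
  by move: ig; rewrite /g lt_min => /andP[_]; move: rm; lra.
exists (2 ^+ m) => [|X Y s t f q H]; first exact: exprn_ge0.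
have [/andP[q0 q1] _ _] := H.
have q1' : 0 < 1 - q by rewrite subr_gt0.
have Sd : schur s t (fun x y => f x y `^ dyad R i) 2.
  have [/andP[_ h1] _ /schurB1] := near_one_dyad i H.
  move=> S; apply: (@schur_le _ _ _ _ _ _ (1 + (1 - (1 - q) `^ dyad R i))).
    by have := powR_ge0 (1 - q) (dyad R i); lra.
  by apply: eq_schur S => x y _ _; rewrite subKr.
have := schurM _ (schurX m _ Sd) (schur_powRN H am).
move=> /(_ (powR_ge0 _ _) (ler0n _ 2)) S.
apply: (@schur_le _ _ _ _ _ _ (2 ^+ m * (1 - q) `^ (- (m%:R * dyad R i - a)))).
  rewrite ler_wpM2l ?exprn_ge0 // ger_powR ?q1' ?gerBl //=; last by move: mr; lra.
apply: eq_schur S => x y xs yt.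
have f0 := near_one_gt0 H xs yt.
rewrite -powR_mulrn ?powR_ge0 // -powRrM -powRD ?(gt_eqF f0) ?implybT //.
by congr powR; ring.
Qed.

(** * The weight on differences of frequencies as a Schur multiplier *)

Section frequencies.
Variables (R : realType) (d : nat).
Implicit Types x y z n m : 'rV[int]_d.

Lemma freq_sqnorm_ge0 n : 0 <= freq_sqnorm R n.
Proof. by apply: sumr_ge0 => j _; exact: sqr_ge0. Qed.

Lemma freq_bracket_gt0 n : 0 < 1 + freq_sqnorm R n.
Proof. by rewrite ltr_pwDl // freq_sqnorm_ge0. Qed.

Lemma jap_gt0 n (s : R) : 0 < jap n s.
Proof. by rewrite powR_gt0 // freq_bracket_gt0. Qed.

Lemma jap_ge0 n (s : R) : 0 <= jap n s.
Proof. exact/ltW/jap_gt0. Qed.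

Lemma jap_neq0 n (s : R) : jap n s != 0.
Proof. by rewrite gt_eqF // jap_gt0. Qed.

Lemma japD n (s r : R) : jap n (s + r) = jap n s * jap n r.
Proof.
by rewrite /jap -powRD ?mulrDl // (gt_eqF (freq_bracket_gt0 n)) implybT.
Qed.

Lemma jap0 n : jap n (0 : R) = 1.
Proof. by rewrite /jap mul0r powRr0. Qed.

Lemma japN n (s : R) : jap n (- s) = (jap n s)^-1.
Proof. by rewrite /jap mulNr powRN. Qed.

Lemma jap_le n (s r : R) : s <= r -> jap n s <= jap n r.
Proof.
move=> sr; apply: ler_powR; first by rewrite lerDl freq_sqnorm_ge0.
by rewrite ler_wpM2r.
Qed.

Lemma freq_sqnormN n : freq_sqnorm R (- n) = freq_sqnorm R n.
Proof. by apply: eq_bigr => j _; rewrite mxE rmorphN sqrrN. Qed.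

Lemma japNn n (s : R) : jap (- n) s = jap n s.
Proof. by rewrite /jap freq_sqnormN. Qed.

Definition freq_small n (B : R) : Prop := forall j, `|(n 0 j)%:~R : R| <= B.

Lemma freq_smallD n m B C : freq_small n B -> freq_small m C ->
  freq_small (n + m) (B + C).
Proof.
move=> nB mC j; rewrite mxE rmorphD; apply: le_trans (ler_normD _ _) _.
by rewrite lerD ?nB ?mC.
Qed.

Lemma freq_small_le n B C : B <= C -> freq_small n B -> freq_small n C.
Proof. by move=> BC nB j; exact: le_trans (nB j) BC. Qed.

Lemma freq_small_sqnorm n B : freq_small n B -> freq_sqnorm R n <= d%:R * B ^+ 2.
Proof.
move=> nB; have -> : d%:R * B ^+ 2 = \sum_(j < d) B ^+ 2.
  by rewrite sumr_const card_ord mulr_natl.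
apply: ler_sum => j _; rewrite -[leLHS]real_normK ?num_real //.
by rewrite lerXn2r ?nnegrE // (le_trans _ (nB j)).
Qed.

Lemma sqnorm_freq_small n B : 0 <= B -> freq_sqnorm R n <= B ^+ 2 -> freq_small n B.
Proof.
move=> B0 nB j; rewrite -(@ler_pXn2r _ 2) ?nnegrE // real_normK ?num_real //.
apply: le_trans nB; rewrite /freq_sqnorm (bigD1 j) //= lerDl.
by apply: sumr_ge0 => i _; exact: sqr_ge0.
Qed.

(** Stereographic projection, after rescaling by [N], maps frequencies to vectors
   [X], [Y] of a Euclidean space with
   [1 + |y + z|^2 = (N^2 / 2) a_y b_z (1 - <X_y, Y_z>)], so that fractional
   powers of the weight reduce to fractional powers of one minus a Gram matrix.
   The vectors [X] have length one; dropping the coordinate that encodes the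
   summand [1] makes the vectors [Y] shorter than that by an amount of order
   [N^-2]. *)
Lemma schur_jap (s rho K : R) : 0 < rho -> - s < rho -> 0 <= K ->
  exists2 C, 0 <= C & forall (N : R), 1 <= N ->
  forall x (S T : seq 'rV[int]_d),
    (forall y, y \in S -> freq_small (x + y) (K * N)) ->
    (forall z, z \in T -> freq_small z (K * N)) ->
    schur S T (fun y z => jap (x + y + z) (- s)) (C * N `^ rho).
Proof.
move=> rho0 srho K0.
have [C C0 HC] := @schur_powR R (- s / 2) (rho / 2)
  ltac:(by rewrite divr_gt0) ltac:(by rewrite ltr_pM2r).
pose D := 2 + d%:R * K ^+ 2.
have D2 : 2 <= D by rewrite lerDl mulr_ge0 ?sqr_ge0.
have D0 : 0 < D by lra.
pose th := - s / 2.
pose c := 2 / D ^+ 2.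
have c0 : 0 < c by rewrite divr_gt0 // exprn_gt0.
have c1 : c < 1 by rewrite ltr_pdivrMr ?exprn_gt0 // mul1r; nra.
exists (C * (2^-1 `^ th * (D `^ `|th| * D `^ `|th|) * c `^ (th - rho / 2))).
  by rewrite !mulr_ge0 ?powR_ge0.
move=> N N1 x S T HS HT.
have N0 : 0 < N by lra.
pose P y := freq_sqnorm R (x + y) / N ^+ 2.
pose Q z := (freq_sqnorm R z + 1) / N ^+ 2.
pose a y := 1 + P y.
pose b z := 1 + Q z.
have NN : 0 < N ^+ 2 by rewrite exprn_gt0.
have P0 y : 0 <= P y by rewrite divr_ge0 ?freq_sqnorm_ge0 ?ltW.
have Q0 y : 0 <= Q y by rewrite divr_ge0 ?addr_ge0 ?freq_sqnorm_ge0 ?ltW.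
have aD y : y \in S -> a y <= D.
  move=> yS; have := freq_small_sqnorm (HS y yS); rewrite exprMn mulrA => h.
  have : P y <= d%:R * K ^+ 2 by rewrite ler_pdivrMr.
  by rewrite /a /D; lra.
have bD z : z \in T -> b z <= D.
  move=> zT; have := freq_small_sqnorm (HT z zT); rewrite exprMn mulrA => h.
  have : Q z <= d%:R * K ^+ 2 + 1.
    rewrite ler_pdivrMr // mulrDl mul1r lerD //.
    by rewrite -[leLHS](expr1n _ 2) lerXn2r ?nnegrE // ltW.
  by rewrite /b /D; lra.
pose X y (k : option 'I_d) : R :=
  if k is Some j then 2 * ((x + y) 0 j)%:~R / N / a y else (P y - 1) / a y.
pose Y z (k : option 'I_d) : R :=
  if k is Some j then - (2 * (z 0 j)%:~R / N / b z) else (Q z - 1) / b z.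
pose r : seq (option 'I_d) := None :: [seq Some j | j <- index_enum 'I_d].
have a1 y : 1 <= a y by rewrite lerDl.
have b1 y : 1 <= b y by rewrite lerDl.
have a0 y : a y != 0 by rewrite gt_eqF // (lt_le_trans ltr01).
have b0 y : b y != 0 by rewrite gt_eqF // (lt_le_trans ltr01).
have N0' : N != 0 by rewrite gt_eqF.
have X1 y : \sum_(k <- r) X y k ^+ 2 = 1.
  rewrite big_cons big_map /=.
  rewrite (eq_bigr (fun j => 4 / N ^+ 2 / a y ^+ 2 * ((x + y) 0 j)%:~R ^+ 2)).
    rewrite -mulr_sumr -/(freq_sqnorm R (x + y)).
    have -> : freq_sqnorm R (x + y) = P y * N ^+ 2 by rewrite divfK // gt_eqF.
    by move: (a0 y); rewrite /a => v0; field; rewrite N0' v0.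
  by move=> j _; move: (_%:~R) (a y) (a0 y) => u v v0; field; rewrite N0' v0.
have Y1 z : \sum_(k <- r) Y z k ^+ 2 = 1 - 4 / (N ^+ 2 * b z ^+ 2).
  rewrite big_cons big_map /=.
  rewrite (eq_bigr (fun j => 4 / N ^+ 2 / b z ^+ 2 * (z 0 j)%:~R ^+ 2)).
    rewrite -mulr_sumr -/(freq_sqnorm R z).
    have -> : freq_sqnorm R z = Q z * N ^+ 2 - 1.
      by rewrite divfK ?gt_eqF // addrK.
    by move: (b0 z); rewrite /b => v0; field; rewrite N0' v0.
  by move=> j _; move: (_%:~R) (b z) (b0 z) => u v v0; field; rewrite N0' v0.
pose f y z := 1 - \sum_(k <- r) X y k * Y z k.
pose q := 1 - c / N ^+ 2.
have cN : c / N ^+ 2 < 1.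
  by rewrite ltr_pdivrMr // mul1r; apply: lt_le_trans c1 _; rewrite exprn_ege1.
have cN0 : 0 < c / N ^+ 2 by rewrite divr_gt0.
have q0 : 0 <= q by rewrite subr_ge0 ltW.
have Yq z : z \in T -> \sum_(k <- r) Y z k ^+ 2 <= q ^+ 2.
  move=> zT; rewrite Y1 /q.
  have : 2 * (c / N ^+ 2) <= 4 / (N ^+ 2 * b z ^+ 2).
    rewrite /c (_ : 2 * _ = 4 / (N ^+ 2 * D ^+ 2)); last first.
      by field; rewrite N0' gt_eqF.
    rewrite ler_pM2l // lef_pV2 ?posrE ?mulr_gt0 ?exprn_gt0 ?(lt_le_trans ltr01 (b1 z)) //.
    rewrite ler_pM2l // lerXn2r ?nnegrE ?bD //; first exact: le_trans (b1 z).
    exact: ltW.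
  by have := sqr_ge0 (c / N ^+ 2); nra.
have fnear : near_one S T f q.
  split; first by rewrite q0 /q gtrBl.
    move=> y z yS zT; rewrite /f subKr.
    apply: le_trans (ler_norm_sum _ _ _) _.
    under eq_bigr do rewrite normrM.
    apply: le_trans (cauchy_schwarz _ _ _) _.
    under eq_bigr do rewrite real_normK ?num_real //.
    rewrite X1 sqrtr1 mul1r -[leRHS]ger0_norm // -sqrtr_sqr ler_wsqrtr //.
    by under eq_bigr do rewrite real_normK ?num_real //; exact: Yq.
  have := @schur_gram R _ _ S T _ r X Y 1 q ler01 q0 _ Yq.
  rewrite mul1r => /(_ ltac:(by move=> y _; rewrite X1 expr1n)).
  by apply: eq_schur => y z _ _; rewrite /f subKr.
have japE y z : jap (x + y + z) (- s) =
    (2^-1 `^ th * N `^ (2 * th)) * (a y `^ th * b z `^ th) * f y z `^ th.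
  have fE : 1 + freq_sqnorm R (x + y + z) = 2^-1 * N ^+ 2 * (a y * b z) * f y z.
    rewrite /f big_cons big_map /=.
    rewrite (eq_bigr (fun j => - (4 / N ^+ 2 / a y / b z) *
      (((x + y) 0 j)%:~R * (z 0 j)%:~R))); last first.
      move=> j _; move: (_%:~R) (_%:~R) (a y) (a0 y) (b z) (b0 z) => u v w w0 o o0.
      by field; rewrite N0' w0 o0.
    have -> : freq_sqnorm R (x + y + z) = freq_sqnorm R (x + y) + freq_sqnorm R z
      + 2 * \sum_j (((x + y) 0 j)%:~R * (z 0 j)%:~R).
      rewrite mulr_sumr -!big_split; apply: eq_bigr => j _ /=.
      by rewrite [(x + y + z) 0 j]mxE rmorphD /=; ring.
    have -> : freq_sqnorm R (x + y) = P y * N ^+ 2 by rewrite divfK // gt_eqF.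
    have -> : freq_sqnorm R z = Q z * N ^+ 2 - 1.
      by rewrite divfK ?gt_eqF // addrK.
    rewrite -mulr_sumr; move: (\sum_j _) => u.
    by move: (a0 y) (b0 z); rewrite /a /b => v0 w0; field; rewrite N0' v0 w0.
  rewrite /jap fE.
  have h0 : 0 <= f y z.
    have := freq_bracket_gt0 (x + y + z); rewrite fE pmulr_rgt0 => [/ltW //|].
    by rewrite !mulr_gt0 ?exprn_gt0 // ?(lt_le_trans ltr01).
  have ay := le_trans ler01 (a1 y); have bz := le_trans ler01 (b1 z).
  rewrite !powRM ?mulr_ge0 ?exprn_ge0 ?invr_ge0 // ?ltW //.
  have -> : N `^ (2 * th) = N `^ th * N `^ th.
    by rewrite -powRD ?(gt_eqF N0) ?implybT // -mulr2n mulr_natl.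
  by rewrite -/th.
have tensor : schur S T (fun y z => a y `^ th * b z `^ th) (D `^ `|th| * D `^ `|th|).
  have aux e : 1 <= e -> e <= D -> `|e `^ th| <= D `^ `|th|.
    move=> e1 eD; rewrite ger0_norm ?powR_ge0 //.
    apply: (@le_trans _ _ (e `^ `|th|)); first by rewrite ler_powR // ler_norm.
    apply: ge0_ler_powR => //; rewrite nnegrE; last exact: ltW.
    exact: le_trans e1.
  by apply: schur_tensor; rewrite ?powR_ge0 // => w wS; rewrite aux ?aD ?bD.
have cst := @schur_cst R _ _ S T (2^-1 `^ th * N `^ (2 * th)).
have := schurM _ (schurM _ cst tensor) (HC _ _ S T f q fnear).
move=> /(_ ltac:(by rewrite mulr_ge0 ?powR_ge0) ltac:(by rewrite mulr_ge0 ?powR_ge0)).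
move=> H.
have {}H := eq_schur (fun y z _ _ => esym (japE y z)) H.
apply: schur_le H.
apply: le_of_eq.
rewrite ger0_norm ?mulr_ge0 ?powR_ge0 // /q subKr -/th.
have -> : (c / N ^+ 2) `^ (th - rho / 2) = c `^ (th - rho / 2) * N `^ (rho - 2 * th).
  rewrite powRM ?invr_ge0 ?exprn_ge0 ?ltW //; congr (_ * _).
  rewrite -powR_inv1 ?exprn_ge0 ?ltW // -powR_mulrn ?ltW // -!powRrM.
  by congr powR; field.
have -> : N `^ rho = N `^ (2 * th) * N `^ (rho - 2 * th).
  rewrite -powRD; first by congr powR; ring.
  by rewrite (gt_eqF N0) implybT.
by ring.
Qed.

End frequencies.

(** * Orthogonality of the characters of the torus *)

Section characters.
Variable R : realType.
Local Notation point d := (d.-tuple (measurableTypeR R)).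

Definition phase d (n : 'rV[int]_d) (x : point d) : R :=
  \sum_(j < d) (n 0 j)%:~R * tnth x j.

Lemma measurable_phase d (n : 'rV[int]_d) : measurable_fun setT (phase n).
Proof.
rewrite /phase; apply: measurable_sum => j.
by apply: measurable_funM => //; exact: measurable_tnth.
Qed.

Lemma measurable_cos_phase d (n : 'rV[int]_d) (c : R) :
  measurable_fun setT (fun x => cos (phase n x + c)).
Proof.
apply: (measurableT_comp (f := @cos R)).
  by apply: continuous_measurable_fun; exact: continuous_cos.
by apply: measurable_funD => //; exact: measurable_phase.
Qed.

Definition freq_tail d (n : 'rV[int]_d.+1) : 'rV[int]_d :=
  \row_j n 0 (lift ord0 j).

Lemma freq_tail_eq0 d (n : 'rV[int]_d.+1) :
  (n == 0) = (n 0 ord0 == 0) && (freq_tail n == 0).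
Proof.
apply/eqP/andP => [->|[/eqP n0 /eqP nt]].
  by split; apply/eqP; [rewrite mxE|apply/rowP => j; rewrite !mxE].
apply/rowP => j; rewrite mxE; case: (unliftP ord0 j) => [i ->|->] //.
by move/rowP : nt => /(_ i); rewrite !mxE.
Qed.

Lemma phase_tcons d (n : 'rV[int]_d.+1) (p : measurableTypeR R * point d) :
  phase n (tcons p) = (n 0 ord0)%:~R * p.1 + phase (freq_tail n) p.2.
Proof.
rewrite /phase big_ord_recl; congr (_ + _).
by apply: eq_bigr => j _; rewrite mxE tnthS.
Qed.

Lemma sinD2piz (x : R) (m : int) : sin (x + m%:~R * (2 * pi)) = sin x.
Proof.
have P : periodic (@sin R) (2 * pi) by move=> u; rewrite mulr_natl sinD2pi.
case: m => m.
  by rewrite -[X in X * _]/(m%:R) mulr_natl (periodicn P).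
rewrite NegzE rmorphN mulNr -(periodicn P m.+1) /= -[X in X * _]/(m.+1%:R).
by rewrite mulr_natl subrK.
Qed.

(** Shifting by one keeps the integrands nonnegative, so that the integrals are
   computed in the extended reals without integrability conditions. *)
Lemma integral_uniform_cos (m : int) (c : R) :
  (\int[uniform_prob (two_pi_gt0 R)]_x (1 + cos (m%:~R * x + c))%:E =
   (1 + (m == 0)%:R * cos c)%:E)%E.
Proof.
have mcos : measurable_fun setT (fun x : measurableTypeR R => cos (m%:~R * x + c)).
  apply: (measurableT_comp (f := @cos R)).
    by apply: continuous_measurable_fun; exact: continuous_cos.
  by apply: measurable_funD => //; apply: measurable_funM.
rewrite integral_uniform; first last.
- by move=> x; rewrite lee_fin -lerBlDl sub0r cos_geN1.
- by apply/measurable_EFinP; apply: measurable_funD.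
have pi0 := two_pi_gt0 R.
have [->|m0] := eqVneq m 0.
  rewrite mul1r; under eq_integral do rewrite mul0r add0r.
  rewrite integral_cst //= lebesgue_measure_itv /= lte_fin pi0 -EFinD -EFinM.
  by rewrite -?EFinM !subr0 mulrCA mulVf ?mulr1 // gt_eqF.
have mR0 : m%:~R != 0 :> R by rewrite intr_eq0.
pose F (x : R) := x + (m%:~R)^-1 * sin (m%:~R * x + c).
have dF (x : R) : is_derive x 1 F (1 + cos (m%:~R * x + c)).
  rewrite /F; apply: is_derive_eq.
  by rewrite ?scaler0 ?add0r ?addr0 ?mulr1 /GRing.scale /=; field.
have cF : continuous F.
  by move=> x; apply: differentiable_continuous; apply/derivable1_diffP; case: (dF x).
rewrite (@continuous_FTC2 _ _ F) //.
- rewrite /F subr0 mulr0 add0r [m%:~R * _ + c]addrC sinD2piz mul0r addr0 add0r.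
  rewrite -EFinD -EFinM; congr EFin; rewrite addrK mulVf // gt_eqF //.
- apply: continuous_subspaceT => x.
  apply: cvgD; first exact: cvg_cst.
  apply: continuous_comp; last exact: continuous_cos.
  by apply: cvgD; [apply: cvgM; [exact: cvg_cst|exact: cvg_id]|exact: cvg_cst].
- split.
  + by move=> x _; case: (dF x).
  + by apply: cvg_at_right_filter; exact: cF.
  + by apply: cvg_at_left_filter; exact: cF.
- by move=> x _; rewrite derive1E; case: (dF x).
Qed.

Lemma integral_torus_cos d (n : 'rV[int]_d) (c : R) :
  (\int[torus_measure R d]_x (1 + cos (phase n x + c))%:E =
   (1 + (n == 0)%:R * cos c)%:E)%E.
Proof.
elim: d n c => [|d IH] n c.
  rewrite /= integral_dirac //; last first.
    by apply/measurable_EFinP; apply: measurable_funD => //; exact: measurable_cos_phase.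
  rewrite diracT mul1e /phase big_ord0 add0r.
  have -> : n = 0 by apply/rowP => -[].
  by rewrite eqxx mul1r.
have m1 : measurable_fun setT (fun x => (1 + cos (phase n x + c))%:E).
  by apply/measurable_EFinP; apply: measurable_funD => //; exact: measurable_cos_phase.
have ge0 z : (0 <= (1 + cos z)%:E :> \bar R)%E.
  by rewrite lee_fin -lerBlDl sub0r cos_geN1.
rewrite /= ge0_integral_distribution //.
rewrite fubini_tonelli1; first last.
- by move=> x; exact: ge0.
- by apply: (measurableT_comp m1); exact: measurable_tcons.
rewrite /fubini_F.
under eq_integral => x _.
  under eq_integral => y _.
    rewrite /= phase_tcons /= [_ + phase _ _]addrC -addrA.
    over.
  rewrite IH.
  over.
rewrite /=.
rewrite freq_tail_eq0; have [t0|t0] := eqVneq (freq_tail n) 0; last first.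
  under eq_integral do rewrite mul0r addr0.
  rewrite andbF mul0r addr0 integral_cst // [X in (_ * X)%E](_ : _ = 1%E) ?mule1 //.
  exact: probability_setT.
under eq_integral do rewrite mul1r.
by rewrite andbT; exact: integral_uniform_cos.
Qed.

End characters.

(** * Finite boxes of frequencies *)

Section boxes.
Variables (R : realType) (d : nat).
Implicit Types n m : 'rV[int]_d.

Definition freq_box (B : nat) : seq 'rV[int]_d :=
  [seq \row_j ((f j : nat)%:Z - B%:Z) | f : {ffun 'I_d -> 'I_(B.*2.+1)}].

Lemma size_freq_box B : size (freq_box B) = (B.*2.+1 ^ d)%N.
Proof. by rewrite size_map -cardE card_ffun !card_ord. Qed.

Lemma mem_freq_box B n : freq_small (R := R) n B%:R -> n \in freq_box B.
Proof.
move=> nB.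
have nB' j : (absz (n 0%R j) <= B)%N.
  have := nB j; rewrite -intr_norm -[B%:R]/(B%:Z%:~R) ler_int.
  by rewrite -abszE lez_nat.
have lt j : (absz (n 0%R j + B%:Z)%R < B.*2.+1)%N by have := nB' j; lia.
apply/mapP; exists [ffun j => Ordinal (lt j)]; first by rewrite mem_enum.
apply/rowP => j; rewrite !mxE ffunE /=; have := nB' j; lia.
Qed.

Lemma size_freq_small (L : seq 'rV[int]_d) B : uniq L ->
  (forall n, n \in L -> freq_small (R := R) n B%:R) -> (size L <= B.*2.+1 ^ d)%N.
Proof.
move=> uL LB; rewrite -size_freq_box; apply: uniq_leq_size => // n nL.
exact/mem_freq_box/LB.
Qed.

Definition freq_ball (N : nat) : seq 'rV[int]_d :=
  [seq n <- undup (freq_box N) | freq_sqnorm R n <= N%:R ^+ 2].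

Lemma freq_ball_uniq N : uniq (freq_ball N).
Proof. by rewrite filter_uniq // undup_uniq. Qed.

Lemma mem_freq_ball N n : (n \in freq_ball N) = (freq_sqnorm R n <= N%:R ^+ 2).
Proof.
rewrite mem_filter; case: leP => //= nN; rewrite mem_undup.
exact/mem_freq_box/sqnorm_freq_small.
Qed.

Lemma freq_ball_sub N M : (N <= M)%N -> {subset freq_ball N <= freq_ball M}.
Proof.
move=> NM n; rewrite !mem_freq_ball => /le_trans; apply.
by rewrite lerXn2r ?nnegrE // ler_nat.
Qed.

Lemma freq_ball_opp N n : (- n \in freq_ball N) = (n \in freq_ball N).
Proof. by rewrite !mem_freq_ball freq_sqnormN. Qed.

Lemma freq_ball_cover n : exists N0, forall N, (N0 <= N)%N -> n \in freq_ball N.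
Proof.
exists (Num.truncn (freq_sqnorm R n)).+1 => N hN; rewrite mem_freq_ball.
have h : freq_sqnorm R n <= N%:R.
  by apply: le_trans (ltW (truncnS_gt _)) _; rewrite ler_nat.
apply: le_trans h _; rewrite expr2 ler_peMl // ler1n.
by apply: leq_trans hN.
Qed.

Lemma freq_ball_cover_seq (L : seq 'rV[int]_d) :
  exists N0, forall N, (N0 <= N)%N -> {subset L <= freq_ball N}.
Proof.
elim: L => [|n L [N0 IH]]; first by exists 0%N.
have [N1 H1] := freq_ball_cover n; exists (maxn N0 N1) => N.
rewrite geq_max => /andP[h0 h1] m; rewrite in_cons => /predU1P[->|mL].
  exact: H1.
exact: IH.
Qed.

Lemma mul_truncE N (v f : tdistr R d) n :
  mul_trunc N v f n = \sum_(m <- freq_ball N) f (n - m) * v m.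
Proof.
rewrite /mul_trunc [RHS]fsbig_seq ?freq_ball_uniq //.
apply: eq_fsbigl; apply/seteqP.
by split => m /=; rewrite mem_freq_ball.
Qed.

End boxes.

(** * Complex integrals on the torus *)

Section complex_integrals.
Context {R : realType} {dsp : measure_display} {X : measurableType dsp}.
Variables (mu : {measure set X -> \bar R}) (D : set X) (mD : measurable D).
Implicit Types f g h : X -> R[i].

Lemma cintegrableD f g : cintegrable mu D f -> cintegrable mu D g ->
  cintegrable mu D (fun x => f x + g x).
Proof.
move=> [rf jf] [rg jg]; split.
  apply: eq_integrable (integrableD mD rf rg) => // x _.
  by rewrite /=; case: (f x) => a b; case: (g x).
apply: eq_integrable (integrableD mD jf jg) => // x _.
by rewrite /=; case: (f x) => a b; case: (g x).
Qed.

Lemma cintegralD f g : cintegrable mu D f -> cintegrable mu D g ->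
  cintegral mu D (fun x => f x + g x) = cintegral mu D f + cintegral mu D g.
Proof.
move=> [rf jf] [rg jg]; apply/eqP; rewrite eq_complex /=; apply/andP; split; apply/eqP.
  rewrite -RintegralD //; apply: eq_Rintegral => x _.
  by case: (f x) => a b; case: (g x).
rewrite -RintegralD //; apply: eq_Rintegral => x _.
by case: (f x) => a b; case: (g x).
Qed.

Lemma cintegrableZ (c : R[i]) f : cintegrable mu D f ->
  cintegrable mu D (fun x => c * f x).
Proof.
case: c => a b [rf jf]; split.
  apply: eq_integrable (integrableB mD (integrableZl mD a rf) (integrableZl mD b jf)) => // x _.
  by rewrite /=; case: (f x).
apply: eq_integrable (integrableD mD (integrableZl mD a jf) (integrableZl mD b rf)) => // x _.
by rewrite /=; case: (f x).
Qed.

Lemma cintegralZ (c : R[i]) f : cintegrable mu D f ->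
  cintegral mu D (fun x => c * f x) = c * cintegral mu D f.
Proof.
move=> [rf jf].
have iZ a (g : X -> R) : mu.-integrable D (EFin \o g) ->
    mu.-integrable D (EFin \o (fun x => a * g x)) by move/(integrableZl mD a).
apply/eqP; rewrite eq_complex; apply/andP; split; apply/eqP.
  rewrite cReM /= -!RintegralZl // -RintegralB //; try exact: iZ.
  by apply: eq_Rintegral => x _; rewrite cReM.
rewrite cImM /= -!RintegralZl // -RintegralD //; try exact: iZ.
by apply: eq_Rintegral => x _; rewrite cImM.
Qed.

Lemma cintegrable0 : cintegrable mu D (fun=> 0).
Proof. by split; exact: integrable0. Qed.

Lemma cintegral0 : cintegral mu D (fun=> 0) = 0.
Proof.
by rewrite /cintegral /= /Rintegral; apply/eqP; rewrite eq_complex /= integral0 eqxx.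
Qed.

Lemma cintegrable_sum (I : Type) (s : seq I) (f : I -> X -> R[i]) :
  (forall i, cintegrable mu D (f i)) ->
  cintegrable mu D (fun x => \sum_(i <- s) f i x).
Proof.
move=> If; elim: s => [|i s IH].
  by under eq_fun do rewrite big_nil; exact: cintegrable0.
by under eq_fun do rewrite big_cons; exact: cintegrableD.
Qed.

Lemma cintegral_sum (I : Type) (s : seq I) (f : I -> X -> R[i]) :
  (forall i, cintegrable mu D (f i)) ->
  cintegral mu D (fun x => \sum_(i <- s) f i x) = \sum_(i <- s) cintegral mu D (f i).
Proof.
move=> If; elim: s => [|i s IH].
  by under eq_fun do rewrite big_nil; rewrite cintegral0 big_nil.
under eq_fun do rewrite big_cons; rewrite cintegralD // ?IH ?big_cons //.
exact: cintegrable_sum.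
Qed.

Definition cmeasurable f : Prop :=
  measurable_fun D (fun x => complex.Re (f x)) /\
  measurable_fun D (fun x => complex.Im (f x)).

Lemma cintegrable_cmeasurable f : cintegrable mu D f -> cmeasurable f.
Proof. by case=> /measurable_int/measurable_EFinP ? /measurable_int/measurable_EFinP ?; split. Qed.

Lemma cmeasurableM f g : cmeasurable f -> cmeasurable g ->
  cmeasurable (fun x => f x * g x).
Proof.
move=> [rf jf] [rg jg]; split.
  rewrite (_ : (fun _ => _) = (fun x => complex.Re (f x) * complex.Re (g x)
    - complex.Im (f x) * complex.Im (g x))).
    by apply: measurable_funB; apply: measurable_funM.
  by apply/funext => x; case: (f x) => a b; case: (g x).
rewrite (_ : (fun _ => _) = (fun x => complex.Re (f x) * complex.Im (g x)
  + complex.Im (f x) * complex.Re (g x))).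
  by apply: measurable_funD; apply: measurable_funM.
by apply/funext => x; case: (f x) => a b; case: (g x).
Qed.

Lemma cmeasurableD f g : cmeasurable f -> cmeasurable g ->
  cmeasurable (fun x => f x + g x).
Proof.
move=> [rf jf] [rg jg]; split.
  apply: eq_measurable_fun (measurable_funD rf rg) => x _.
  by rewrite /=; case: (f x) => a b; case: (g x).
apply: eq_measurable_fun (measurable_funD jf jg) => x _.
by rewrite /=; case: (f x) => a b; case: (g x).
Qed.

Lemma cmeasurable_cst (c : R[i]) : cmeasurable (fun=> c).
Proof. by split; exact: measurable_cst. Qed.

Lemma cmeasurable_sum (I : Type) (s : seq I) (f : I -> X -> R[i]) :
  (forall i, cmeasurable (f i)) -> cmeasurable (fun x => \sum_(i <- s) f i x).
Proof.
move=> If; elim: s => [|i s IH].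
  by under eq_fun do rewrite big_nil; exact: cmeasurable_cst.
by under eq_fun do rewrite big_cons; exact: cmeasurableD.
Qed.

Lemma cmeasurable_cabs_sqr f : cmeasurable f ->
  measurable_fun D (fun x => cabs (f x) ^+ 2).
Proof.
move=> [rf jf]; rewrite (_ : (fun _ => _) = (fun x =>
  complex.Re (f x) ^+ 2 + complex.Im (f x) ^+ 2)).
  by apply: measurable_funD; apply: measurable_funX.
by apply/funext => x; rewrite cabs_sqr.
Qed.

Lemma cmeasurable_cabs f : cmeasurable f -> measurable_fun D (fun x => cabs (f x)).
Proof.
move=> mf; rewrite (_ : (fun _ => _) = Num.sqrt \o (fun x => cabs (f x) ^+ 2)).
  apply: (measurableT_comp (f := @Num.sqrt R)); last exact: cmeasurable_cabs_sqr.
  by apply: continuous_measurable_fun; exact: sqrt_continuous.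
by apply/funext => x /=; rewrite sqrtr_sqr ger0_norm // cabs_ge0.
Qed.

Lemma bounded_le_cabs h K (p : X -> R) : (forall x, cabs (h x) <= K) ->
  (forall x, `|p x| <= cabs (h x)) -> [bounded p x | x in D].
Proof.
move=> hK ph; exists K; split; first exact: num_real.
by move=> M KM x _; apply: le_trans (ph x) _; apply: le_trans (hK x) (ltW KM).
Qed.

Lemma cintegrableM f h K : cintegrable mu D f -> cmeasurable h ->
  (forall x, cabs (h x) <= K) -> cintegrable mu D (fun x => f x * h x).
Proof.
move=> [rf jf] [rh jh] hK.
have bR := bounded_le_cabs hK (fun x => norm_Re_le (h x)).
have bI := bounded_le_cabs hK (fun x => norm_Im_le (h x)).
split.
  apply: eq_integrable (integrableB mD (integrableMl mD rf rh bR) (integrableMl mD jf jh bI)) => // x _.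
  by rewrite /=; case: (f x) => a b; case: (h x).
apply: eq_integrable (integrableD mD (integrableMl mD rf jh bI) (integrableMl mD jf rh bR)) => // x _.
by rewrite /=; case: (f x) => a b; case: (h x).
Qed.

Lemma bounded_cintegrable h K : (mu D < +oo)%E -> cmeasurable h ->
  (forall x, cabs (h x) <= K) -> cintegrable mu D h.
Proof.
move=> muD [rh jh] hK.
split; apply: measurable_bounded_integrable => //; apply: (bounded_le_cabs hK) => x.
  exact: norm_Re_le.
exact: norm_Im_le.
Qed.

End complex_integrals.

(** * Fourier coefficients: Bessel inequality and multipliers *)

Section fourier.
Variables (R : realType) (d : nat).
Local Notation point := (d.-tuple (measurableTypeR R)).
Local Notation mu := (torus_measure R d).
Implicit Types (n m : 'rV[int]_d) (L : seq 'rV[int]_d) (u : 'rV[int]_d -> R[i]).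
Implicit Types (f g : point -> R[i]).

Lemma phaseD n m (x : point) : phase (n + m) x = phase n x + phase m x.
Proof.
by rewrite /phase -big_split; apply: eq_bigr => j _; rewrite mxE rmorphD mulrDl.
Qed.

Lemma phaseN n (x : point) : phase (- n) x = - phase n x.
Proof. by rewrite /phase -sumrN; apply: eq_bigr => j _; rewrite mxE rmorphN mulNr. Qed.

Lemma char_conjE n (x : point) :
  char_conj n x = Complex (cos (phase n x)) (- sin (phase n x)).
Proof. by []. Qed.

Lemma char_conjD n m (x : point) : char_conj (n + m) x = char_conj n x * char_conj m x.
Proof.
rewrite !char_conjE phaseD; apply/eqP; rewrite eq_complex cReM cImM /= cosD sinD.
by apply/andP; split; apply/eqP; ring.
Qed.

Lemma char_conj0 (x : point) : char_conj 0 x = 1.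
Proof.
rewrite char_conjE (_ : phase 0 x = 0) ?cos0 ?sin0 ?oppr0 //.
by rewrite /phase big1 // => j _; rewrite mxE mul0r.
Qed.

Lemma conj_char_conj n (x : point) : conjc (char_conj n x) = char_conj (- n) x.
Proof. by rewrite !char_conjE phaseN cosN sinN. Qed.

Lemma cabs_char_conj n (x : point) : cabs (char_conj n x) = 1.
Proof.
have : cabs (char_conj n x) ^+ 2 = 1 by rewrite cabs_sqr /= sqrrN cos2Dsin2.
by move=> /eqP; rewrite sqrp_eq1 ?cabs_ge0 // => /eqP.
Qed.

Lemma cmeasurable_char_conj n : cmeasurable setT (char_conj (d := d) (R := R) n).
Proof.
split.
  apply: (measurableT_comp (f := @cos R)); last exact: measurable_phase.
  by apply: continuous_measurable_fun; exact: continuous_cos.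
apply: measurable_funN; apply: (measurableT_comp (f := @sin R)); last exact: measurable_phase.
by apply: continuous_measurable_fun; exact: continuous_sin.
Qed.

Lemma muT_lty : (mu setT < +oo)%E.
Proof. by rewrite probability_setT ltry. Qed.

Lemma cintegrable_char_conj n : cintegrable mu setT (char_conj n).
Proof.
apply: (@bounded_cintegrable _ _ _ _ _ _ _ 1) => //; first exact: muT_lty.
- exact: cmeasurable_char_conj.
- by move=> x; rewrite cabs_char_conj.
Qed.

Lemma Rintegral_torus_cos n (c : R) :
  \int[mu]_x cos (phase n x + c) = (n == 0)%:R * cos c.
Proof.
have mcos := measurable_cos_phase n c.
have icos : mu.-integrable setT (EFin \o (fun x => cos (phase n x + c))).
  apply: measurable_bounded_integrable => //; first exact: muT_lty.
  exists 1; split; first exact: num_real.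
  move=> M M1 x _; apply: le_trans (ltW M1).
  by rewrite ler_norml cos_geN1 cos_le1.
have i1 : mu.-integrable setT (EFin \o (fun=> 1)).
  by apply: finite_measure_integrable_cst.
have := integral_torus_cos n c => /(congr1 fine) /=.
rewrite -/(Rintegral _ _ _) RintegralD // Rintegral_cst //.
rewrite [X in fine X](_ : _ = 1%E); last exact: probability_setT.
by rewrite mul1r => /addrI.
Qed.

Lemma fourier_char_conj n : cintegral mu setT (char_conj n) = (n == 0)%:R.
Proof.
rewrite /cintegral /=; apply/eqP; rewrite eq_complex /=; apply/andP; split; apply/eqP.
  have := Rintegral_torus_cos n 0; rewrite cos0 mulr1.
  under eq_Rintegral do rewrite addr0; move=> ->.
  by case: (n == 0).
have := Rintegral_torus_cos n (pi / 2); rewrite cos_pihalf mulr0.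
under eq_Rintegral do rewrite cosDpihalf; move=> ->.
by case: (n == 0).
Qed.

Definition trig L u (x : point) : R[i] := \sum_(n <- L) u n * char_conj n x.

Lemma cmeasurable_trig L u : cmeasurable setT (trig L u).
Proof.
apply: cmeasurable_sum => // n.
exact: (cmeasurableM (cmeasurable_cst _ _) (cmeasurable_char_conj n)).
Qed.

Lemma cabs_trig L u x : cabs (trig L u x) <= \sum_(n <- L) cabs (u n).
Proof.
apply: le_trans (cabs_sum _ _ _) _; apply: ler_sum => n _.
by rewrite cabsM cabs_char_conj mulr1.
Qed.

Lemma cintegrable_trigM g L u : cintegrable mu setT g ->
  cintegrable mu setT (fun x => g x * trig L u x).
Proof.
move=> ig; apply: cintegrableM ig _ _ => //; first exact: cmeasurable_trig.
exact: cabs_trig.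
Qed.

Lemma cintegrable_charM g n : cintegrable mu setT g ->
  cintegrable mu setT (fun x => g x * char_conj n x).
Proof.
move=> ig; apply: (@cintegrableM _ _ _ _ _ _ _ _ 1) ig _ _ => //.
  exact: cmeasurable_char_conj.
by move=> x; rewrite cabs_char_conj.
Qed.

Lemma cintegral_trigM g L u : cintegrable mu setT g ->
  cintegral mu setT (fun x => g x * trig L u x) =
  \sum_(n <- L) u n * fourier_coef g n.
Proof.
move=> ig; under eq_fun do rewrite /trig mulr_sumr.
rewrite cintegral_sum // => [|n].
  apply: eq_bigr => n _; rewrite -cintegralZ //; last exact: cintegrable_charM.
  by congr cintegral; apply/funext => x; ring.
under eq_fun do rewrite mulrCA.
by apply: cintegrableZ => //; exact: cintegrable_charM.
Qed.

Lemma cintegrable_trig L u : cintegrable mu setT (trig L u).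
Proof.
apply: cintegrable_sum => // n; apply: cintegrableZ => //.
exact: cintegrable_char_conj.
Qed.

Lemma fourier_trig L u n :
  fourier_coef (trig L u) n = \sum_(m <- L) u m * (n + m == 0)%:R.
Proof.
rewrite /fourier_coef; under eq_fun do rewrite mulrC.
rewrite cintegral_trigM; last exact: cintegrable_char_conj.
apply: eq_bigr => m _; congr (_ * _).
rewrite /fourier_coef; under eq_fun do rewrite -char_conjD.
exact: fourier_char_conj.
Qed.

Lemma conj_trig L u x :
  conjc (trig L u x) = trig [seq - n | n <- L] (fun n => conjc (u (- n))) x.
Proof.
rewrite /trig rmorph_sum big_map; apply: eq_bigr => n _.
rewrite rmorphM opprK; congr (_ * _); exact: conj_char_conj.
Qed.

Lemma integrable_cabs_trig L u :
  mu.-integrable setT (EFin \o (fun x => cabs (trig L u x) ^+ 2)).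
Proof.
apply: measurable_bounded_integrable => //; first exact: muT_lty.
  by apply: cmeasurable_cabs_sqr => //; exact: cmeasurable_trig.
exists ((\sum_(n <- L) cabs (u n)) ^+ 2); split; first exact: num_real.
move=> M hM x _; apply: le_trans (ltW hM).
rewrite ger0_norm ?sqr_ge0 // lerXn2r ?nnegrE ?cabs_ge0 ?cabs_trig //.
by apply: sumr_ge0 => n _; exact: cabs_ge0.
Qed.

Lemma integrable_cabs_trig1 L u : mu.-integrable setT (EFin \o (fun x => cabs (trig L u x))).
Proof.
apply: measurable_bounded_integrable => //; first exact: muT_lty.
  by apply: cmeasurable_cabs; exact: cmeasurable_trig.
exists (\sum_(n <- L) cabs (u n)); split; first exact: num_real.
move=> M hM x _; apply: le_trans (ltW hM).
by rewrite ger0_norm ?cabs_ge0 // cabs_trig.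
Qed.

Lemma parseval_trig L u : uniq L ->
  \int[mu]_x (cabs (trig L u x) ^+ 2) = l2 L u ^+ 2.
Proof.
move=> uL.
have := cintegral_trigM L u (cintegrable_trig [seq - n | n <- L] (fun n => conjc (u (- n)))).
have -> : \sum_(n <- L) u n * fourier_coef (trig [seq - n | n <- L]
    (fun n => conjc (u (- n)))) n = real_complex R (l2 L u ^+ 2).
  rewrite l2_sqr rmorph_sum big_seq [RHS]big_seq; apply: eq_bigr => n nL.
  rewrite -[RHS]/(real_complex R (cabs (u n) ^+ 2)) -mulc_conj; congr (_ * _).
  rewrite fourier_trig big_map.
  rewrite (bigD1_seq n) //= subrr eqxx mulr1 opprK big1 ?addr0 // => m mn.
  by rewrite subr_eq0 eq_sym (negbTE mn) mulr0.
move=> E; rewrite -[RHS]/(complex.Re (real_complex R (l2 L u ^+ 2))) -E.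
apply: eq_Rintegral => x _.
by rewrite -conj_trig mulrC mulc_conj.
Qed.

Lemma measurable_cabs_sqr g : cintegrable mu setT g ->
  measurable_fun setT (fun x => (cabs (g x) ^+ 2)%:E).
Proof.
move=> ig; apply/measurable_EFinP; apply: cmeasurable_cabs_sqr => //.
exact: cintegrable_cmeasurable ig.
Qed.

(** Pair [g] with the trigonometric polynomial that has the same coefficients and
   use [|g h| <= (|g| ^ 2 + |h| ^ 2) / 2]. *)
Lemma bessel g (A : R) : cintegrable mu setT g ->
  (\int[mu]_x (cabs (g x) ^+ 2)%:E <= (A ^+ 2)%:E)%E ->
  forall L, uniq L -> l2 L (fourier_coef g) <= `|A|.
Proof.
move=> ig gA L uL; rewrite l2_leP // real_normK ?num_real // -l2_sqr.
set c := fourier_coef g; pose u n := conjc (c n).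
have ig2 : mu.-integrable setT (EFin \o (fun x => cabs (g x) ^+ 2)).
  apply/integrableP; split; first exact: (measurable_cabs_sqr ig).
  apply: le_lt_trans (ltry (A ^+ 2)); apply: le_trans gA.
  apply: le_of_eq; apply: eq_integral => x _ /=.
  by rewrite ger0_norm ?sqr_ge0.
have ul : l2 L u = l2 L c.
  by congr Num.sqrt; apply: eq_bigr => n _; rewrite cabs_conj.
have := cintegral_trigM L u ig.
have -> : \sum_(n <- L) u n * fourier_coef g n = real_complex R (l2 L c ^+ 2).
  by rewrite l2_sqr rmorph_sum; apply: eq_bigr => n _; rewrite mulrC mulc_conj.
move=> /(congr1 (@complex.Re R)) /= E.
have i2 : mu.-integrable setT (EFin \o (fun x => cabs (g x) ^+ 2 + cabs (trig L u x) ^+ 2)).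
  exact: (integrableD measurableT ig2 (integrable_cabs_trig L u)).
have ih : mu.-integrable setT (EFin \o (fun x => 2^-1 * (cabs (g x) ^+ 2 + cabs (trig L u x) ^+ 2))).
  by have := integrableZl measurableT 2^-1 i2.
have : l2 L c ^+ 2 <= \int[mu]_x (2^-1 * (cabs (g x) ^+ 2 + cabs (trig L u x) ^+ 2)).
  rewrite -E; apply: le_Rintegral => //; first by case: (cintegrable_trigM L u ig).
  move=> x _; apply: le_trans (ler_norm _) _; apply: le_trans (norm_Re_le _) _.
  by rewrite cabsM; have := sqr_ge0 (cabs (g x) - cabs (trig L u x)); nra.
rewrite RintegralZl //.
rewrite RintegralD //; last exact: integrable_cabs_trig.
rewrite parseval_trig // ul.
have : \int[mu]_x (cabs (g x) ^+ 2) <= A ^+ 2.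
  by rewrite -lee_fin /Rintegral fineK //; exact: integrable_fin_num.
by move=> h1 h2; lra.
Qed.

(** The matrix represents multiplication by [g] in the basis of characters, up to
   the reflection and the translation of frequencies, which are unitary. *)
Lemma op_bounded_fourier g (A : R) : 0 <= A -> cintegrable mu setT g ->
  {ae mu, forall x, cabs (g x) <= A} ->
  forall (z : 'rV[int]_d) L L', uniq L -> uniq L' ->
    op_bounded L L' (fun n m => fourier_coef g (z + n + m)) A.
Proof.
move=> A0 ig gA z L L' uL uL' u v.
pose h x := g x * char_conj z x * trig L u x.
have ih : cintegrable mu setT h.
  by apply: cintegrable_trigM; exact: cintegrable_charM.
have hE m : fourier_coef h m = \sum_(n <- L) u n * fourier_coef g (z + n + m).
  rewrite /fourier_coef.
  rewrite (_ : (fun x => h x * char_conj m x) =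
    (fun x => (g x * char_conj (z + m) x) * trig L u x)); last first.
    by apply/funext => x; rewrite /h char_conjD; ring.
  rewrite cintegral_trigM; last exact: cintegrable_charM.
  apply: eq_bigr => n _; congr (_ * _); rewrite /fourier_coef; congr cintegral.
  by apply/funext => x; rewrite !char_conjD; ring.
have hA : (\int[mu]_x (cabs (h x) ^+ 2)%:E <= ((A * l2 L u) ^+ 2)%:E)%E.
  have itr := integrable_cabs_trig L u.
  have -> : ((A * l2 L u) ^+ 2)%:E =
      (\int[mu]_x (A ^+ 2 * cabs (trig L u x) ^+ 2)%:E)%E.
    under eq_integral do rewrite EFinM.
    rewrite integralZl // exprMn -parseval_trig // EFinM; congr (_ * _)%E.
    by rewrite /Rintegral fineK //; exact: integrable_fin_num.
  apply: ae_ge0_le_integral => //.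
  - by move=> x _; rewrite lee_fin sqr_ge0.
  - exact: (measurable_cabs_sqr ih).
  - by move=> x _; rewrite lee_fin mulr_ge0 ?sqr_ge0.
  - apply/measurable_EFinP; apply: measurable_funM => //.
    by apply: cmeasurable_cabs_sqr => //; exact: cmeasurable_trig.
  apply: filterS gA => x gx _; rewrite lee_fin -exprMn.
  rewrite lerXn2r ?nnegrE ?mulr_ge0 ?cabs_ge0 //.
  by rewrite !cabsM cabs_char_conj mulr1 ler_wpM2r ?cabs_ge0.
have := bessel ih hA uL'; rewrite ger0_norm ?mulr_ge0 ?l2_ge0 // => hl.
have -> : \sum_(x <- L) \sum_(y <- L') u x * fourier_coef g (z + x + y) * v y =
   \sum_(y <- L') fourier_coef h y * v y.
  rewrite exchange_big; apply: eq_bigr => y _.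
  by rewrite hE mulr_suml.
by apply: le_trans (cabs_dot_le _ _ _) _; rewrite ler_wpM2r ?l2_ge0.
Qed.

End fourier.

(** * Sobolev norms through Fourier coefficients *)

Section sobolev_fourier.
Variables (R : realType) (d : nat).
Local Notation point := (d.-tuple (measurableTypeR R)).
Local Notation mu := (torus_measure R d).
Implicit Types (n m : 'rV[int]_d) (L : seq 'rV[int]_d) (f : tdistr R d).

(** The H^s norm of [f] is at most [A].  Testing finite sets of frequencies only
   avoids infinite sums. *)
Definition hs (s : R) f (A : R) : Prop := forall L, uniq L ->
  l2 L (fun n => real_complex R (jap n s) * f n) <= A.

(** The W^{s,oo} norm enters the estimates only through the norm of the
   multiplication by [<nabla>^s f] as an operator on L2. *)
Definition mult_bounded (s : R) f (A : R) : Prop :=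
  forall (z : 'rV[int]_d) L L', uniq L -> uniq L' ->
  op_bounded L L' (fun n m => real_complex R (jap (z + n + m) s) * f (z + n + m)) A.

Lemma sobolev_infty_mult_bounded s f A :
  (sobolev_norm s +oo f <= A%:E)%E -> mult_bounded s f A.
Proof.
move=> fA z L L' uL uL' u v.
have K0 : 0 <= l2 L u * l2 L' v by rewrite mulr_ge0 ?l2_ge0.
apply/ler_addgt0Pr => e e0.
pose e' := e / (l2 L u * l2 L' v + 1).
have e'0 : 0 < e' by rewrite divr_gt0 // ltr_wpDl.
have : (sobolev_norm s +oo f < (A + e')%:E)%E.
  by apply: le_lt_trans fA _; rewrite lte_fin ltrDl.
move=> /ereal_inf_lt[_ [g [ig gf] <-]] gA.
have A0 : 0 <= A + e' by rewrite -lee_fin; apply: le_trans (ltW gA); exact: Lnorm_ge0.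
have gae : {ae mu, forall x, cabs (g x) <= A + e'}.
  have mu1 : (0 < mu setT)%E by rewrite [X in (_ < X)%E](_ : _ = 1%E) ?lte01 //; exact: probability_setT.
  move: gA; rewrite unlock mu1 => /ltW /ess_supP.
  by apply: filterS => x /=; rewrite lee_fin ger0_norm ?cabs_ge0.
have := op_bounded_fourier A0 ig gae z uL uL' u v.
under eq_bigr do under eq_bigr do rewrite gf.
move=> H; apply: le_trans H _.
rewrite -!mulrA mulrDl lerD2l /e' mulrAC ler_pdivrMr ?ltr_wpDl //.
by rewrite ler_pM2l // lerDl.
Qed.

Lemma integral_cabs_sqr_le (g : point -> R[i]) (A : R) : 0 <= A ->
  cintegrable mu setT g ->
  (Lnorm mu 2%:E (fun x => (cabs (g x))%:E) <= A%:E)%E <->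
  (\int[mu]_x (cabs (g x) ^+ 2)%:E <= (A ^+ 2)%:E)%E.
Proof.
move=> A0 ig.
rewrite unlock.
have -> : (\int[mu]_x (`|(cabs (g x))%:E| `^ 2))%E =
    (\int[mu]_x (cabs (g x) ^+ 2)%:E)%E.
  apply: eq_integral => x _.
  rewrite /= ger0_norm ?cabs_ge0 // powR_mulrn; last exact: cabs_ge0.
  reflexivity.
have I0 : (0 <= \int[mu]_x (cabs (g x) ^+ 2)%:E)%E.
  by apply: integral_ge0 => x _; rewrite lee_fin sqr_ge0.
case: (\int[mu]_x _)%E I0 => [r| |] //= r0; last by rewrite invr_eq0 pnatr_eq0 /= !leye_eq.
rewrite !lee_fin in r0 *; rewrite powR12_sqrt //.
by rewrite -[A in X in iff X _]ger0_norm // -sqrtr_sqr ler_sqrt // sqr_ge0.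
Qed.

Lemma sobolev2_hs s f A : (sobolev_norm s 2%:E f <= A%:E)%E -> hs s f A.
Proof.
move=> fA L uL; apply/ler_addgt0Pr => e e0.
have : (sobolev_norm s 2%:E f < (A + e)%:E)%E.
  by apply: le_lt_trans fA _; rewrite lte_fin ltrDl.
move=> /ereal_inf_lt[_ [g [ig gf] <-]] gA.
have A0 : 0 <= A + e by rewrite -lee_fin; apply: le_trans (ltW gA); exact: Lnorm_ge0.
have /(integral_cabs_sqr_le A0 ig) gA2 := ltW gA.
have := bessel ig gA2 uL; rewrite ger0_norm //; apply: le_trans.
by apply/le_of_eq/eq_l2 => n _; rewrite gf.
Qed.

End sobolev_fourier.

Section riesz_fischer.
Variables (R : realType) (d : nat).
Local Notation point := (d.-tuple (measurableTypeR R)).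
Local Notation mu := (torus_measure R d).
Implicit Types (n m : 'rV[int]_d) (L : seq 'rV[int]_d).

Lemma big_sub_filter (V : nmodType) (I : eqType) (L M : seq I) (F : I -> V) :
  uniq L -> uniq M -> {subset L <= M} ->
  \sum_(i <- M) F i = \sum_(i <- L) F i + \sum_(i <- [seq i <- M | i \notin L]) F i.
Proof.
move=> uL uM LM; rewrite (bigID (mem L)) /=; congr (_ + _); last by rewrite big_filter.
rewrite -big_filter; apply: perm_big; apply: uniq_perm => //.
  by rewrite filter_uniq.
by move=> i; rewrite mem_filter; case iL : (i \in L) => //=; rewrite LM.
Qed.

Section bounded_l2.
Variables (a : 'rV[int]_d -> R[i]) (A : R).
Hypothesis aA : forall L, uniq L -> l2 L a <= A.

Let A0 : 0 <= A.
Proof. by apply: le_trans (aA (isT : uniq [::])); exact: l2_ge0. Qed.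

Lemma l2_tail e : 0 < e -> exists N0, forall N, (N0 <= N)%N ->
  forall L, uniq L -> (forall n, n \in L -> n \notin freq_ball R d N) -> l2 L a <= e.
Proof.
move=> e0.
pose S := [set l2 L a ^+ 2 | L in [set L | uniq L]].
have supS : has_sup S.
  split; first by exists (l2 [::] a ^+ 2); exists [::].
  by exists (A ^+ 2) => _ [L uL <-]; rewrite lerXn2r ?nnegrE ?l2_ge0 ?aA.
have [_ [L0 /= uL0 <-] L0S] := sup_adherent (exprn_gt0 2 e0) supS.
have [N0 HN0] := freq_ball_cover_seq R L0; exists N0 => N N0N L uL LN.
have uLL0 : uniq (L ++ L0).
  rewrite cat_uniq uL uL0 andbT /=; apply/hasPn => n nL0; apply/negP => nL.
  by have := LN n nL; rewrite HN0.
have : l2 (L ++ L0) a ^+ 2 <= sup S.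
  by apply: sup_upper_bound => //; exists (L ++ L0).
rewrite l2_sqr big_cat /= -!l2_sqr => H.
rewrite -(@ler_pXn2r _ 2) ?nnegrE ?l2_ge0 ?(ltW e0) //.
by move: L0S H; lra.
Qed.

Let radius : exists N : nat -> nat, (forall i, (N i <= N i.+1)%N) /\
  (forall n, exists i0, forall i, (i0 <= i)%N -> n \in freq_ball R d (N i)) /\
  forall i L, uniq L -> (forall n, n \in L -> n \notin freq_ball R d (N i)) ->
    l2 L a <= (2 ^+ i)^-1.
Proof.
have /choice[n Hn] : forall i, exists N0, forall N, (N0 <= N)%N ->
  forall L, uniq L -> (forall n, n \in L -> n \notin freq_ball R d N) ->
    l2 L a <= (2 ^+ i)^-1.
  by move=> i; apply: l2_tail; rewrite invr_gt0 exprn_gt0.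
exists (fun i => \sum_(j < i.+1) n j + i)%N; split; [|split].
- by move=> i; rewrite [X in (_ <= X + _)%N]big_ord_recr leq_add // leq_addr.
- move=> m; have [i0 Hi] := freq_ball_cover R m; exists i0 => i i0i.
  by apply: Hi; apply: leq_trans i0i _; rewrite leq_addl.
- by move=> i; apply: Hn; rewrite big_ord_recr /= -addnA addnCA leq_addr.
Qed.

(* The Fourier coefficients of [trig] are those of its argument at the opposite
   frequency, since [trig] is built from the conjugate characters. *)
Let aN n := a (- n).

Let l2_aN L : l2 L aN = l2 [seq - n | n <- L] a.
Proof. by rewrite /l2 big_map. Qed.

Let uniq_opp L : uniq L -> uniq [seq - n | n <- L].
Proof. by move=> uL; rewrite map_inj_uniq //; exact: oppr_inj. Qed.

(** Riesz-Fischer theorem: the partial sums over balls of rapidly increasing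
   radius converge almost everywhere, because the L1 norms of their increments
   are summable; the same sum dominates the partial sums, which gives the
   coefficients of the limit, and Fatou's lemma gives its L2 norm. *)
Lemma riesz_fischer : exists g : point -> R[i],
  [/\ cintegrable mu setT g, fourier_coef g =1 a &
      (\int[mu]_x (cabs (g x) ^+ 2)%:E <= (A ^+ 2)%:E)%E].
Proof.
have [N [Nmon [Ncov Ntail]]] := radius.
pose B i := freq_ball R d (N i).
pose U i := trig (B i) aN : point -> R[i].
pose D i := trig [seq n <- B i.+1 | n \notin B i] aN : point -> R[i].
have UD i x : U i.+1 x = U i x + D i x.
  apply: big_sub_filter; rewrite ?freq_ball_uniq //.
  exact: freq_ball_sub.
have Usum i x : U i x = U 0%N x + \sum_(0 <= j < i) D j x.
  elim: i => [|i IH]; first by rewrite big_geq ?addr0.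
  by rewrite UD IH big_nat_recr //= addrA.
have l2D i : l2 [seq n <- B i.+1 | n \notin B i] aN <= (2 ^+ i)^-1.
  rewrite l2_aN; apply: Ntail.
    by apply: uniq_opp; rewrite filter_uniq ?freq_ball_uniq.
  move=> _ /mapP[n + ->]; rewrite freq_ball_opp mem_filter.
  by case/andP.
have iD i : mu.-integrable setT (EFin \o (fun x => cabs (D i x))).
  exact: integrable_cabs_trig1.
pose w i : R := (2 ^+ i)^-1.
have w0 i : 0 < w i by rewrite invr_gt0 exprn_gt0.
(* Young's inequality [a <= w / 2 + a ^ 2 / (2 w)] replaces Cauchy-Schwarz. *)
have intD i : \int[mu]_x cabs (D i x) <= w i.
  have i1 : mu.-integrable setT (EFin \o (fun x : point => w i / 2)).
    exact: finite_measure_integrable_cst.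
  have i2 : mu.-integrable setT (EFin \o (fun x => (2 * w i)^-1 * cabs (D i x) ^+ 2)).
    by have := integrableZl measurableT (2 * w i)^-1 (integrable_cabs_trig [seq n <- B i.+1 | n \notin B i] aN).
  have i3 : mu.-integrable setT (EFin \o (fun x => w i / 2 + (2 * w i)^-1 * cabs (D i x) ^+ 2)).
    exact: (integrableD measurableT i1 i2).
  apply: (@le_trans _ _ (\int[mu]_x (w i / 2 + (2 * w i)^-1 * cabs (D i x) ^+ 2))).
    apply: le_Rintegral => // x _.
    have h : 0 <= (2 * w i)^-1 * (w i - cabs (D i x)) ^+ 2.
      by rewrite mulr_ge0 ?sqr_ge0 ?invr_ge0 ?mulr_ge0 // ltW.
    rewrite -subr_ge0; apply: le_trans h _; apply: le_of_eq.
    by field; rewrite gt_eqF.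
  rewrite RintegralD // Rintegral_cst // [X in fine X](_ : _ = 1%E); last exact: probability_setT.
  rewrite RintegralZl //; last exact: integrable_cabs_trig.
  rewrite parseval_trig; last by rewrite filter_uniq ?freq_ball_uniq.
  rewrite /= mulr1.
  have := l2D i; rewrite -/(w i) => h.
  apply: (@le_trans _ _ (w i / 2 + (2 * w i)^-1 * w i ^+ 2)).
    rewrite lerD2l ler_pM2l ?invr_gt0 ?mulr_gt0 //.
    by rewrite lerXn2r ?nnegrE ?l2_ge0 // ltW.
  by apply: le_of_eq; field; rewrite gt_eqF.
pose h x := (\sum_(i <oo) (cabs (D i x))%:E)%E.
have h0 x : (0 <= h x)%E by apply: nneseries_ge0 => i _ _; rewrite lee_fin cabs_ge0.
have mD i : measurable_fun setT (fun x => (cabs (D i x))%:E).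
  by apply/measurable_EFinP; apply: cmeasurable_cabs; exact: cmeasurable_trig.
have mh : measurable_fun setT h.
  by apply: ge0_emeasurable_sum => // i x _ _; rewrite lee_fin cabs_ge0.
have inth : (\int[mu]_x h x < +oo)%E.
  rewrite /h integral_nneseries //; last by move=> i x _; rewrite lee_fin cabs_ge0.
  apply: le_lt_trans (ltry 2); apply: lime_le.
    by apply: is_cvg_nneseries => i _ _; apply: integral_ge0 => x _; rewrite lee_fin cabs_ge0.
  apply: nearW => i.
  apply: (@le_trans _ _ (\sum_(0 <= j < i) (w j)%:E)%E).
    apply: lee_sum => j _.
    have -> : (\int[mu]_x (cabs (D j x))%:E)%E = (\int[mu]_x cabs (D j x))%:E.
      by rewrite /Rintegral fineK //; exact: integrable_fin_num (iD j).
    by rewrite lee_fin.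
  rewrite sumEFin lee_fin.
  have -> : \sum_(0 <= j < i) w j = 2 - 2 * w i.
    elim: i => [|i IH]; first by rewrite big_geq // /w expr0 invr1; ring.
    by rewrite big_nat_recr //= IH /w exprS invfM; field; rewrite expf_neq0.
  by rewrite gerBl mulr_ge0 // ltW.
have ih : mu.-integrable setT h.
  apply/integrableP; split => //.
  by under eq_integral do rewrite gee0_abs //.
(* Upper limits, to have measurable functions also where the series diverges. *)
pose gR x : R := fine (limn_esup (fun i => (complex.Re (U i x))%:E)).
pose gI x : R := fine (limn_esup (fun i => (complex.Im (U i x))%:E)).
pose g x := Complex (gR x) (gI x).
have mU i := cmeasurable_trig (B i) aN.
have mg : cmeasurable setT g.
  split.
    apply: (measurableT_comp (f := fine)) => //.
    by apply: measurable_fun_limn_esup => i; apply/measurable_EFinP; case: (mU i).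
  apply: (measurableT_comp (f := fine)) => //.
  by apply: measurable_fun_limn_esup => i; apply/measurable_EFinP; case: (mU i).
have cvgU (x : point) (p : R[i] -> R) : (h x < +oo)%E ->
    (forall y z, p (y + z) = p y + p z) -> (p 0 = 0) -> (forall z, `|p z| <= cabs z) ->
    p (U i x) @[i --> \oo] --> fine (limn_esup (fun i => (p (U i x))%:E)).
  move=> hx pD p0 pz.
  have psum (i : nat) : p (U i x) = p (U 0%N x) + series (fun j => p (D j x)) i.
    rewrite Usum pD; congr (_ + _); rewrite /series /=.
    by elim/big_ind2 : _ => // ? ? ? ? <- <-.
  have : cvgn (series (fun j => p (D j x))).
    apply: normed_cvg; apply: (@series_le_cvg _ _ (fun j => cabs (D j x))).
    - by move=> j; exact: normr_ge0.
    - by move=> j; exact: cabs_ge0.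
    - by move=> j; exact: pz.
    apply: nondecreasing_is_cvgn.
      by apply: nondecreasing_series => j _ _; exact: cabs_ge0.
    exists (fine (h x)) => _ [i _ <-].
    rewrite -lee_fin fineK ?ge0_fin_numE // /series /= -sumEFin.
    by apply: nneseries_lim_ge => j _ _; rewrite lee_fin cabs_ge0.
  move=> /cvg_ex[l sl].
  have cl : p (U i x) @[i --> \oo] --> p (U 0%N x) + l.
    by under eq_fun do rewrite psum; apply: cvgD => //; exact: cvg_cst.
  have /cvg_limn_einf_sup[_ ->] : (p (U i x))%:E @[i --> \oo] --> (p (U 0%N x) + l)%:E.
    by apply: cvg_EFin; [exact: nearW|exact: cl].
  exact: cl.
have cvgRe x : (h x < +oo)%E -> complex.Re (U i x) @[i --> \oo] --> gR x.
  move=> hx; apply: cvgU => //; last exact: norm_Re_le.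
  by move=> [? ?] [].
have cvgIm x : (h x < +oo)%E -> complex.Im (U i x) @[i --> \oo] --> gI x.
  move=> hx; apply: cvgU => //; last exact: norm_Im_le.
  by move=> [? ?] [].
have aeh : {ae mu, forall x, (h x < +oo)%E}.
  have := integrable_ae measurableT ih; apply: filterS => x /(_ I).
  by rewrite ge0_fin_numE.
pose G x := ((cabs (U 0%N x))%:E + h x)%E.
have iG : mu.-integrable setT G.
  by apply: integrableD => //; exact: integrable_cabs_trig1.
have UG i x : ((cabs (U i x))%:E <= G x)%E.
  apply: (@le_trans _ _ ((cabs (U 0%N x))%:E + (\sum_(0 <= j < i) cabs (D j x))%:E)%E).
    rewrite -EFinD lee_fin Usum; apply: le_trans (cabsD _ _) _; rewrite lerD2l.
    exact: cabs_sum.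
  rewrite /G leeD2l // -sumEFin.
  by apply: nneseries_lim_ge => j _ _; rewrite lee_fin cabs_ge0.
have DC n : cintegrable mu setT (fun x => g x * char_conj n x) /\ fourier_coef g n = a n.
  have [i0 Hi0] := Ncov (- n).
  have fU i : (i0 <= i)%N -> fourier_coef (U i) n = a n.
    move=> i0i; rewrite fourier_trig (bigD1_seq (- n)) ?freq_ball_uniq ?Hi0 //=.
    rewrite subrr eqxx mulr1 /aN opprK big1 ?addr0 // => m mn.
    by rewrite addr_eq0 -eqr_oppLR eq_sym (negbTE mn) mulr0.
  have mchar := cmeasurable_char_conj R n.
  have mgc := cmeasurableM mg mchar.
  have mUc i := cmeasurableM (mU i) mchar.
  have Uc i x : ((cabs (U i x * char_conj n x))%:E <= G x)%E.
    by rewrite cabsM cabs_char_conj mulr1.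
  have [] := @dominated_convergence _ _ R mu setT measurableT
    (fun i x => (complex.Re (U i x * char_conj n x))%:E)
    (fun x => (complex.Re (g x * char_conj n x))%:E) G _ _ _ iG _.
  - by move=> i; apply/measurable_EFinP; case: (mUc i).
  - by apply/measurable_EFinP; case: mgc.
  - apply: filterS aeh => x hx _; apply: cvg_EFin.
      exact: nearW.
    under eq_fun do rewrite /= cReM; rewrite cReM.
    by apply: cvgB; apply: cvgMl; [exact: cvgRe|exact: cvgIm].
  - apply: aeW => x i _; apply: le_trans (Uc i x).
    by rewrite lee_fin norm_Re_le.
  move=> iRe _ cRe.
  have [] := @dominated_convergence _ _ R mu setT measurableT
    (fun i x => (complex.Im (U i x * char_conj n x))%:E)
    (fun x => (complex.Im (g x * char_conj n x))%:E) G _ _ _ iG _.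
  - by move=> i; apply/measurable_EFinP; case: (mUc i).
  - by apply/measurable_EFinP; case: mgc.
  - apply: filterS aeh => x hx _; apply: cvg_EFin.
      exact: nearW.
    under eq_fun do rewrite /= cImM; rewrite cImM.
    by apply: cvgD; apply: cvgMl; [exact: cvgRe|exact: cvgIm].
  - apply: aeW => x i _; apply: le_trans (Uc i x).
    by rewrite lee_fin norm_Im_le.
  move=> iIm _ cIm.
  have iU i : cintegrable mu setT (fun x => U i x * char_conj n x).
    by apply: cintegrable_charM; exact: cintegrable_trig.
  split => //; apply/eqP; rewrite eq_complex; apply/andP; split; apply/eqP.
    have E : (\int[mu]_x (complex.Re (g x * char_conj n x))%:E = (complex.Re (a n))%:E)%E.
      apply: (cvg_unique _ cRe) => //; apply: cvg_near_cst; exists i0 => // i i0i.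
      rewrite /= -(fU i i0i) /fourier_coef /= /Rintegral fineK //.
      by apply: integrable_fin_num => //; case: (iU i).
    by rewrite /= /Rintegral E.
  have E : (\int[mu]_x (complex.Im (g x * char_conj n x))%:E = (complex.Im (a n))%:E)%E.
    apply: (cvg_unique _ cIm) => //; apply: cvg_near_cst; exists i0 => // i i0i.
    rewrite /= -(fU i i0i) /fourier_coef /= /Rintegral fineK //.
    by apply: integrable_fin_num => //; case: (iU i).
  by rewrite /= /Rintegral E.
have ig : cintegrable mu setT g.
  have [+ _] := DC 0; congr cintegrable; apply/funext => x.
  by rewrite char_conj0 mulr1.
exists g; split => //; first by move=> n; have [] := DC n.
have mU2 i : measurable_fun setT (fun x => (cabs (U i x) ^+ 2)%:E).
  by apply: measurable_cabs_sqr; exact: cintegrable_trig.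
apply: (@le_trans _ _ (\int[mu]_x limn_einf (fun i => (cabs (U i x) ^+ 2)%:E))%E).
  apply: ae_ge0_le_integral => //.
  - by move=> x _; rewrite lee_fin sqr_ge0.
  - exact: measurable_cabs_sqr.
  - move=> x _; rewrite limn_einf_lim; apply: lime_ge; first exact: is_cvg_einfs.
    by apply: nearW => i; apply: le_ereal_inf_tmp => _ [j /= _ <-]; rewrite lee_fin sqr_ge0.
  - apply: (emeasurable_fun_cvg (fun i x => einfs (fun i => (cabs (U i x) ^+ 2)%:E) i)).
      exact: measurable_fun_einfs.
    by move=> x _; rewrite limn_einf_lim; exact: is_cvg_einfs.
  apply: filterS aeh => x hx _.
  apply: le_of_eq; apply/esym.
  apply: (cvg_limn_einf_sup _).1; apply: cvg_EFin; first exact: nearW.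
  under eq_fun do rewrite /= cabs_sqr; rewrite cabs_sqr.
  by apply: cvgD; apply: cvgM; [exact: cvgRe|exact: cvgRe|exact: cvgIm|exact: cvgIm].
apply: le_trans (fatou mu measurableT mU2 _) _; first by move=> i x _; rewrite lee_fin sqr_ge0.
rewrite limn_einf_lim; apply: lime_le; first exact: is_cvg_einfs.
apply: nearW => i; apply: (@le_trans _ _ (\int[mu]_x (cabs (U i x) ^+ 2)%:E)%E).
  by apply: ereal_inf_lbound; exists i => /=.
have -> : (\int[mu]_x (cabs (U i x) ^+ 2)%:E)%E = (l2 (B i) aN ^+ 2)%:E.
  rewrite -parseval_trig ?freq_ball_uniq // /Rintegral fineK //.
  by apply: integrable_fin_num => //; exact: integrable_cabs_trig.
rewrite lee_fin lerXn2r ?nnegrE ?l2_ge0 // l2_aN aA //.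
by apply: uniq_opp; exact: freq_ball_uniq.
Qed.

End bounded_l2.

Lemma hs_sobolev2 (s : R) (f : tdistr R d) (A : R) :
  hs s f A -> (sobolev_norm s 2%:E f <= A%:E)%E.
Proof.
move=> fA; have [g [ig gf gA]] := riesz_fischer fA.
have A0 : 0 <= A by apply: le_trans (fA [::] isT); exact: l2_ge0.
apply: (@le_trans _ _ (Lnorm mu 2%:E (fun x => (cabs (g x))%:E))).
  by apply: ereal_inf_lbound; exists g.
exact/(integral_cabs_sqr_le A0 ig).
Qed.

End riesz_fischer.

(** * The multilinear estimate *)

Section multilinear_sums.
Variables (R : realType) (d : nat).
Local Notation freq := 'rV[int]_d.
Local Notation factor := (seq freq * (freq -> R[i]))%type.
Implicit Types (xi : tdistr R d) (p q : factor) (ps qs : seq factor) (x y z n : freq).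

(** The Fourier coefficients of the product of [xi] with trigonometric
   polynomials, each given by its list of frequencies and its coefficients; the
   frequencies are reflected, which makes all the signs equal. *)
Fixpoint msum xi ps x : R[i] :=
  if ps is p :: ps' then \sum_(y <- p.1) p.2 y * msum xi ps' (x + y) else xi x.

Lemma msum_swap xi p q ps x : msum xi (p :: q :: ps) x = msum xi (q :: p :: ps) x.
Proof.
rewrite /=; under eq_bigr do rewrite mulr_sumr.
rewrite exchange_big /=; apply: eq_bigr => y _.
by rewrite mulr_sumr; apply: eq_bigr => z _; rewrite mulrCA addrAC.
Qed.

Lemma eq_msum xi p ps qs : msum xi ps =1 msum xi qs ->
  msum xi (p :: ps) =1 msum xi (p :: qs).
Proof. by move=> E x /=; apply: eq_bigr => y _; rewrite E. Qed.

Lemma msum_move xi ps p qs : msum xi (ps ++ p :: qs) =1 msum xi (p :: ps ++ qs).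
Proof.
elim: ps => [|q ps IH] x //=.
by rewrite -/(msum xi (p :: q :: ps ++ qs) x) msum_swap; exact: (eq_msum q IH).
Qed.

Lemma msum_perm (K : eqType) (g : K -> factor) xi (ks ks' : seq K) :
  perm_eq ks ks' -> msum xi (map g ks) =1 msum xi (map g ks').
Proof.
elim: ks ks' => [|k ks IH] ks'.
  by move=> /perm_size /esym /eqP; rewrite size_eq0 => /eqP ->.
move=> kks; have kks' : k \in ks' by rewrite -(perm_mem kks) mem_head.
move: kks; case/splitPr: kks' => a b.
rewrite perm_sym perm_catC cat_cons perm_cons perm_catC perm_sym => /IH E x.
rewrite map_cat /= msum_move -map_cat.
exact: (eq_msum (g k) E).
Qed.

Definition l1 p : R := \sum_(y <- p.1) cabs (p.2 y).

Lemma l1_ge0 p : 0 <= l1 p.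
Proof. by apply: sumr_ge0 => y _; exact: cabs_ge0. Qed.

(** Sum the factors of low frequency in l1: together they move the argument of
   the remaining factors by at most [size ks * r]. *)
Lemma msum_outer (K : eqType) (g : K -> factor) xi (ks : seq K) qs (r B : R) x :
  (forall k, k \in ks -> forall y, y \in (g k).1 -> freq_small y r) ->
  (forall z, freq_small z ((size ks)%:R * r) -> cabs (msum xi qs (x + z)) <= B) ->
  cabs (msum xi (map g ks ++ qs) x) <= \prod_(k <- ks) l1 (g k) * B.
Proof.
elim: ks x => [|k ks IH] x kr H /=.
  rewrite big_nil mul1r; have := H 0; rewrite addr0; apply=> j.
  by rewrite mxE normr0 mul0r.
apply: le_trans (cabs_sum _ _ _) _; rewrite big_cons -mulrA [l1 (g k)]/l1 mulr_suml.
rewrite [leLHS]big_seq [leRHS]big_seq; apply: ler_sum => y yk.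
rewrite cabsM ler_wpM2l ?cabs_ge0 //; apply: IH => [k' kk'|z zr].
  by apply: kr; rewrite in_cons kk' orbT.
rewrite -addrA; apply: H.
rewrite /= -[(size ks).+1%:R]natr1 mulrDl mul1r [X in freq_small _ X]addrC.
by apply: freq_smallD => //; apply: (kr k) => //; rewrite mem_head.
Qed.

Definition shell (n : freq) : nat := trunc_log 2 (Num.truncn (@jap R d n 1)).

Lemma jap1_ge1 n : 1 <= jap n (1 : R).
Proof. by rewrite -{1}(jap0 R n) jap_le. Qed.

Lemma shell_lower n : 2 ^+ shell n <= jap n (1 : R).
Proof.
have j1 := jap1_ge1 n.
apply: (@le_trans _ _ (Num.truncn (jap n (1 : R)))%:R).
  by rewrite -natrX ler_nat trunc_logP // truncn_gt0.
by rewrite truncn_le // (le_trans ler01).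
Qed.

Lemma shell_upper n : jap n (1 : R) <= 2 * 2 ^+ shell n.
Proof.
apply: le_trans (ltW (truncnS_gt _)) _.
by rewrite -exprS -natrX ler_nat trunc_log_ltn.
Qed.

Lemma jap1_sqr n : jap n (1 : R) ^+ 2 = 1 + freq_sqnorm R n.
Proof.
by rewrite /jap div1r powR12_sqrt ?ltW ?freq_bracket_gt0 // sqr_sqrtr ?ltW ?freq_bracket_gt0.
Qed.

Lemma japE n (s : R) : jap n s = jap n 1 `^ s.
Proof. by rewrite /jap -powRrM div1r mulrC. Qed.

Lemma shell_small n : freq_small n (2 * 2 ^+ shell n : R).
Proof.
apply: sqnorm_freq_small; first by rewrite mulr_ge0 ?exprn_ge0.
apply: (@le_trans _ _ (jap n (1 : R) ^+ 2)); first by rewrite jap1_sqr lerDr.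
by rewrite lerXn2r ?nnegrE ?jap_ge0 ?mulr_ge0 ?exprn_ge0 // shell_upper.
Qed.

Definition pow2 (I : nat) (a : R) : R := (2 ^+ I) `^ a.

Lemma pow2_ge0 I a : 0 <= pow2 I a. Proof. exact: powR_ge0. Qed.

Lemma pow2D I a b : pow2 I (a + b) = pow2 I a * pow2 I b.
Proof. by rewrite /pow2 powRD // expf_eq0 pnatr_eq0 andbF implybT. Qed.

Lemma pow2E I a : pow2 I a = 2 `^ (I%:R * a).
Proof. by rewrite /pow2 -powR_mulrn // -powRrM. Qed.

Section one_block.
Variables (L : seq freq) (u : freq -> R[i]) (I : nat).
Let LI := [seq y <- L | shell y == I].

Lemma block_l2 (e : R) : 0 <= e ->
  l2 LI u <= pow2 I (- e) * l2 L (fun n => real_complex R (jap n e) * u n).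
Proof.
move=> e0; rewrite l2_leP ?mulr_ge0 ?pow2_ge0 ?l2_ge0 // exprMn l2_sqr mulr_sumr.
rewrite big_filter [leRHS](bigID (fun y => shell y == I)) /= ler_wpDr //.
  by apply: sumr_ge0 => y _; rewrite mulr_ge0 ?sqr_ge0.
apply: ler_sum => y /eqP yI; rewrite -exprMn cabsM.
rewrite lerXn2r ?nnegrE ?mulr_ge0 ?cabs_ge0 ?pow2_ge0 // cabs_real ger0_norm ?jap_ge0 //.
rewrite mulrA ler_peMl ?cabs_ge0 // /pow2 powRN mulrC ler_pdivlMr ?powR_gt0 ?exprn_gt0 //.
rewrite mul1r japE; apply: ge0_ler_powR => //; rewrite ?nnegrE ?exprn_ge0 ?jap_ge0 //.
by rewrite -yI shell_lower.
Qed.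

(** The shell [I] lies in a box with at most [(5 * 2 ^ I) ^ d] points. *)
Lemma block_l1 : uniq L ->
  l1 (LI, u) <= 5 `^ (d%:R / 2) * pow2 I (d%:R / 2) * l2 LI u.
Proof.
move=> uL.
have szL : (size LI)%:R <= (5 * 2 ^+ I : R) ^+ d.
  have : (size LI <= (2 * 2 ^ I).*2.+1 ^ d)%N.
    apply: (@size_freq_small R); first by rewrite filter_uniq.
    move=> n; rewrite mem_filter => /andP[/eqP <- _].
    by rewrite natrM natrX; exact: shell_small.
  rewrite -(ler_nat R) natrX => /le_trans; apply.
  rewrite lerXn2r ?nnegrE ?mulr_ge0 ?exprn_ge0 //.
  rewrite -natrX -natrM ler_nat -muln2; have := expn_gt0 2 I; lia.
have -> : 5 `^ (d%:R / 2) * pow2 I (d%:R / 2) = Num.sqrt ((5 * 2 ^+ I : R) ^+ d).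
  rewrite /pow2 -powRM ?exprn_ge0 // -powR12_sqrt ?exprn_ge0 ?mulr_ge0 ?exprn_ge0 //.
  have c0 : 0 <= 5 * 2 ^+ I :> R by rewrite mulr_ge0 ?exprn_ge0.
  by rewrite -(powR_mulrn d c0) -powRrM ?div1r.
rewrite /l1 /=.
under eq_bigr do rewrite -[cabs _]mul1r.
apply: le_trans (cauchy_schwarz _ _ _) _; rewrite ler_wpM2r ?l2_ge0 //.
rewrite ler_wsqrtr // expr1n big_const_seq count_predT iter_addr_0.
exact: szL.
Qed.

End one_block.
End multilinear_sums.

Section multilinear_estimate.
Variables (R : realType) (d : nat).
Local Notation freq := 'rV[int]_d.
Implicit Types (xi : tdistr R d) (L : nat -> seq freq) (u : nat -> freq -> R[i]).
Implicit Types (e : nat -> R).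

Definition factor_block L u (k : nat * nat) : seq freq * (freq -> R[i]) :=
  ([seq y <- L k.1 | shell R y == k.2], u k.1).

Definition factor_norm L u e (i : nat) : R :=
  l2 (L i) (fun n => real_complex R (jap n (e i)) * u i n).

Lemma factor_norm_ge0 L u e i : 0 <= factor_norm L u e i.
Proof. exact: l2_ge0. Qed.

(** The two largest frequencies are summed in l2 against the operator norm, and
   the weight costs a power of the largest one only. *)
Lemma two_factor_bound (s rho K : R) : 0 < rho -> - s < rho -> 0 <= K ->
  exists2 C, 0 <= C & forall xi A, mult_bounded s xi A -> 0 <= A ->
  forall (I : nat) (S T : seq freq) (v w : freq -> R[i]) x, uniq S -> uniq T ->
    (forall y, y \in S -> freq_small (x + y) (K * 2 ^+ I)) ->
    (forall z, z \in T -> freq_small z (K * 2 ^+ I)) ->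
    cabs (msum xi [:: (S, v); (T, w)] x) <= C * A * pow2 I rho * l2 S v * l2 T w.
Proof.
move=> rho0 srho K0; have [C C0 HC] := @schur_jap R d s rho K rho0 srho K0.
exists C => // xi A xiA A0 I S T v w x uS uT xS zT.
have N1 : 1 <= 2 ^+ I :> R by rewrite exprn_ege1 // ler1n.
have := HC _ N1 x S T xS zT _ A A0 (xiA x S T uS uT) v w.
rewrite /= [C * _ * A]mulrAC; apply: le_trans.
apply: le_of_eq; congr cabs.
apply: eq_bigr => y _; rewrite mulr_sumr; apply: eq_bigr => z _.
rewrite [X in _ = _ * X * _]mulrA -rmorphM /= -japD addNr jap0 mul1r.
by rewrite mulrCA mulrA [v y * _]mulrC; ring.
Qed.

(** A power counting of the shells [Ip >= Iq >= I k]: raising the small shells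
   to [Iq] leaves a linear function of [Ip] and [Iq], whose two
   extreme cases [Iq = 0] and [Iq = Ip] are the hypotheses on the exponents. *)
Lemma exponent_bound (rho eta ep eq S Ip Iq : R) (n : nat) (K : Type)
    (rest : seq K) (I c : K -> R) :
  0 <= Iq -> Iq <= Ip -> (size rest).+2 = n -> 0 < eta ->
  all (fun k => I k <= Iq) rest -> all (fun k => 0 <= c k) rest ->
  S = \sum_(k <- rest) c k ->
  rho - ep <= - eta -> rho - ep - eq + S <= - eta ->
  (rho - ep) * Ip - eq * Iq + \sum_(k <- rest) I k * c k <=
  - (eta / n%:R) * (Ip + Iq + \sum_(k <- rest) I k).
Proof.
move=> Iq0 Iqp szn eta0 IkI c0 SE h1 h2.
have hS : \sum_(k <- rest) I k * c k <= Iq * S.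
  rewrite SE mulr_sumr; elim: (rest) IkI c0 => [|k r IH] /=; first by rewrite !big_nil.
  by move=> /andP[ik ir] /andP[ck cr]; rewrite !big_cons lerD ?ler_wpM2r ?IH.
have hI : \sum_(k <- rest) I k <= (size rest)%:R * Iq.
  elim: (rest) IkI => [|k r IH] /=; first by rewrite big_nil mul0r.
  by move=> /andP[ik ir]; rewrite big_cons -natr1 mulrDl mul1r addrC lerD ?IH.
have nR : n%:R = (size rest)%:R + 2 :> R by rewrite -szn -addn2 natrD.
have n0 : 0 < n%:R :> R by rewrite ltr0n -szn.
apply: (@le_trans _ _ (- eta * Ip)); last first.
  rewrite mulNr [leRHS]mulNr lerN2 mulrAC ler_pdivrMr // -mulrA ler_pM2l //.
  rewrite nR; have := ler0n R (size rest); nra.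
have [Sq|Sq] := leP S eq; nra.
Qed.

Lemma prod_pow2 (K : Type) (r : seq K) (a : K -> R) :
  \prod_(k <- r) (2 `^ a k) = 2 `^ (\sum_(k <- r) a k).
Proof.
elim: r => [|k r IH]; first by rewrite !big_nil powRr0.
by rewrite !big_cons IH powRD // pnatr_eq0 implybT.
Qed.

Lemma sum_geometric (z : R) K : 0 <= z < 1 -> \sum_(I < K) z ^+ I <= (1 - z)^-1.
Proof.
move=> /andP[z0 z1]; rewrite -[leRHS]mul1r ler_pdivlMr ?subr_gt0 //.
elim: K => [|K IH]; first by rewrite big_ord0 mul0r.
have -> : (\sum_(I < K.+1) z ^+ I) * (1 - z) = 1 - z ^+ K.+1.
  elim: K {IH} => [|K IH]; first by rewrite big_ord1 expr0 expr1 mul1r.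
  by rewrite big_ord_recr /= mulrDl IH [in RHS]exprS; ring.
by rewrite gerBl exprn_ge0.
Qed.

Lemma positive_lower_bound (r : seq nat) (f : nat -> R) :
  (forall i, i \in r -> 0 < f i) -> exists2 t, 0 < t & forall i, i \in r -> t <= f i.
Proof.
elim: r => [|i r IH] H; first by exists 1.
have [t t0 Ht] : exists2 t, 0 < t & forall i, i \in r -> t <= f i.
  by apply: IH => j jr; rewrite H // in_cons jr orbT.
exists (Num.min t (f i)); first by rewrite lt_min t0 H ?mem_head.
move=> j; rewrite in_cons => /predU1P[->|jr]; first by rewrite ge_min lexx orbT.
by rewrite ge_min Ht.
Qed.

Lemma prod_le_scale (K : eqType) (r : seq K) (f g : K -> R) (c : R) :
  (forall k, k \in r -> 0 <= f k <= c * g k) ->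
  \prod_(k <- r) f k <= c ^+ size r * \prod_(k <- r) g k.
Proof.
elim: r => [|k r IH] H; first by rewrite !big_nil mulr1.
have /andP[f0 fg] := H k (mem_head _ _).
have H' j : j \in r -> 0 <= f j <= c * g j by move=> jr; apply: H; rewrite in_cons jr orbT.
rewrite !big_cons exprS mulrACA ler_pM ?IH //.
by rewrite big_seq; apply: prodr_ge0 => j /H' /andP[].
Qed.

(** Decompose every factor into dyadic shells.  For each choice of shells the
   two factors of largest frequency are estimated in l2 and the others in l1, so
   that each contributes [2 ^ (d / 2)] per shell; the conditions on the
   exponents leave a negative power of all the shells. *)
Lemma block_bound (s rho : R) (js : seq nat) e :
  0 < rho -> - s < rho -> (1 < size js)%N ->
  (forall i, i \in js -> rho < e i <= d%:R / 2) ->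
  rho + \sum_(i <- js) (d%:R / 2 - e i) < d%:R ->
  exists2 eta, 0 < eta & exists2 C, 0 <= C & forall xi A L u,
    mult_bounded s xi A -> 0 <= A -> (forall i, i \in js -> uniq (L i)) ->
  forall ks : seq (nat * nat), map fst ks = js ->
    cabs (msum xi [seq factor_block L u k | k <- ks] 0) <=
    C * A * \prod_(k <- ks) (pow2 k.2 (- eta) * factor_norm L u e k.1).
Proof.
move=> rho0 srho szjs ejs esum.
have [t0 t0_gt0 Ht0] := @positive_lower_bound js (fun i => e i - rho)
  ltac:(by move=> i /ejs /andP[]; rewrite subr_gt0).
pose eta0 := Num.min t0 (d%:R - rho - \sum_(i <- js) (d%:R / 2 - e i)).
have eta0_gt0 : 0 < eta0 by rewrite lt_min t0_gt0; move: esum; lra.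
have n0 : 0 < (size js)%:R :> R by rewrite ltr0n (leq_trans _ szjs).
have [C C0 HC] := @two_factor_bound s rho (2 * (size js)%:R) rho0 srho
  ltac:(by rewrite mulr_ge0).
pose c5 : R := 5 `^ (d%:R / 2).
have c51 : 1 <= c5.
  by rewrite -[leLHS](powRr0 5) ler_powR ?divr_ge0 // ler1n.
exists (eta0 / (size js)%:R); first by rewrite divr_gt0.
exists (C * c5 ^+ size js); first by rewrite mulr_ge0 ?exprn_ge0 // (le_trans ler01).
move=> xi A L u xiA A0 uL ks ksjs.
have szks : size ks = size js by rewrite -ksjs size_map.
pose le2 (k k' : nat * nat) := (k.2 <= k'.2)%N.
have le2_total : total le2 by move=> k k'; exact: leq_total.
have le2_trans : transitive le2 by move=> k k' k''; exact: leq_trans.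
have : sorted le2 (sort le2 ks) by exact: sort_sorted.
have : perm_eq ks (sort le2 ks) by rewrite perm_sym perm_sort.
move: (sort le2 ks) => ks' ks's srt.
have := perm_size ks's; rewrite szks.
have kin k : k \in ks' -> k.1 \in js.
  by rewrite -(perm_mem ks's) -ksjs => kks; apply: map_f.
rewrite (msum_perm _ _ ks's) (perm_big _ ks's) /=.
have {esum} : \sum_(i <- js) (d%:R / 2 - e i) = \sum_(k <- ks') (d%:R / 2 - e k.1).
  by rewrite -ksjs big_map (perm_big _ ks's).
move: srt kin; case/lastP: ks' {ks's} => [|ks' p]; first by move=> _ _ _ h; move: szjs; rewrite h.
case/lastP: ks' => [|rest q]; first by move=> _ _ _ h; move: szjs; rewrite h.
rewrite -!cats1 -catA /= => srt kin esumE szE.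
have Iqp : (q.2 <= p.2)%N.
  by move: srt; rewrite sorted_cat_cons => /andP[_]; rewrite /= andbT.
have Irest k : k \in rest -> (k.2 <= q.2)%N.
  move: srt; rewrite (sorted_pairwise le2_trans) pairwise_cat => /and3P[/allrelP + _ _].
  by move=> /(_ k q) /[apply]; apply; rewrite mem_head.
have kp : p.1 \in js by apply: kin; rewrite mem_cat !in_cons eqxx !orbT.
have kq : q.1 \in js by apply: kin; rewrite mem_cat in_cons eqxx orbT.
have kr k : k \in rest -> k.1 \in js by move=> kr; apply: kin; rewrite mem_cat kr.
rewrite map_cat /=.
(* The factors outside the two largest ones only translate the argument by a
   multiple of [2 ^ q.2 <= 2 ^ p.2]. *)
have inner z : freq_small z ((size rest)%:R * (2 * 2 ^+ q.2) : R) ->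
    cabs (msum xi [:: factor_block L u q; factor_block L u p] (0 + z)) <=
    C * A * pow2 p.2 rho * l2 (factor_block L u q).1 (u q.1)
      * l2 (factor_block L u p).1 (u p.1).
  move=> zs; rewrite add0r; apply: HC => //.
  - by rewrite filter_uniq // uL.
  - by rewrite filter_uniq // uL.
  - move=> y; rewrite mem_filter => /andP[/eqP yI _].
    apply: freq_small_le (freq_smallD zs (shell_small R y)).
    rewrite yI szE size_cat /= natrD.
    have := ler0n R (size rest); have : 2 ^+ q.2 <= 2 ^+ p.2 :> R by rewrite ler_weXn2l ?ler1n.
    have : 0 <= 2 ^+ q.2 :> R by rewrite exprn_ge0.
    move: (2 ^+ q.2 : R) (2 ^+ p.2 : R) ((size rest)%:R : R) => a b c a0 ab c0.
    have := mulr_ge0 c0 a0; have : c * a <= c * b by rewrite ler_wpM2l.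
    by nra.
  - move=> y; rewrite mem_filter => /andP[/eqP yI _].
    apply: freq_small_le (shell_small R y); rewrite yI.
    rewrite ler_wpM2r ?exprn_ge0 // ler_peMr // ler1n.
    exact: leq_trans szjs.
have outer := @msum_outer R d _ (factor_block L u) xi rest _ (2 * 2 ^+ q.2) _ 0 _ inner.
apply: le_trans (outer _) _.
  move=> k krest y; rewrite /= mem_filter => /andP[/eqP yI _].
  apply: freq_small_le (shell_small R y); rewrite yI ler_pM2l // ler_weXn2l ?ler1n //.
  exact: Irest.
pose F (k : nat * nat) := factor_norm L u e k.1.
have F0 k : 0 <= F k by exact: factor_norm_ge0.
have e0 i : i \in js -> 0 <= e i by move=> /ejs /andP[h _]; apply: ltW; apply: lt_trans h.
have hl2 k : k.1 \in js ->
    l2 (factor_block L u k).1 (u k.1) <= 2 `^ (k.2%:R * - e k.1) * F k.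
  by move=> kj; rewrite -pow2E; apply: block_l2; exact: e0.
have hl1 k : k \in rest ->
    l1 (factor_block L u k) <= c5 * (2 `^ (k.2%:R * (d%:R / 2 - e k.1)) * F k).
  move=> krest; apply: le_trans (block_l1 _ _ (uL _ (kr k krest))) _.
  rewrite -pow2E pow2D -!mulrA ler_wpM2l ?powR_ge0 // ler_wpM2l ?pow2_ge0 //.
  by rewrite pow2E; apply: hl2; exact: kr.
have prod_l1 : \prod_(k <- rest) l1 (factor_block L u k) <= c5 ^+ size rest *
    (2 `^ (\sum_(k <- rest) k.2%:R * (d%:R / 2 - e k.1)) * \prod_(k <- rest) F k).
  rewrite -prod_pow2 -big_split /=; apply: prod_le_scale => k krest.
  by rewrite l1_ge0 hl1.
have pow2_last : 2 `^ (\sum_(k <- rest) k.2%:R * (d%:R / 2 - e k.1)) *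
    (pow2 p.2 rho * (2 `^ (q.2%:R * - e q.1)) * (2 `^ (p.2%:R * - e p.1))) <=
    \prod_(k <- rest ++ [:: q; p]) pow2 k.2 (- (eta0 / (size js)%:R)).
  under [leRHS]eq_bigr do rewrite pow2E.
  rewrite prod_pow2 pow2E -!powRD ?pnatr_eq0 ?implybT //.
  rewrite ler_powR ?ler1n // -mulr_suml big_cat !big_cons big_nil /= addr0.
  have h1 : rho - e p.1 <= - eta0.
    have := Ht0 _ kp; have : eta0 <= t0 by rewrite ge_min lexx.
    by lra.
  have h2 : rho - e p.1 - e q.1 + \sum_(k <- rest) (d%:R / 2 - e k.1) <= - eta0.
    have : eta0 <= d%:R - rho - \sum_(i <- js) (d%:R / 2 - e i) by rewrite ge_min lexx orbT.
    rewrite esumE big_cat !big_cons big_nil /= addr0.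
    by move: (\sum_(_ <- _) _) => S; lra.
  have Ir : all (fun k : nat * nat => k.2%:R <= q.2%:R :> R) rest.
    by apply/allP => k /Irest; rewrite ler_nat.
  have cr : all (fun k : nat * nat => 0 <= d%:R / 2 - e k.1) rest.
    by apply/allP => k /kr /ejs /andP[_]; rewrite subr_ge0.
  have Iqp' : q.2%:R <= p.2%:R :> R by rewrite ler_nat.
  have szE' : (size rest).+2 = size js by rewrite szE size_cat addn2.
  have := exponent_bound (ler0n _ q.2) Iqp' szE' eta0_gt0 Ir cr erefl h1 h2.
  rewrite mulrC; set X := \sum_(_ <- _) _; set Z := \sum_(_ <- _) _ => h.
  apply: le_trans (le_trans _ h) _; first by apply: le_of_eq; ring.
  by apply: le_of_eq; ring.
rewrite big_split /=.
have FE : \prod_(k <- rest ++ [:: q; p]) factor_norm L u e k.1 =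
    \prod_(k <- rest) F k * (F q * F p).
  by rewrite big_cat !big_cons big_nil /= mulr1.
rewrite FE.
have PF0 : 0 <= \prod_(k <- rest) F k by apply: prodr_ge0.
apply: (@le_trans _ _ (c5 ^+ size rest *
    (2 `^ (\sum_(k <- rest) k.2%:R * (d%:R / 2 - e k.1)) * \prod_(k <- rest) F k) *
    (C * A * pow2 p.2 rho * (2 `^ (q.2%:R * - e q.1) * F q) * (2 `^ (p.2%:R * - e p.1) * F p)))).
  apply: ler_pM => //.
  - by apply: prodr_ge0 => k _; exact: l1_ge0.
  - by rewrite !mulr_ge0 ?pow2_ge0 ?l2_ge0.
  - apply: ler_pM; rewrite ?l2_ge0 ?hl2 // ?mulr_ge0 ?pow2_ge0 ?l2_ge0 //.
    by rewrite ler_wpM2l ?hl2 // !mulr_ge0 ?pow2_ge0.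
set W := \prod_(k <- rest) F k; set a1 := _ `^ _; set a2 := _ `^ (_ * - e q.1).
set a3 := _ `^ (_ * - e p.1); set c1 := c5 ^+ size rest; set c2 := c5 ^+ size js.
set X := \prod_(k <- _) _.
have c12 : c1 <= c2 by rewrite ler_weXn2l // szE size_cat leq_addr.
have c10 : 0 <= c1 by rewrite exprn_ge0 // (le_trans ler01).
have -> : c1 * (a1 * W) * (C * A * pow2 p.2 rho * (a2 * F q) * (a3 * F p)) =
    (C * A * (W * (F q * F p)) * c1) * (a1 * (pow2 p.2 rho * a2 * a3)).
  by move: c1 {c10 c12 pow2_last} a1 a2 a3 => *; ring.
have -> : C * c2 * A * (X * (W * (F q * F p))) = (C * A * (W * (F q * F p)) * c2) * X.
  by move: c2 {c12} => *; ring.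
have CW : 0 <= C * A * (W * (F q * F p)) by rewrite !mulr_ge0.
apply: ler_pM => //; first by rewrite mulr_ge0.
  by rewrite !mulr_ge0 ?powR_ge0 ?pow2_ge0.
by rewrite ler_wpM2l.
Qed.

Lemma msum_shells xi (ps qs : seq (seq freq * (freq -> R[i]))) (M : seq freq)
    (v : freq -> R[i]) (K : nat) x :
  (forall y, y \in M -> (shell R y < K)%N) ->
  msum xi (ps ++ (M, v) :: qs) x =
  \sum_(I < K) msum xi (ps ++ ([seq y <- M | shell R y == I], v) :: qs) x.
Proof.
move=> MK; elim: ps x => [|p ps IH] x /=; last first.
  by rewrite exchange_big /=; apply: eq_bigr => y _; rewrite IH mulr_sumr.
under [RHS]eq_bigr do rewrite big_filter.
rewrite (exchange_big_dep xpredT) //= big_seq [RHS]big_seq; apply: eq_bigr => y yM.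
rewrite (bigD1 (Ordinal (MK y yM))) //= big1 ?addr0 // => I /andP[/eqP yI].
by rewrite -val_eqE /= yI eqxx.
Qed.

(** The sum over all the choices of shells of the bounds for the blocks is a
   product of geometric series. *)
Theorem multilinear_estimate (s rho : R) (js : seq nat) e :
  0 < rho -> - s < rho -> (1 < size js)%N ->
  (forall i, i \in js -> rho < e i <= d%:R / 2) ->
  rho + \sum_(i <- js) (d%:R / 2 - e i) < d%:R ->
  exists2 C, 0 <= C & forall xi A L u,
    mult_bounded s xi A -> 0 <= A -> (forall i, i \in js -> uniq (L i)) ->
    cabs (msum xi [seq (L i, u i) | i <- js] 0) <=
    C * A * \prod_(i <- js) factor_norm L u e i.
Proof.
move=> rho0 srho szjs ejs esum.
have [eta eta0 [C C0 HC]] := block_bound rho0 srho szjs ejs esum.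
pose z : R := 2 `^ (- eta).
have z01 : 0 <= z < 1.
  rewrite powR_ge0 /z powRN invf_lt1 ?powR_gt0 //.
  have := @gt0_ltr_powR R eta eta0 1 2; rewrite powR1; apply; rewrite ?nnegrE //.
  by rewrite ltr1n.
pose G := (1 - z)^-1.
have G0 : 0 <= G by rewrite invr_ge0 subr_ge0; case/andP: z01 => _ /ltW.
exists (C * G ^+ size js); first by rewrite mulr_ge0 ?exprn_ge0.
move=> xi A L u xiA A0 uL.
have [K HK] : exists K, forall i, i \in js -> forall y, y \in L i -> (shell R y < K)%N.
  exists (\max_(i <- js) \max_(y <- L i) (shell R y).+1)%N => i ij y yL.
  apply: (@leq_trans (\max_(y <- L i) (shell R y).+1)).
    by rewrite (big_rem y) //= leq_maxl.
  by rewrite (big_rem i ij) /= leq_maxl.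
pose a (k : nat * nat) := pow2 k.2 (- eta) * factor_norm L u e k.1.
have main (pre : seq (nat * nat)) (rest : seq nat) : map fst pre ++ rest = js ->
    cabs (msum xi (map (factor_block L u) pre ++ [seq (L i, u i) | i <- rest]) 0) <=
    C * A * (\prod_(k <- pre) a k * \prod_(i <- rest) (G * factor_norm L u e i)).
  elim: rest pre => [|i rest IH] pre E.
    by rewrite !cats0 in E *; rewrite big_nil mulr1; exact: HC.
  have ij : i \in js by rewrite -E mem_cat mem_head orbT.
  rewrite /= (@msum_shells xi _ _ _ _ K) => [|y yL]; last exact: HK yL.
  apply: le_trans (cabs_sum _ _ _) _.
  apply: (@le_trans _ _ (\sum_(I < K) C * A * (\prod_(k <- rcons pre (i, I : nat)) a k *
      \prod_(j <- rest) (G * factor_norm L u e j)))).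
    apply: ler_sum => I _; have := IH (rcons pre (i, I : nat)).
    rewrite !map_rcons !cat_rcons; apply; exact: E.
  rewrite [leLHS](_ : _ = C * A * (\prod_(k <- pre) a k *
      ((\sum_(I < K) a (i, I : nat)) * \prod_(j <- rest) (G * factor_norm L u e j)))); last first.
    rewrite mulr_suml !mulr_sumr; apply: eq_bigr => I _.
    by rewrite -cats1 big_cat big_seq1 /=; ring.
  rewrite ler_wpM2l ?mulr_ge0 // ler_wpM2l //.
    by apply: prodr_ge0 => k _; rewrite mulr_ge0 ?pow2_ge0 ?factor_norm_ge0.
  rewrite big_cons ler_wpM2r //.
    by apply: prodr_ge0 => j _; rewrite mulr_ge0 ?factor_norm_ge0.
  rewrite /a /= -mulr_suml ler_wpM2r ?factor_norm_ge0 //.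
  apply: le_trans (sum_geometric K z01); apply: ler_sum => I _.
  by rewrite pow2E /z -powR_mulrn ?powR_ge0 // -powRrM mulrC.
have := main [::] js erefl; rewrite big_nil mul1r /= => H; apply: le_trans H _.
have -> : C * G ^+ size js * A * \prod_(i <- js) factor_norm L u e i =
    C * A * (G ^+ size js * \prod_(i <- js) factor_norm L u e i).
  by move: (G ^+ size js) => *; ring.
rewrite ler_wpM2l ?mulr_ge0 //; apply: prod_le_scale => i ij.
by rewrite lexx andbT mulr_ge0 ?factor_norm_ge0.
Qed.

End multilinear_estimate.

(** * The spaces H^s and limits of distributions *)

Section hs_algebra.
Variables (R : realType) (d : nat).
Implicit Types (f g : tdistr R d) (s A B c : R) (n : 'rV[int]_d).

Lemma hs_ge0 s f A : hs s f A -> 0 <= A.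
Proof. by move=> /(_ [::] isT); apply: le_trans; exact: l2_ge0. Qed.

Lemma hs_le s f A B : A <= B -> hs s f A -> hs s f B.
Proof. by move=> AB fA L uL; apply: le_trans (fA L uL) AB. Qed.

Lemma eq_hs s f g A : f =1 g -> hs s f A -> hs s g A.
Proof.
move=> fg fA L uL; apply: le_trans (fA L uL).
by apply/le_of_eq/eq_l2 => n _; rewrite fg.
Qed.

Lemma hsD s f g A B : hs s f A -> hs s g B -> hs s (fun n => f n + g n) (A + B).
Proof.
move=> fA gB L uL; apply: (le_trans _ (lerD (fA L uL) (gB L uL))).
apply: le_trans (l2D _ _ _).
by apply/le_of_eq/eq_l2 => n _; rewrite mulrDr.
Qed.

Lemma hsZ s f A c : hs s f A -> hs s (fun n => real_complex R c * f n) (`|c| * A).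
Proof.
move=> fA L uL; apply: (@le_trans _ _ (`|c| * l2 L (fun n => real_complex R (jap n s) * f n))).
  apply: le_trans (@l2_scale _ _ L (fun=> c) _ `|c| _ _) => //.
  by apply/le_of_eq/eq_l2 => n _; rewrite mulrCA.
by rewrite ler_wpM2l // fA.
Qed.

Lemma hsN s f A : hs s f A -> hs s (fun n => - f n) A.
Proof.
move=> /(hsZ (-1)); rewrite normrN1 mul1r; apply: eq_hs => n.
by rewrite rmorphN rmorph1 mulN1r.
Qed.

Lemma hsB s f g A B : hs s f A -> hs s g B -> hs s (tdistr_sub f g) (A + B).
Proof. by move=> fA /hsN gB; exact: hsD. Qed.

Lemma hs_subC s f g A : hs s (tdistr_sub f g) A -> hs s (tdistr_sub g f) A.
Proof. by move/hsN; apply: eq_hs => n; rewrite /tdistr_sub opprB. Qed.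

Lemma hs_sub_trans s f g h A B : hs s (tdistr_sub f g) A -> hs s (tdistr_sub g h) B ->
  hs s (tdistr_sub f h) (A + B).
Proof.
move=> fg gh; apply: eq_hs (hsD fg gh) => n.
by rewrite /tdistr_sub addrA subrK.
Qed.

Lemma hs0 s : hs s (fun _ : 'rV[int]_d => 0) 0.
Proof.
move=> L _; rewrite /l2 big1 ?sqrtr0 // => n _.
by rewrite mulr0 cabs0 expr0n.
Qed.

Lemma hs_sum s (I : Type) (r : seq I) (P : pred I) (f : I -> tdistr R d) (A : I -> R) :
  (forall i, P i -> hs s (f i) (A i)) ->
  hs s (fun n => \sum_(i <- r | P i) f i n) (\sum_(i <- r | P i) A i).
Proof.
move=> H; elim: r => [|i r IH].
  by rewrite big_nil; apply: eq_hs (hs0 s) => n; rewrite big_nil.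
rewrite big_cons; case: ifPn => Pi.
  by apply: eq_hs (hsD (H i Pi) IH) => n; rewrite big_cons Pi.
by apply: eq_hs IH => n; rewrite big_cons (negbTE Pi).
Qed.

Lemma hs_coef s f A n : hs s f A -> cabs (f n) <= A * jap n (- s).
Proof.
move=> fA; have := fA [:: n] isT; rewrite /l2 big_seq1 sqrtr_sqr.
rewrite ger0_norm ?cabs_ge0 // cabsM cabs_real ger0_norm ?jap_ge0 //.
by rewrite japN ler_pdivlMr ?jap_gt0 // mulrC.
Qed.

Lemma hs_eq0 s f : (forall e, 0 < e -> hs s f e) -> forall n, f n = 0.
Proof.
move=> H n; apply: cabs_eq0; apply/eqP; rewrite eq_le cabs_ge0 andbT.
apply/ler_addgt0Pr => e e0; rewrite add0r.
have := hs_coef n (H (e * jap n s) (mulr_gt0 e0 (jap_gt0 _ _))).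
by rewrite japN mulfK // jap_neq0.
Qed.

Lemma hs_dual s f A : 0 <= A ->
  (forall L (w : 'rV[int]_d -> R[i]), uniq L ->
    cabs (\sum_(n <- L) w n * f n) <= A * l2 L (fun n => real_complex R (jap n (- s)) * w n)) ->
  hs s f A.
Proof.
move=> A0 H L uL; apply: l2_dual => // v.
have := H L (fun n => real_complex R (jap n s) * v n) uL.
move=> h; apply: le_trans (le_trans _ h) _; last first.
  rewrite ler_wpM2l //; apply/le_of_eq/eq_l2 => n _.
  by rewrite mulrA -rmorphM -japD addNr jap0 mul1r.
by apply: le_of_eq; congr cabs; apply: eq_bigr => n _; ring.
Qed.

Definition pointwise_cvg (g : nat -> tdistr R d) f : Prop :=
  forall n, cabs (g N n - f n) @[N --> \oo] --> (0 : R).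

(** The H^s norm is lower semicontinuous. *)
Lemma hs_pointwise_lim s (g : nat -> tdistr R d) f A : pointwise_cvg g f ->
  (exists N0, forall N, (N0 <= N)%N -> hs s (g N) A) -> hs s f A.
Proof.
move=> gf [N0 HN0] L uL; apply/ler_addgt0Pr => e e0.
have sz0 : 0 < (size L)%:R + 1 :> R by rewrite ltr_wpDl.
have hN : \forall N \near \oo, forall n, n \in L ->
    cabs (g N n - f n) <= e / ((size L)%:R + 1) / jap n s.
  apply: near_seq_forall => n _.
  have e1 : 0 < e / ((size L)%:R + 1) / jap n s by rewrite !divr_gt0 // jap_gt0.
  have /cvgrPdist_le/(_ _ e1) := gf n; apply: filterS => N.
  by rewrite sub0r normrN ger0_norm // cabs_ge0.
have [N1 _ HN1] := hN.
pose N := maxn N0 N1.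
have gA := HN0 N (leq_maxl _ _) L uL.
have gfN := HN1 N (leq_maxr _ _).
apply: (@le_trans _ _ (l2 L (fun n => real_complex R (jap n s) * g N n)
    + l2 L (fun n => real_complex R (jap n s) * (f n - g N n)))).
  apply: le_trans (l2D _ _ _); apply/le_of_eq/eq_l2 => n _.
  by rewrite -mulrDr addrC subrK.
apply: lerD => //.
apply: (@le_trans _ _ (\sum_(n <- L) cabs (real_complex R (jap n s) * (f n - g N n)))).
  rewrite l2_leP ?sumr_ge0 // => [|n _]; last exact: cabs_ge0.
  elim: (L) => [|n r IH]; first by rewrite !big_nil expr0n.
  rewrite !big_cons sqrrD -addrA lerD2l; apply: le_trans IH _.
  rewrite lerDr mulrn_wge0 // mulr_ge0 ?cabs_ge0 // sumr_ge0 // => m _; exact: cabs_ge0.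
apply: (@le_trans _ _ (\sum_(n <- L) e / ((size L)%:R + 1))).
  rewrite big_seq [leRHS]big_seq; apply: ler_sum => n nL.
  rewrite cabsM cabs_real ger0_norm ?jap_ge0 // -cabsN opprB mulrC.
  by rewrite -ler_pdivlMr ?jap_gt0 // gfN.
rewrite big_const_seq count_predT iter_addr_0 -[leLHS]mulr_natr mulrAC ler_pdivrMr //.
by rewrite ler_pM2l // lerDl.
Qed.

Definition hs_cauchy s (g : nat -> tdistr R d) : Prop :=
  forall e, 0 < e -> exists N0, forall M N, (N0 <= M)%N -> (N0 <= N)%N ->
    hs s (tdistr_sub (g M) (g N)) e.

Definition tlim (g : nat -> tdistr R d) : tdistr R d := fun n =>
  Complex (limn (fun N => complex.Re (g N n))) (limn (fun N => complex.Im (g N n))).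

Lemma cauchy_real_cvgn (u : nat -> R) :
  (forall e, 0 < e -> exists N0, forall M N, (N0 <= M)%N -> (N0 <= N)%N ->
    `|u M - u N| <= e) -> cvgn u.
Proof.
move=> H; apply/cauchy_cvgP; apply: cauchy_exP => e e0.
have [N0 HN0] := H (e / 2) (divr_gt0 e0 (ltr0Sn _ _)).
exists (u N0); exists N0 => // N /= hN; rewrite -ball_normE /=.
by apply: le_lt_trans (HN0 _ _ _ _) _ => //; rewrite gtr_pMr // invf_lt1 // ltr1n.
Qed.

Lemma tlim_pointwise s (g : nat -> tdistr R d) : hs_cauchy s g -> pointwise_cvg g (tlim g).
Proof.
move=> gc n.
have coef e : 0 < e -> exists N0, forall M N, (N0 <= M)%N -> (N0 <= N)%N ->
    cabs (g M n - g N n) <= e.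
  move=> e0; have [N0 H] := gc _ (mulr_gt0 e0 (jap_gt0 n s)); exists N0 => M N hM hN.
  by have := hs_coef n (H M N hM hN); rewrite japN mulfK // jap_neq0.
have cRe : cvgn (fun N => complex.Re (g N n)).
  apply: cauchy_real_cvgn => e /coef[N0 H]; exists N0 => M N hM hN.
  apply: le_trans (H M N hM hN); apply: le_trans (norm_Re_le _).
  by case: (g M n) => a b; case: (g N n).
have cIm : cvgn (fun N => complex.Im (g N n)).
  apply: cauchy_real_cvgn => e /coef[N0 H]; exists N0 => M N hM hN.
  apply: le_trans (H M N hM hN); apply: le_trans (norm_Im_le _).
  by case: (g M n) => a b; case: (g N n).
apply/cvgrPdist_le => e e0.
have e20 : 0 < e / 2 by rewrite divr_gt0.
have /cvgrPdist_le/(_ _ e20) hRe := cRe.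
have /cvgrPdist_le/(_ _ e20) hIm := cIm.
near=> N.
rewrite sub0r normrN ger0_norm ?cabs_ge0 //; apply: le_trans (cabs_le_ReIm _) _.
rewrite [e]splitr; apply: lerD.
  have -> : complex.Re (g N n - tlim g n) = - (limn (fun N => complex.Re (g N n)) - complex.Re (g N n)).
    by rewrite /tlim; case: (g N n) => a b /=; rewrite opprB.
  by rewrite normrN; near: N.
have -> : complex.Im (g N n - tlim g n) = - (limn (fun N => complex.Im (g N n)) - complex.Im (g N n)).
  by rewrite /tlim; case: (g N n) => a b /=; rewrite opprB.
by rewrite normrN; near: N.
Unshelve. all: by end_near.
Qed.

Lemma pointwise_cvg_unique (g : nat -> tdistr R d) f h : pointwise_cvg g f -> pointwise_cvg g h -> f =1 h.
Proof.
move=> gf gh n; apply/eqP; rewrite -subr_eq0; apply/eqP; apply: cabs_eq0.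
apply/eqP; rewrite eq_le cabs_ge0 andbT.
have H : (cabs (g N n - f n) + cabs (g N n - h n)) @[N --> \oo] --> (0 + 0 : R).
  by apply: cvgD; [exact: gf|exact: gh].
rewrite addr0 in H; rewrite -(cvg_lim _ H) //.
apply: limr_ge; first exact: cvgP H.
apply: nearW => N; rewrite -[cabs (g N n - f n)]cabsN; apply: le_trans (cabsD _ _).
by rewrite opprB addrA subrK.
Qed.

End hs_algebra.

(** * Products of a distribution with powers of a function *)

Section truncated_products.
Variables (R : realType) (d : nat).
Implicit Types (xi f g v w : tdistr R d) (vs : seq (tdistr R d)) (s A B : R).
Implicit Types (N M : nat) (n : 'rV[int]_d).

(** Different factors are allowed, because powers of two functions are compared by
   replacing one factor at a time. *)
Definition mul_truncs N vs xi : tdistr R d := foldr (mul_trunc N) xi vs.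

Lemma iter_mul_trunc N v j xi : iter j (mul_trunc N v) xi = mul_truncs N (nseq j v) xi.
Proof. by elim: j => //= j ->. Qed.

Lemma mul_trunc_reflect N v f n :
  mul_trunc N v f n = \sum_(y <- freq_ball R d N) v (- y) * f (n + y).
Proof.
rewrite mul_truncE.
have p : perm_eq (freq_ball R d N) [seq - y | y <- freq_ball R d N].
  apply: uniq_perm; first exact: freq_ball_uniq.
    by rewrite (map_inj_uniq (@oppr_inj _)) freq_ball_uniq.
  move=> y; apply/idP/mapP => [yN|[z zN ->]]; last by rewrite freq_ball_opp.
  by exists (- y); rewrite ?opprK // freq_ball_opp.
by rewrite (perm_big _ p) big_map; apply: eq_bigr => y _; rewrite opprK mulrC.
Qed.

Lemma mul_truncs_msum N vs xi n : mul_truncs N vs xi n =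
  msum xi [seq (freq_ball R d N, fun y => v (- y)) | v <- vs] n.
Proof.
elim: vs n => [|v vs IH] n //=.
by rewrite mul_trunc_reflect; apply: eq_bigr => y _; rewrite IH.
Qed.

Lemma mul_truncs_cat N vs ws xi :
  mul_truncs N (vs ++ ws) xi = mul_truncs N vs (mul_truncs N ws xi).
Proof. by rewrite /mul_truncs foldr_cat. Qed.

Lemma mul_truncB N v f g n :
  mul_trunc N v (tdistr_sub f g) n = tdistr_sub (mul_trunc N v f) (mul_trunc N v g) n.
Proof.
rewrite /tdistr_sub !mul_truncE -sumrB; apply: eq_bigr => m _.
by rewrite mulrBl.
Qed.

Lemma mul_truncsB N vs f g :
  mul_truncs N vs (tdistr_sub f g) =
  tdistr_sub (mul_truncs N vs f) (mul_truncs N vs g).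
Proof.
elim: vs => [|v vs IH] //=; rewrite IH.
by apply/funext => n; rewrite mul_truncB.
Qed.

Lemma mul_truncBl N v w f :
  mul_trunc N (tdistr_sub v w) f = tdistr_sub (mul_trunc N v f) (mul_trunc N w f).
Proof.
apply/funext => n; rewrite /tdistr_sub !mul_truncE -sumrB; apply: eq_bigr => m _.
by rewrite mulrBr.
Qed.

(** Moving the truncation from the operation to the function compares truncations
   of two orders as products with two functions. *)
Definition freq_cut N v : tdistr R d := fun n => if n \in freq_ball R d N then v n else 0.

Lemma mul_trunc_cut N M v f : (N <= M)%N ->
  mul_trunc N v f = mul_trunc M (freq_cut N v) f.
Proof.
move=> NM; apply/funext => n; rewrite !mul_truncE.
rewrite (big_sub_filter _ (freq_ball_uniq R d N) (freq_ball_uniq R d M) (freq_ball_sub NM)).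
rewrite [X in _ + X]big1_seq ?addr0.
  by apply: eq_big_seq => m mN; rewrite /freq_cut mN.
by move=> m /andP[_]; rewrite mem_filter /freq_cut => /andP[/negbTE -> _]; rewrite mulr0.
Qed.

Lemma hs_cut s v A N : hs s v A -> hs s (freq_cut N v) A.
Proof.
move=> vA L uL; apply: le_trans (vA L uL).
rewrite l2_leP ?l2_ge0 // l2_sqr; apply: ler_sum => n _.
rewrite /freq_cut; case: ifP => _ //.
by rewrite mulr0 cabs0 expr0n sqr_ge0.
Qed.

Lemma hs_cut_cvg s v A e : hs s v A -> 0 < e -> exists N0, forall N, (N0 <= N)%N ->
  hs s (tdistr_sub v (freq_cut N v)) e.
Proof.
move=> vA e0; have [N0 H] := l2_tail vA e0; exists N0 => N hN L uL.
apply: le_trans (H N hN [seq n <- L | n \notin freq_ball R d N] _ _); last 2 first.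
- by rewrite filter_uniq.
- by move=> n; rewrite mem_filter => /andP[].
rewrite l2_leP ?l2_ge0 // l2_sqr big_filter [leLHS](bigID (mem (freq_ball R d N))) /=.
rewrite big1 ?add0r => [|n nN]; last by rewrite /tdistr_sub /freq_cut nN subrr mulr0 cabs0 expr0n.
apply: ler_sum => n nN; rewrite /tdistr_sub /freq_cut.
by rewrite (negbTE nN) subr0.
Qed.

Fixpoint hs_all (s : R) vs (Bs : seq R) : Prop :=
  match vs, Bs with
  | [::], [::] => True
  | v :: vs', B :: Bs' => hs s v B /\ hs_all s vs' Bs'
  | _, _ => False
  end.

Lemma hs_all_cat s vs ws Bs Cs : hs_all s vs Bs -> hs_all s ws Cs ->
  hs_all s (vs ++ ws) (Bs ++ Cs).
Proof.
elim: vs Bs => [|v vs IH] [|B Bs] //= [vB vsB] wC; split => //; exact: IH.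
Qed.

Lemma hs_all_nseq s v B j : hs s v B -> hs_all s (nseq j v) (nseq j B).
Proof. by move=> vB; elim: j => //= j IH. Qed.

Lemma hs_all_nth s vs Bs i : hs_all s vs Bs -> (i < size vs)%N ->
  hs s (nth (fun=> 0) vs i) (nth 0 Bs i).
Proof.
elim: vs Bs i => [|v vs IH] [|B Bs] [|i] //= [vB vsB]; rewrite ltnS => hi //.
exact: IH.
Qed.

Lemma hs_all_size s vs Bs : hs_all s vs Bs -> size vs = size Bs.
Proof. by elim: vs Bs => [|v vs IH] [|B Bs] //= [_ /IH ->]. Qed.

Lemma hs_one s : hs s (@tdistr_one R d) 1.
Proof.
have j0 : jap (0 : 'rV[int]_d) s = 1 :> R.
  rewrite /jap /freq_sqnorm big1 ?addr0 ?powR1 // => j _.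
  by rewrite mxE expr0n.
move=> L uL; rewrite l2_leP // expr1n.
have [L0|L0] := boolP (0 \in L).
  rewrite (bigD1_seq 0) //= /tdistr_one eqxx j0 mulr1 cabs_real normr1 expr1n.
  by rewrite big1 ?addr0 // => n /negbTE ->; rewrite mulr0 cabs0 expr0n.
rewrite big1_seq // => n /andP[_ nL]; rewrite /tdistr_one.
by case: eqP nL L0 => [-> ->|_ _ _] //; rewrite mulr0 cabs0 expr0n.
Qed.

Lemma mul_trunc_one N xi : mul_trunc N (@tdistr_one R d) xi = xi.
Proof.
apply/funext => n; rewrite mul_truncE (bigD1_seq 0) ?freq_ball_uniq //=; last first.
  rewrite mem_freq_ball /freq_sqnorm big1 ?sqr_ge0 // => j _.
  by rewrite mxE expr0n.
rewrite /tdistr_one eqxx mulr1 subr0 big1 ?addr0 // => m /negbTE ->.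
by rewrite mulr0.
Qed.

(** [C] bounds the multilinear map [(xi, v_1, ..., v_j) |-> xi v_1 ... v_j] from
   W^{s,oo} x (H^sigma)^j to H^{-b}, uniformly in the truncation [N]. *)
Definition product_bounded (s sigma b C : R) (j : nat) : Prop :=
  forall xi A N vs Bs, mult_bounded s xi A -> 0 <= A ->
  size vs = j -> hs_all sigma vs Bs ->
  hs (- b) (mul_truncs N vs xi) (C * A * \prod_(B <- Bs) B).

(** Testing against a function in H^b turns the product into the multilinear sum
   with one more factor. *)
Lemma mul_truncs_hs (s rho sigma b : R) (j : nat) :
  0 < rho -> - s < rho -> rho < sigma <= d%:R / 2 -> rho < b <= d%:R / 2 ->
  rho + (d%:R / 2 - b) + (maxn 1 j)%:R * (d%:R / 2 - sigma) < d%:R ->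
  exists2 C, 0 <= C & product_bounded s sigma b C j.
Proof.
move=> rho0 srho hsigma hb hsum.
pose e i := if i is i'.+1 then sigma else b.
pose j1 := maxn 1 j.
have sumE : \sum_(i <- iota 0 j1.+1) (d%:R / 2 - e i) =
    (d%:R / 2 - b) + j1%:R * (d%:R / 2 - sigma).
  rewrite /= big_cons; congr (_ + _); rewrite (eq_big_seq (fun=> d%:R / 2 - sigma)).
    by rewrite big_const_seq count_predT size_iota iter_addr_0 -[LHS]mulr_natl.
  by case=> [|i] //; rewrite mem_iota.
have [C C0 HC] := @multilinear_estimate R d s rho (iota 0 j1.+1) e rho0 srho
  ltac:(by rewrite size_iota ltnS leq_maxl) ltac:(by case)
  ltac:(by rewrite sumE addrA).
exists C => // xi A N vs Bs xiA A0 szvs vsB.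
have key ws Cs : size ws = j1 -> hs_all sigma ws Cs ->
    hs (- b) (mul_truncs N ws xi) (C * A * \prod_(B <- Cs) B).
  move=> szws wsC.
  have C0' : 0 <= \prod_(B <- Cs) B.
    rewrite (big_nth 0) big_mkord; apply: prodr_ge0 => i _.
    by apply: hs_ge0 (hs_all_nth wsC _); rewrite (hs_all_size wsC).
  apply: hs_dual => [|L w uL]; first by rewrite !mulr_ge0.
  pose LL i := if i is i'.+1 then freq_ball R d N else L.
  pose u i := if i is i'.+1 then (fun y => nth (fun=> 0) ws i' (- y)) else w.
  have uLL i : i \in iota 0 j1.+1 -> uniq (LL i) by case: i => // i _; exact: freq_ball_uniq.
  have := HC xi A LL u xiA A0 uLL; rewrite /=.
  have -> : [seq (LL i, u i) | i <- iota 1 j1] =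
      [seq (freq_ball R d N, fun y => v (- y)) | v <- ws].
    apply: (@eq_from_nth _ ([::], fun=> 0)); rewrite !size_map size_iota ?szws // => i ij.
    rewrite (nth_map 0%N) ?size_iota // nth_iota // (nth_map (fun=> 0)) ?szws //.
  under eq_bigr do rewrite add0r -mul_truncs_msum.
  move=> H; apply: le_trans H _; rewrite big_cons opprK mulrA -!mulrA.
  rewrite ler_wpM2l // ler_wpM2l // mulrC ler_wpM2r ?l2_ge0 //.
  rewrite [iota 1 j1](iotaDl 1 0 j1) big_map [leRHS](big_nth 0) -(hs_all_size wsC) szws.
  rewrite /index_iota subn0 big_seq [leRHS]big_seq; apply: ler_prod => i; rewrite mem_iota add0n => ij.
  rewrite factor_norm_ge0 /=.
  have := hs_all_nth wsC; rewrite szws => /(_ i ij) /(_ [seq - y | y <- freq_ball R d N]).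
  rewrite (map_inj_uniq (@oppr_inj _)) freq_ball_uniq => /(_ isT); apply: le_trans.
  rewrite /factor_norm /l2 big_map ler_wsqrtr //; apply: le_of_eq.
  by apply: eq_bigr => y _; rewrite /= japNn.
have [j0|j0] := posnP j; last by apply: key => //; rewrite szvs /j1 (maxn_idPr j0).
(* a factor equal to the constant function 1 reduces the empty product to one factor *)
have := key [:: @tdistr_one R d] [:: 1]; rewrite /j1 j0 => /(_ erefl).
move=> /(_ (conj (hs_one sigma) I)); rewrite big_seq1 /= mul_trunc_one.
by move: szvs vsB; rewrite j0; case: (vs) => // _; case: (Bs) => //= _; rewrite big_nil.
Qed.

End truncated_products.

Section limit_products.
Variables (R : realType) (d : nat).
Implicit Types (xi v w : tdistr R d) (A B : R) (N j : nat).

(** The product [xi v^j], extended by continuity from trigonometric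
   polynomials. *)
Definition limit_product xi v j : tdistr R d :=
  tlim (fun N => iter j (mul_trunc N v) xi).

(** Exponents for which [xi v^j] is defined and belongs to H^{-b}, for [xi] in
   W^{s,oo} and [v] in H^sigma. *)
Definition admissible (s sigma b : R) (j : nat) : Prop := exists rho : R,
  [/\ 0 < rho, - s < rho, rho < sigma <= d%:R / 2, rho < b <= d%:R / 2 &
   rho + (d%:R / 2 - b) + (maxn 1 j)%:R * (d%:R / 2 - sigma) < d%:R].

Section fixed_exponents.
Variables (s sigma b C : R) (j : nat).
Hypothesis C0 : 0 <= C.
Hypothesis HC : product_bounded d s sigma b C j.

Lemma prod_nseq (B : R) m : \prod_(x <- nseq m B) x = B ^+ m.
Proof. by elim: m => [|m IH]; rewrite ?big_nil // big_cons IH exprS. Qed.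

(** Telescoping: the factors [v] are replaced by [w] one at a time. *)
Lemma mul_truncs_lip_fun N xi v w A B e : mult_bounded s xi A -> 0 <= A -> 1 <= B ->
  hs sigma v B -> hs sigma w B -> hs sigma (tdistr_sub v w) e ->
  hs (- b) (tdistr_sub (mul_truncs N (nseq j v) xi) (mul_truncs N (nseq j w) xi))
    (j%:R * (C * A * (B ^+ j * e))).
Proof.
move=> xiA A0 B1 vB wB vwe.
have e0 := hs_ge0 vwe.
have B0 := le_trans ler01 B1.
suff H c a : (a + c)%N = j ->
    hs (- b) (tdistr_sub (mul_truncs N (nseq a w ++ nseq c v) xi)
      (mul_truncs N (nseq a w ++ nseq c w) xi)) (c%:R * (C * A * (B ^+ j * e))).
  exact: (H j 0%N).
elim: c a => [|c IH] a acj.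
  rewrite mul0r; apply: (eq_hs _ (hs0 _)) => n.
  by rewrite /tdistr_sub subrr.
have ac : (a.+1 + c)%N = j by rewrite -acj addnS.
have -> : nseq a w ++ nseq c.+1 w = nseq a.+1 w ++ nseq c w.
  by rewrite -!nseqD addSnnS.
rewrite -natr1 mulrDl mul1r addrC.
apply: hs_sub_trans (IH a.+1 ac).
have -> : nseq a.+1 w ++ nseq c v = nseq a w ++ w :: nseq c v.
  by rewrite -cat_rcons -cats1 -[[:: w]]/(nseq 1 w) -nseqD addn1.
rewrite !mul_truncs_cat -mul_truncsB /= -mul_truncBl.
rewrite -[mul_trunc N _ _]/(mul_truncs N (tdistr_sub v w :: nseq c v) xi) -mul_truncs_cat.
have := HC N xiA A0 _ (hs_all_cat (hs_all_nseq a wB) (conj vwe (hs_all_nseq c vB) : hs_all sigma (_ :: _) (e :: _))).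
rewrite size_cat /= !size_nseq acj => /(_ erefl); apply: hs_le.
rewrite big_cat big_cons !prod_nseq ler_wpM2l ?mulr_ge0 //=.
rewrite mulrCA -exprD mulrC ler_wpM2r //.
by rewrite ler_weXn2l // -acj leq_add2l.
Qed.

Lemma mul_truncs_lip N xi xi' v w A A' B e : mult_bounded s xi A -> 0 <= A ->
  mult_bounded s (tdistr_sub xi xi') A' -> 0 <= A' -> 1 <= B ->
  hs sigma v B -> hs sigma w B -> hs sigma (tdistr_sub v w) e ->
  hs (- b) (tdistr_sub (mul_truncs N (nseq j v) xi) (mul_truncs N (nseq j w) xi'))
    (C * B ^+ j * (A' + j%:R * A * e)).
Proof.
move=> xiA A0 xiA' A'0 B1 vB wB vwe.
have h1 := mul_truncs_lip_fun N xiA A0 B1 vB wB vwe.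
have := HC N xiA' A'0 (size_nseq j w) (hs_all_nseq j wB).
rewrite prod_nseq mul_truncsB => h2.
apply: hs_le (hs_sub_trans h1 h2).
by apply: le_of_eq; ring.
Qed.

Section one_product.
Variables (xi v : tdistr R d) (A B : R).
Hypotheses (xiA : mult_bounded s xi A) (A0 : 0 <= A) (vB : hs sigma v B).

(** Truncations of two orders differ by a tail of [v], which is small in H^sigma,
   and the estimate of the product does not depend on the order. *)
Lemma limit_product_cauchy : hs_cauchy (- b) (fun N => iter j (mul_trunc N v) xi).
Proof.
pose B1 := Num.max 1 B.
have B11 : 1 <= B1 by rewrite le_max lexx.
have vB1 : hs sigma v B1 by apply: hs_le vB; rewrite le_max lexx orbT.
move=> e e0.
pose D := j%:R * (C * A * B1 ^+ j) + 1.
have D0 : 0 < D by rewrite ltr_wpDl // !mulr_ge0 // exprn_ge0 // (le_trans ler01).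
have [N0 HN0] := hs_cut_cvg vB1 (divr_gt0 e0 D0).
have step N M : (N0 <= N)%N -> (N <= M)%N ->
    hs (- b) (tdistr_sub (iter j (mul_trunc M v) xi) (iter j (mul_trunc N v) xi)) e.
  move=> hN NM.
  have -> : iter j (mul_trunc N v) xi = iter j (mul_trunc M (freq_cut N v)) xi.
    by elim: (j) => //= i ->; rewrite (mul_trunc_cut _ _ NM).
  rewrite !iter_mul_trunc.
  apply: hs_le (mul_truncs_lip_fun M xiA A0 B11 vB1 (hs_cut N vB1) (HN0 N hN)).
  rewrite (_ : _ * _ = j%:R * (C * A * B1 ^+ j) * (e / D)); last by ring.
  rewrite [leLHS]mulrA ler_pdivrMr // mulrC ler_pM2l // /D.
  by rewrite lerDl.
exists N0 => M N hM hN; have [MN|/ltnW NM] := leqP M N.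
  by apply: hs_subC; exact: step.
exact: step.
Qed.

Lemma limit_product_bound N :
  hs (- b) (iter j (mul_trunc N v) xi) (C * A * B ^+ j).
Proof.
have := HC N xiA A0 (size_nseq j v) (hs_all_nseq j vB).
by rewrite prod_nseq iter_mul_trunc.
Qed.

Lemma limit_product_hs : hs (- b) (limit_product xi v j) (C * A * B ^+ j).
Proof.
apply: hs_pointwise_lim (tlim_pointwise limit_product_cauchy) _.
by exists 0%N => N _; exact: limit_product_bound.
Qed.

Lemma is_product_limit : is_product xi v j (limit_product xi v j).
Proof.
split; last exact: tlim_pointwise limit_product_cauchy.
exists (C * A * B ^+ j), b => N n.
by have := hs_coef n (limit_product_bound N); rewrite opprK.
Qed.

Lemma is_product_unique h : is_product xi v j h -> h = limit_product xi v j.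
Proof.
case=> _ hh; apply/funext.
exact: pointwise_cvg_unique hh (tlim_pointwise limit_product_cauchy).
Qed.

End one_product.

Lemma limit_product_lip xi xi' v w A A' B e : mult_bounded s xi A -> 0 <= A ->
  mult_bounded s xi' A ->
  mult_bounded s (tdistr_sub xi xi') A' -> 0 <= A' -> 1 <= B ->
  hs sigma v B -> hs sigma w B -> hs sigma (tdistr_sub v w) e ->
  hs (- b) (tdistr_sub (limit_product xi v j) (limit_product xi' w j))
    (C * B ^+ j * (A' + j%:R * A * e)).
Proof.
move=> xiA A0 xi'A xiA' A'0 B1 vB wB vwe.
apply: (@hs_pointwise_lim _ _ _ (fun N =>
  tdistr_sub (iter j (mul_trunc N v) xi) (iter j (mul_trunc N w) xi'))); last first.
  by exists 0%N => N _; rewrite !iter_mul_trunc; exact: mul_truncs_lip.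
move=> n.
have h1 := tlim_pointwise (limit_product_cauchy xiA A0 vB) n.
have h2 := tlim_pointwise (limit_product_cauchy xi'A A0 wB) n.
apply: (@squeeze_cvgr _ _ _ _ (fun=> 0) (fun N =>
  cabs (iter j (mul_trunc N v) xi n - limit_product xi v j n) +
  cabs (iter j (mul_trunc N w) xi' n - limit_product xi' w j n))).
- apply: nearW => N; rewrite cabs_ge0 /= /tdistr_sub.
  rewrite -[X in _ <= _ + X]cabsN; apply: le_trans (cabsD _ _).
  by apply: le_of_eq; congr cabs; ring.
- exact: cvg_cst.
- by rewrite -[0]addr0; apply: cvgD.
Qed.

End fixed_exponents.

Lemma admissible_products s sigma b j : admissible s sigma b j ->
  exists2 C, 0 <= C & product_bounded d s sigma b C j.
Proof. by case=> rho [h1 h2 h3 h4 h5]; exact: mul_truncs_hs h1 h2 h3 h4 h5. Qed.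

End limit_products.

(** * The Duhamel integral *)

Section minkowski.
Context {R : realType} {dsp : measure_display} {X : measurableType dsp}.
Variables (mu : {measure set X -> \bar R}) (D : set X) (mD : measurable D) (d : nat).

(** Minkowski inequality for integrals, by duality on finite sets of
   frequencies. *)
Lemma hs_cintegral (s : R) (F : X -> tdistr R d) (K : X -> R) :
  (forall n, cintegrable mu D (fun x => F x n)) ->
  mu.-integrable D (EFin \o K) -> (forall x, D x -> hs s (F x) (K x)) ->
  hs s (fun n => cintegral mu D (fun x => F x n)) (\int[mu]_(x in D) K x).
Proof.
move=> iF iK FK L uL.
set I := fun n => cintegral mu D (fun x => F x n).
set Q := l2 L (fun n => real_complex R (jap n s) * I n).
have K0 : 0 <= \int[mu]_(x in D) K x.
  by apply: Rintegral_ge0 => x Dx; exact: hs_ge0 (FK x Dx).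
pose c n := real_complex R (jap n s ^+ 2) * conjc (I n).
have icF : cintegrable mu D (fun x => \sum_(n <- L) c n * F x n).
  by apply: cintegrable_sum => // n; exact: cintegrableZ.
have E : real_complex R (Q ^+ 2) = cintegral mu D (fun x => \sum_(n <- L) c n * F x n).
  rewrite cintegral_sum // => [|n]; last exact: cintegrableZ.
  rewrite /Q l2_sqr rmorph_sum; apply: eq_bigr => n _.
  rewrite cintegralZ // /c cabsM cabs_real ger0_norm ?jap_ge0 // exprMn rmorphM.
  by rewrite -[X in _ * X]/(real_complex R (cabs (I n) ^+ 2)) -mulc_conj /= /I; ring.
have QQ : Q ^+ 2 <= Q * \int[mu]_(x in D) K x.
  rewrite -[leLHS]/(complex.Re (real_complex R (Q ^+ 2))) E /= -RintegralZl //.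
  apply: le_Rintegral => //.
  - by case: icF.
  - by have := integrableZl mD Q iK.
  move=> x Dx; apply: le_trans (ler_norm _) _; apply: le_trans (norm_Re_le _) _.
  rewrite (eq_bigr (fun n => (real_complex R (jap n s) * conjc (I n)) *
     (real_complex R (jap n s) * F x n))); last first.
    by move=> n _; rewrite /c rmorphXn /=; ring.
  apply: le_trans (cabs_dot_le _ _ _) _.
  apply: ler_pM; rewrite ?l2_ge0 //; last exact: FK.
  apply: le_of_eq; rewrite /Q /l2.
  by congr Num.sqrt; apply: eq_bigr => n _; rewrite !cabsM cabs_conj.
have [<- //|Q0] := eqVneq 0 Q.
by rewrite expr2 ler_pM2l // lt_neqAle Q0 l2_ge0 in QQ.
Qed.

End minkowski.

Section duhamel.
Variables (R : realType) (d : nat).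
Implicit Types (t T : R) (f g : R -> tdistr R d) (n : 'rV[int]_d).
Local Notation leb := (@lebesgue_measure R).

Lemma sin_lip (x y : R) : `|sin x - sin y| <= `|x - y|.
Proof.
wlog : x y / y <= x => [H|].
  by case/orP: (le_total y x) => /H //; rewrite distrC [leRHS]distrC.
rewrite le_eqVlt => /predU1P[->|yx]; first by rewrite !subrr.
have [c _ ->] := @MVT R sin cos y x yx (fun z _ => is_derive_sin z)
  (continuous_subspaceT (@continuous_sin R)).
by rewrite normrM ler_piMl // ler_norml cos_geN1 cos_le1.
Qed.

(** Letting the kernel vanish at future times turns the integrals up to [t] into
   integrals over a fixed interval, so that two times can be compared. *)
Definition wave_kernel (alpha t : R) n (tau : R) : R :=
  sin (Num.max (t - tau) 0 * jap n alpha) / jap n alpha.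

Lemma measurable_wave_kernel alpha t n (D : set R) :
  measurable_fun D (wave_kernel alpha t n).
Proof.
apply: measurable_funTS; apply: measurable_funM; last exact: measurable_cst.
apply: (measurableT_comp (f := @sin R)).
  by apply: continuous_measurable_fun; exact: continuous_sin.
apply: measurable_funM; last exact: measurable_cst.
apply: measurable_maxr; last exact: measurable_cst.
by apply: measurable_funB; [exact: measurable_cst|exact: measurable_id].
Qed.

Lemma wave_kernel_bound alpha t n tau : `|wave_kernel alpha t n tau| <= jap n (- alpha).
Proof.
rewrite normrM [X in _ * X]ger0_norm ?invr_ge0 ?jap_ge0 // japN ler_piMl ?invr_ge0 ?jap_ge0 //.
by rewrite ler_norml sin_geN1 sin_le1.
Qed.

(** Interpolate between the uniform bound and the Lipschitz bound in time, which
   costs alpha derivatives. *)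
Lemma wave_kernel_holder alpha t t' n tau theta : 0 < theta <= 1 ->
  `|wave_kernel alpha t' n tau - wave_kernel alpha t n tau| <=
  2 * `|t' - t| `^ theta * jap n (alpha * theta - alpha).
Proof.
move=> /andP[th0 th1].
set w : R := jap n alpha.
have w0 : 0 < w by exact: jap_gt0.
rewrite /wave_kernel -mulrBl normrM [X in _ * X]ger0_norm ?invr_ge0 ?(ltW w0) //.
have -> : jap n (alpha * theta - alpha) = w `^ theta * w^-1.
  by rewrite japD japN; congr (_ * _); rewrite /w /jap -powRrM mulrAC.
rewrite [leRHS]mulrA; apply: ler_wpM2r; first by rewrite invr_ge0 ltW.
rewrite -mulrA -powRM ?(ltW w0) //.
set z := `|t' - t| * w.
have z0 : 0 <= z by rewrite mulr_ge0 // ltW.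
have h1 : `|sin (Num.max (t' - tau) 0 * w) - sin (Num.max (t - tau) 0 * w)| <= z.
  apply: le_trans (sin_lip _ _) _.
  rewrite -mulrBl normrM [X in _ * X]ger0_norm ?(ltW w0) // ler_wpM2r ?(ltW w0) //.
  have : t' - t = (t' - tau) - (t - tau) by ring.
  move=> ->; move: (t' - tau) (t - tau) => x y.
  have a1 := ler_norm (x - y); have a2 := ler_norm (y - x); rewrite distrC in a2.
  rewrite ler_norml; case: (leP x 0) => x0; case: (leP y 0) => y0;
    by apply/andP; split; lra.
have h2 : `|sin (Num.max (t' - tau) 0 * w) - sin (Num.max (t - tau) 0 * w)| <= 2.
  move: (Num.max (t' - tau) 0 * w) (Num.max (t - tau) 0 * w) => x y.
  rewrite ler_norml; have := sin_geN1 x; have := sin_le1 x.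
  by have := sin_geN1 y; have := sin_le1 y => *; apply/andP; split; lra.
have [z1|z1] := leP z 1; last first.
  apply: le_trans h2 _; rewrite ler_peMr //.
  have := @ge0_ler_powR R theta (ltW th0) 1 z; rewrite powR1.
  by apply; rewrite ?nnegrE //; exact: ltW.
apply: le_trans h1 _.
have : z <= z `^ theta.
  have [->|zn0] := eqVneq z 0; first exact: powR_ge0.
  rewrite -[X in X <= _]powRr1 // ger_powR // z1 andbT.
  by rewrite lt_neqAle eq_sym zn0.
have := powR_ge0 z theta; lra.
Qed.

Lemma integrable_cst_itv (a c : R) :
  leb.-integrable `[0, a]%classic (EFin \o (fun=> c)).
Proof.
apply: continuous_compact_integrable; first exact: segment_compact.
by apply: continuous_subspaceT => x; exact: cvg_cst.
Qed.

Lemma Rintegral_cst_itv (c t : R) : 0 <= t -> \int[leb]_(tau in `[0, t]) c = c * t.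
Proof.
move=> t0; rewrite Rintegral_cst //= lebesgue_measure_itv /= lte_fin.
case: ltP => [_|t0'] /=; first by rewrite oppr0 addr0.
by rewrite (_ : t = 0) //; apply/eqP; rewrite eq_le t0' t0.
Qed.

Lemma mulr_real_cmeasurable (D : set R) (h : R -> R) : measurable_fun D h ->
  cmeasurable D (fun x => real_complex R (h x)).
Proof. by move=> mh; split => //=; exact: measurable_cst. Qed.

Section term.
Variables (alpha sigma b T : R) (f : R -> tdistr R d).
Hypothesis sba : sigma + b <= alpha.
Hypothesis T0 : 0 <= T.
Hypothesis fi : forall n, cintegrable leb `[0, T]%classic (fun tau => f tau n).

Definition duhamel_term (t : R) : tdistr R d := fun n =>
  cintegral leb `[0, t]%classic (fun tau =>
    real_complex R (sin ((t - tau) * jap n alpha) / jap n alpha) * f tau n).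

Let sub_itv t : t \in `[0, T] -> `[0, t]%classic `<=` `[0, T]%classic.
Proof.
rewrite in_itv /= => /andP[t0 tT] x /=; rewrite !in_itv /= => /andP[-> xt].
exact: le_trans xt tT.
Qed.

Lemma cintegrableS (D E : set R) (h : R -> R[i]) : measurable D -> measurable E ->
  D `<=` E -> cintegrable leb E h -> cintegrable leb D h.
Proof.
by move=> mD mE DE [hR hI]; split; [exact: integrableS hR|exact: integrableS hI].
Qed.

Lemma cintegrable_kernel t n (D : set R) : measurable D -> D `<=` `[0, T]%classic ->
  cintegrable leb D (fun tau => real_complex R (wave_kernel alpha t n tau) * f tau n).
Proof.
move=> mD DT.
rewrite (_ : (fun tau => _) =
  (fun tau => f tau n * real_complex R (wave_kernel alpha t n tau))); last first.
  by apply/funext => tau; rewrite mulrC.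
apply: (@cintegrableM _ _ _ leb D mD (fun tau => f tau n) _ (jap n (- alpha))).
- exact: (cintegrableS mD _ DT (fi n)).
- by apply: mulr_real_cmeasurable; exact: measurable_wave_kernel.
- by move=> x; rewrite cabs_real wave_kernel_bound.
Qed.

Lemma duhamel_termE t n : t \in `[0, T] -> duhamel_term t n =
  cintegral leb `[0, t]%classic (fun tau => real_complex R (wave_kernel alpha t n tau) * f tau n).
Proof.
move=> tT; rewrite /duhamel_term /cintegral; congr Complex; apply: eq_Rintegral => x;
  rewrite inE /= in_itv /= => /andP[_ xt]; rewrite /wave_kernel max_l // subr_ge0 //.
Qed.

Lemma duhamel_termT t n : t \in `[0, T] -> duhamel_term t n =
  cintegral leb `[0, T]%classic (fun tau => real_complex R (wave_kernel alpha t n tau) * f tau n).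
Proof.
move=> tT; rewrite duhamel_termE // /cintegral.
have aux (p : R[i] -> R) : p 0 = 0 ->
    \int[leb]_(x in `[0, t]) p (real_complex R (wave_kernel alpha t n x) * f x n) =
    \int[leb]_(x in `[0, T]) p (real_complex R (wave_kernel alpha t n x) * f x n).
  move=> p0; rewrite Rintegral_mkcond [RHS]Rintegral_mkcond; apply: eq_Rintegral => x _.
  rewrite !patchE; have [xt|xt] := boolP (x \in `[0, t]%classic).
    by rewrite mem_set //; exact: (sub_itv tT (set_mem xt)).
  case: ifPn => // xT; rewrite /wave_kernel max_r ?mul0r ?sin0 ?mul0r ?rmorph0 ?mul0r ?p0 //.
  move: xt xT; rewrite notin_setE inE /= !in_itv /= subr_le0.
  by move=> /negP xt /andP[x0 _]; rewrite x0 /= -ltNge in xt; exact: ltW.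
by congr Complex; apply: aux.
Qed.

Lemma duhamel_term_hs t (K : R -> R) : t \in `[0, T] ->
  (forall tau, tau \in `[0, t] -> hs (- b) (f tau) (K tau)) ->
  leb.-integrable `[0, t]%classic (EFin \o K) ->
  hs sigma (duhamel_term t) (\int[leb]_(tau in `[0, t]) K tau).
Proof.
move=> tT fK iK.
have H := @hs_cintegral _ _ _ leb `[0, t]%classic (measurable_itv _) d sigma (fun tau n =>
  real_complex R (wave_kernel alpha t n tau) * f tau n) K.
apply: (eq_hs _ (H _ iK _)) => [n|n|x].
- by rewrite duhamel_termE.
- by apply: cintegrable_kernel => //; exact: sub_itv.
move=> xt; have fxK := fK x xt; move=> L uL; apply: le_trans (fxK L uL).
rewrite l2_leP ?l2_ge0 // l2_sqr; apply: ler_sum => n _.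
rewrite lerXn2r ?nnegrE ?cabs_ge0 // mulrA !cabsM ler_wpM2r ?cabs_ge0 //.
rewrite !cabs_real !(ger0_norm (jap_ge0 _ _)).
apply: (@le_trans _ _ (jap n sigma * jap n (- alpha))).
  by rewrite ler_wpM2l ?jap_ge0 // wave_kernel_bound.
by rewrite -japD jap_le //; move: sba; lra.
Qed.

Lemma duhamel_term_holder t t' (K theta : R) : 0 < theta <= 1 ->
  sigma + b + alpha * theta <= alpha -> 0 <= K ->
  t \in `[0, T] -> t' \in `[0, T] ->
  (forall tau, tau \in `[0, T] -> hs (- b) (f tau) K) ->
  hs sigma (tdistr_sub (duhamel_term t') (duhamel_term t))
    (2 * `|t' - t| `^ theta * K * T).
Proof.
move=> th sbt K0 tT t'T fK.
have H := @hs_cintegral _ _ _ leb `[0, T]%classic (measurable_itv _) d sigma (fun tau n =>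
  (real_complex R (wave_kernel alpha t' n tau) - real_complex R (wave_kernel alpha t n tau))
   * f tau n) (fun=> 2 * `|t' - t| `^ theta * K).
have ik u n := @cintegrable_kernel u n `[0, T]%classic (measurable_itv _) (@subset_refl _ _).
have iB n : cintegrable leb `[0, T]%classic (fun tau =>
   (real_complex R (wave_kernel alpha t' n tau) - real_complex R (wave_kernel alpha t n tau))
   * f tau n).
  rewrite (_ : (fun tau => _) =
    (fun tau => real_complex R (wave_kernel alpha t' n tau) * f tau n +
      -1 * (real_complex R (wave_kernel alpha t n tau) * f tau n))).
    by apply: cintegrableD => //; apply: cintegrableZ.
  by apply/funext => tau; rewrite mulrBl mulN1r.
have -> : 2 * `|t' - t| `^ theta * K * T =
    \int[leb]_(tau in `[0, T]) (2 * `|t' - t| `^ theta * K).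
  by rewrite Rintegral_cst_itv.
apply: (eq_hs _ (H iB _ _)) => [n||tau tauT].
- rewrite /tdistr_sub !duhamel_termT //.
  rewrite -[- cintegral _ _ _]mulN1r -cintegralZ // -cintegralD //; last exact: cintegrableZ.
  by congr cintegral; apply/funext => tau; rewrite mulrBl mulN1r.
- exact: integrable_cst_itv.
move=> L uL; have KL := fK tau tauT L uL.
apply: (@le_trans _ _ (2 * `|t' - t| `^ theta *
    l2 L (fun n => real_complex R (jap n (- b)) * f tau n))); last first.
  by rewrite ler_wpM2l // mulr_ge0 ?powR_ge0.
rewrite l2_leP ?mulr_ge0 ?powR_ge0 ?l2_ge0 // exprMn l2_sqr mulr_sumr.
apply: ler_sum => n _; rewrite -exprMn.
rewrite lerXn2r ?nnegrE ?mulr_ge0 ?powR_ge0 ?cabs_ge0 // mulrA !cabsM mulrA.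
rewrite ler_wpM2r ?cabs_ge0 // -rmorphB !cabs_real !(ger0_norm (jap_ge0 _ _)).
apply: (@le_trans _ _ (jap n sigma * (2 * `|t' - t| `^ theta * jap n (alpha * theta - alpha)))).
  by rewrite ler_wpM2l ?jap_ge0 // wave_kernel_holder.
rewrite mulrCA ler_wpM2l ?mulr_ge0 ?powR_ge0 // -japD jap_le //.
by move: sbt; lra.
Qed.

End term.
End duhamel.

(** * Continuous paths in H^s *)

Section paths.
Variables (R : realType) (d : nat).
Implicit Types (s T A B e : R) (v w f : R -> tdistr R d).
Local Notation leb := (@lebesgue_measure R).

Definition path_bounded s T v B : Prop := forall t, t \in `[0, T] -> hs s (v t) B.

Definition path_cont s T v : Prop := forall t, t \in `[0, T] -> forall e, 0 < e ->
  exists2 eta, 0 < eta & forall t', t' \in `[0, T] -> `|t' - t| < eta ->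
    hs s (tdistr_sub (v t') (v t)) e.

Lemma within_continuous_itv T (h : R -> R) :
  (forall t, t \in `[0, T] -> forall e, 0 < e -> exists2 eta, 0 < eta &
     forall t', t' \in `[0, T] -> `|t' - t| < eta -> `|h t' - h t| <= e) ->
  {within `[0, T]%classic, continuous h}.
Proof.
move=> H; apply/subspace_continuousP => t tT; apply/cvgrPdist_le => e e0.
have [eta eta0 Heta] := H t tT e e0.
rewrite near_withinE; exists eta => //= t' tt' t'T.
by rewrite distrC; apply: Heta => //; rewrite distrC.
Qed.

Lemma path_cont_cintegrable s T f : path_cont s T f ->
  forall n, cintegrable leb `[0, T]%classic (fun tau => f tau n).
Proof.
move=> fc n.
have coef t : t \in `[0, T] -> forall e, 0 < e -> exists2 eta, 0 < eta &
    forall t', t' \in `[0, T] -> `|t' - t| < eta -> cabs (f t' n - f t n) <= e.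
  move=> tT e e0; have [eta eta0 H] := fc t tT _ (mulr_gt0 e0 (jap_gt0 n s)).
  exists eta => // t' t'T tt'; have := hs_coef n (H t' t'T tt').
  by rewrite japN mulfK // jap_neq0.
split; apply: continuous_compact_integrable; try exact: segment_compact;
  apply: within_continuous_itv => t tT e e0; have [eta eta0 H] := coef t tT e e0;
  exists eta => // t' t'T tt'; apply: le_trans (H t' t'T tt').
- by apply: le_trans (norm_Re_le _); case: (f t' n) => ? ?; case: (f t n).
- by apply: le_trans (norm_Im_le _); case: (f t' n) => ? ?; case: (f t n).
Qed.

(** The extreme value theorem is applied to the norm of the path. *)
Lemma path_cont_bounded s T v : 0 <= T -> path_cont s T v ->
  (forall t, t \in `[0, T] -> exists A, hs s (v t) A) ->
  exists2 B, 1 <= B & path_bounded s T v B.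
Proof.
move=> T0 vc vb.
pose S t := [set l2 L (fun n => real_complex R (jap n s) * v t n) | L in [set L | uniq L]].
pose N t := sup (S t).
have S0 t : S t !=set0 by exists (l2 [::] (fun n => real_complex R (jap n s) * v t n)); exists [::].
have supS t : t \in `[0, T] -> has_sup (S t).
  by move=> /vb[A vA]; split => //; exists A => _ [L uL <-]; exact: vA.
have NE t : t \in `[0, T] -> hs s (v t) (N t).
  by move=> tT L uL; apply: sup_upper_bound; [exact: supS|exists L].
have Nle t A : t \in `[0, T] -> hs s (v t) A -> N t <= A.
  by move=> tT vA; apply: ge_sup => // _ [L uL <-]; exact: vA.
have Nc : {within `[0, T]%classic, continuous N}.
  apply: within_continuous_itv => t tT e e0; have [eta eta0 H] := vc t tT e e0.
  exists eta => // t' t'T tt'; have h := H t' t'T tt'.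
  rewrite ler_distl; apply/andP; split.
    rewrite lerBlDr; apply: Nle => //.
    apply: eq_hs (hsB (NE t' t'T) h) => n.
    by rewrite /tdistr_sub opprB addrC subrK.
  apply: Nle => //; apply: eq_hs (hsD (NE t tT) h) => n.
  by rewrite /tdistr_sub addrC subrK.
have [c _ Hc] := EVT_max T0 Nc.
exists (Num.max 1 (N c)); first by rewrite le_max lexx.
by move=> t tT; apply: hs_le (NE t tT); rewrite le_max Hc ?orbT.
Qed.

Lemma path_bounded_le s T v A B : A <= B -> path_bounded s T v A -> path_bounded s T v B.
Proof. by move=> AB vA t tT; apply: hs_le (vA t tT). Qed.

End paths.

(** * The Duhamel map *)

Section duhamel_map.
Variables (R : realType) (d k : nat) (s : nat -> nat -> R).
Variables (alpha sigma b theta : R).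
Hypothesis theta01 : 0 < theta <= 1.
Hypothesis gain : sigma + b + alpha * theta <= alpha.
Hypothesis alpha0 : 0 < alpha.
Hypothesis adm : forall k1 k2 k3, (k1 < k)%N -> k = (k1 + k2 + k3)%N ->
  admissible d (s k1 k2) sigma b k3.
Local Notation leb := (@lebesgue_measure R).
Implicit Types (Xi : noise R d) (v w : R -> tdistr R d) (M B T t tau e : R).

Lemma gain0 : sigma + b <= alpha.
Proof. by case/andP: theta01 => t0 _; have := mulr_gt0 alpha0 t0; move: gain; lra. Qed.

Definition noise_bounded Xi M : Prop := forall k1 k2 tau, (k1 < k)%N -> (k2 <= k)%N ->
  tau \in `[0, 1] -> mult_bounded (s k1 k2) (Xi k1 k2 tau) M.

Definition noise_cont Xi : Prop := forall k1 k2, (k1 < k)%N -> (k2 <= k)%N ->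
  forall tau, tau \in `[0, 1] -> forall e, 0 < e -> exists2 eta, 0 < eta &
  forall tau', tau' \in `[0, 1] -> `|tau' - tau| < eta ->
    mult_bounded (s k1 k2) (tdistr_sub (Xi k1 k2 tau') (Xi k1 k2 tau)) e.

Lemma hs_all_prod_ge0 (r : R) (vs : seq (tdistr R d)) Bs : hs_all r vs Bs ->
  0 <= \prod_(B <- Bs) B.
Proof.
elim: vs Bs => [|v vs IH] [|B Bs] //=; first by rewrite big_nil.
by case=> vB /IH h; rewrite big_cons mulr_ge0 // (hs_ge0 vB).
Qed.

(** One constant serves the finitely many indices. *)
Lemma product_constant : exists2 C, 0 <= C & forall k1 k2 k3, (k1 < k)%N ->
  k = (k1 + k2 + k3)%N ->
  product_bounded d (s k1 k2) sigma b C k3.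
Proof.
pose P (x : 'I_k * 'I_k.+1 * 'I_k.+1) C := 0 <= C /\
  (k = (x.1.1 + x.1.2 + x.2)%N -> product_bounded d (s x.1.1 x.1.2) sigma b C x.2).
have /choice[C HC] : forall x, exists C, P x C.
  move=> [[k1 k2] k3]; rewrite /P /=; have [E|E] := eqVneq k (k1 + k2 + k3)%N.
    have [C C0 HC] := admissible_products (adm (ltn_ord k1) E).
    by exists C; split => // _; exact: HC.
  by exists 0; split => // E'; move: E; rewrite -E' eqxx.
exists (\sum_x C x); first by apply: sumr_ge0 => x _; have [] := HC x.
move=> k1 k2 k3 k1k E xi A N vs Bs xiA A0 szvs vsB.
have k2k : (k2 < k.+1)%N by rewrite ltnS E -addnA addnCA leq_addr.
have k3k : (k3 < k.+1)%N by rewrite ltnS E leq_addl.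
have [C0 H] := HC (Ordinal k1k, Ordinal k2k, Ordinal k3k).
apply: hs_le (H E xi A N vs Bs xiA A0 szvs vsB).
rewrite ler_wpM2r ?(hs_all_prod_ge0 vsB) // ler_wpM2r //.
rewrite (bigD1 (Ordinal k1k, Ordinal k2k, Ordinal k3k)) //= lerDl.
by apply: sumr_ge0 => x _; have [] := HC x.
Qed.

Definition multinomial_sum : R := \sum_(k1 < k) \sum_(k2 < k.+1)
  \sum_(k3 < k.+1 | k == (k1 + k2 + k3)%N) (k`!)%:R / (k1`! * k2`! * k3`!)%:R.

Lemma multinomial_sum_ge0 : 0 <= multinomial_sum.
Proof. by do 3 (apply: sumr_ge0 => ? _); rewrite divr_ge0. Qed.

Definition forcing := nat -> nat -> nat -> R -> tdistr R d.

Definition duhamel (F : forcing) (t : R) : tdistr R d := fun n =>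
  - \sum_(k1 < k) \sum_(k2 < k.+1) \sum_(k3 < k.+1 | k == (k1 + k2 + k3)%N)
     (k`!)%:R / (k1`! * k2`! * k3`!)%:R * duhamel_term alpha (F k1 k2 k3) t n.

Lemma multinomial_sum_hs (G : nat -> nat -> nat -> tdistr R d) (K : R) :
  (forall k1 k2 k3, (k1 < k)%N -> k = (k1 + k2 + k3)%N -> hs sigma (G k1 k2 k3) K) ->
  hs sigma (fun n => - \sum_(k1 < k) \sum_(k2 < k.+1)
     \sum_(k3 < k.+1 | k == (k1 + k2 + k3)%N)
     (k`!)%:R / (k1`! * k2`! * k3`!)%:R * G k1 k2 k3 n) (multinomial_sum * K).
Proof.
move=> H; apply: hsN; rewrite /multinomial_sum mulr_suml.
apply: hs_sum => k1 _; rewrite mulr_suml; apply: hs_sum => k2 _.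
rewrite mulr_suml; apply: hs_sum => k3 /eqP E.
have := hsZ ((k`!)%:R / (k1`! * k2`! * k3`!)%:R) (H k1 k2 k3 (ltn_ord k1) E).
rewrite ger0_norm ?divr_ge0 //; apply: eq_hs => n.
by rewrite fmorph_div !rmorph_nat.
Qed.

Definition forcing_integrable T (F : forcing) : Prop := forall k1 k2 k3,
  (k1 < k)%N -> k = (k1 + k2 + k3)%N -> forall n,
  cintegrable leb `[0, T]%classic (fun tau => F k1 k2 k3 tau n).

Lemma duhamel_hs T t (F : forcing) (K : R -> R) : 0 <= T -> forcing_integrable T F ->
  t \in `[0, T] ->
  (forall k1 k2 k3, (k1 < k)%N -> k = (k1 + k2 + k3)%N ->
     forall tau, tau \in `[0, t] -> hs (- b) (F k1 k2 k3 tau) (K tau)) ->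
  leb.-integrable `[0, t]%classic (EFin \o K) ->
  hs sigma (duhamel F t) (multinomial_sum * \int[leb]_(tau in `[0, t]) K tau).
Proof.
move=> T0 Fi tT FK iK.
apply: (multinomial_sum_hs (G := fun k1 k2 k3 => duhamel_term alpha (F k1 k2 k3) t)).
move=> k1 k2 k3 k1k E.
by apply: (duhamel_term_hs gain0 (Fi k1 k2 k3 k1k E) tT) => // tau ?; exact: FK.
Qed.

Lemma duhamel_termB T t (f g : R -> tdistr R d) n : t \in `[0, T] ->
  (forall n, cintegrable leb `[0, T]%classic (fun tau => f tau n)) ->
  (forall n, cintegrable leb `[0, T]%classic (fun tau => g tau n)) ->
  duhamel_term alpha (fun tau => tdistr_sub (f tau) (g tau)) t n =
  duhamel_term alpha f t n - duhamel_term alpha g t n.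
Proof.
move=> tT fi gi.
have sub : `[0, t]%classic `<=` `[0, T]%classic.
  move: tT; rewrite in_itv /= => /andP[t0 tT] x /=; rewrite !in_itv /= => /andP[-> xt].
  exact: le_trans xt tT.
have ikf := @cintegrable_kernel _ _ alpha T f fi t n `[0, t]%classic (measurable_itv _) sub.
have ikg := @cintegrable_kernel _ _ alpha T g gi t n `[0, t]%classic (measurable_itv _) sub.
rewrite !(@duhamel_termE _ _ alpha T _ t n tT).
rewrite -[X in _ = _ + X]mulN1r -cintegralZ // -cintegralD //; last exact: cintegrableZ.
by congr cintegral; apply/funext => tau; rewrite mulrBr mulN1r.
Qed.

Definition forcing_sub (F G : forcing) : forcing := fun k1 k2 k3 tau =>
  tdistr_sub (F k1 k2 k3 tau) (G k1 k2 k3 tau).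

Lemma cintegrable_sub T (f g : R -> tdistr R d) n :
  cintegrable leb `[0, T]%classic (fun tau => f tau n) ->
  cintegrable leb `[0, T]%classic (fun tau => g tau n) ->
  cintegrable leb `[0, T]%classic (fun tau => tdistr_sub (f tau) (g tau) n).
Proof.
move=> fi gi; rewrite /tdistr_sub.
rewrite (_ : (fun tau => _) = (fun tau => f tau n + -1 * g tau n)).
  by apply: cintegrableD => //; exact: cintegrableZ.
by apply/funext => tau; rewrite mulN1r.
Qed.

Lemma duhamel_diff_hs T t (F G : forcing) (K : R -> R) : 0 <= T ->
  forcing_integrable T F -> forcing_integrable T G -> t \in `[0, T] ->
  (forall k1 k2 k3, (k1 < k)%N -> k = (k1 + k2 + k3)%N ->
     forall tau, tau \in `[0, t] ->
     hs (- b) (tdistr_sub (F k1 k2 k3 tau) (G k1 k2 k3 tau)) (K tau)) ->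
  leb.-integrable `[0, t]%classic (EFin \o K) ->
  hs sigma (tdistr_sub (duhamel F t) (duhamel G t))
    (multinomial_sum * \int[leb]_(tau in `[0, t]) K tau).
Proof.
move=> T0 Fi Gi tT FGK iK.
have FGi : forcing_integrable T (forcing_sub F G).
  by move=> k1 k2 k3 k1k E n; apply: cintegrable_sub; [exact: Fi|exact: Gi].
apply: eq_hs (duhamel_hs T0 FGi tT FGK iK) => n.
rewrite /tdistr_sub /duhamel -opprD; congr (- _).
rewrite -sumrB; apply: eq_bigr => k1 _; rewrite -sumrB; apply: eq_bigr => k2 _.
rewrite -sumrB; apply: eq_bigr => k3 /eqP E.
have kk := ltn_ord k1.
rewrite (@duhamel_termB T t (F k1 k2 k3) (G k1 k2 k3)) ?mulrBr //.
  exact: Fi.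
exact: Gi.
Qed.

Lemma duhamel_cont T (F : forcing) (K : R) : 0 <= T -> 0 <= K -> forcing_integrable T F ->
  (forall k1 k2 k3, (k1 < k)%N -> k = (k1 + k2 + k3)%N ->
     forall tau, tau \in `[0, T] -> hs (- b) (F k1 k2 k3 tau) K) ->
  path_cont sigma T (duhamel F).
Proof.
move=> T0 K0 Fi FK t tT e e0.
have [th0 th1] := andP theta01.
pose D := multinomial_sum * (2 * K * T) + 1.
have D0 : 0 < D.
  by rewrite ltr_wpDl // mulr_ge0 ?multinomial_sum_ge0 // !mulr_ge0.
exists ((e / D) `^ theta^-1); first by rewrite powR_gt0 // divr_gt0.
move=> t' t'T tt'.
have small : `|t' - t| `^ theta <= e / D.
  rewrite -[leRHS]powRr1 ?divr_ge0 ?(ltW e0) ?(ltW D0) //.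
  have thn0 : theta != 0 by rewrite gt_eqF.
  rewrite -(mulVf thn0) powRrM.
  by apply: ge0_ler_powR; rewrite ?nnegrE ?powR_ge0 // ltW.
have := multinomial_sum_hs (G := fun k1 k2 k3 =>
  tdistr_sub (duhamel_term alpha (F k1 k2 k3) t') (duhamel_term alpha (F k1 k2 k3) t))
  (K := 2 * `|t' - t| `^ theta * K * T).
move=> /(_ ltac:(by move=> k1 k2 k3 k1k E;
  exact: (duhamel_term_holder T0 (Fi k1 k2 k3 k1k E) theta01 gain K0 tT t'T (FK k1 k2 k3 k1k E)))) H.
apply: (hs_le _ (eq_hs _ H)) => [|n].
  rewrite (_ : _ * _ = multinomial_sum * (2 * K * T) * `|t' - t| `^ theta); last by ring.
  apply: (@le_trans _ _ (multinomial_sum * (2 * K * T) * (e / D))).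
    by rewrite ler_wpM2l // mulr_ge0 ?multinomial_sum_ge0 // !mulr_ge0.
  by rewrite mulrA ler_pdivrMr // mulrC ler_pM2l // lerDl.
rewrite /tdistr_sub /duhamel -opprD; congr (- _).
rewrite -sumrB; apply: eq_bigr => k1 _; rewrite -sumrB; apply: eq_bigr => k2 _.
rewrite -sumrB; apply: eq_bigr => k3 _.
by rewrite mulrBr.
Qed.

End duhamel_map.

(** * The choice of exponents *)

(** With [delta = d/2 - beta], the products lie in H^{-b} for b slightly above
   [(k-1) delta], and sigma is taken just below the regularity [alpha - b] gained
   from the Duhamel integral, or below d/2.  The product condition is affine in
   k1, so it only has to be checked for the two extreme values of k1: at
   [k1 = k-1] it says that sigma is positive, and at [k1 = 0] it follows from the
   lower bounds on alpha and beta. *)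
Lemma exponents_exist (R : realType) (d k : nat) (alpha beta : R) :
  (2 <= k)%N -> 0 < alpha ->
  Num.max (d%:R / 2 - d%:R / (2 * k%:R)) (d%:R / 2 - alpha / (2 * k%:R)) < beta ->
  beta <= d%:R / 2 ->
  (k%:R - 1) * (d%:R / 2 - (k%:R - 1) / k%:R * beta) < alpha ->
  exists eps sigma b theta : R,
  [/\ 0 < eps, 0 < sigma, 0 < theta <= 1, sigma + b + alpha * theta <= alpha &
      forall s, regularities d k s beta eps ->
      forall k1 k2 k3, (k1 < k)%N -> k = (k1 + k2 + k3)%N ->
      admissible d (s k1 k2) sigma b k3].
Proof.
move=> k2 alpha0 beta_gt beta_le alpha_gt.
have [D DE] : exists D : R, D = d%:R / 2 by eexists.
have [kap kE] : exists kap : R, kap = k%:R by eexists.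
have [delta deltaE] : exists delta, delta = D - beta by eexists.
have kap2 : 2 <= kap by rewrite kE ler_nat.
have kap0 : 0 < kap by lra.
have delta0 : 0 <= delta by rewrite deltaE subr_ge0 DE.
move: beta_gt; rewrite gt_max => /andP[h1 h2].
have hD : kap * delta < D.
  rewrite mulrC -ltr_pdivlMr // deltaE; move: h1.
  by rewrite invfM mulrA -DE -kE; lra.
have halpha : 2 * kap * delta < alpha.
  rewrite mulrC -ltr_pdivlMr ?mulr_gt0 // deltaE; move: h2.
  by rewrite -DE -kE; lra.
have hka : (kap - 1) * (D + (kap - 1) * delta) < kap * alpha.
  rewrite -ltr_pdivrMl //; apply: le_lt_trans alpha_gt.
  rewrite -DE -kE deltaE; apply: le_of_eq; field.
  by rewrite gt_eqF.
pose m := Num.min (Num.min (alpha - 2 * kap * delta) (D - kap * delta))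
  (Num.min alpha (kap * alpha - (kap - 1) * (D + (kap - 1) * delta))).
have [m0 m1 m2 m3 m4] : [/\ 0 < m, m <= alpha - 2 * kap * delta, m <= D - kap * delta,
    m <= alpha & m <= kap * alpha - (kap - 1) * (D + (kap - 1) * delta)].
  by rewrite !lt_min !subr_gt0 !ge_min !lexx /= ?orbT hD halpha alpha0 hka.
have [eta eta0 etaE] : exists2 eta, 0 < eta & 4 * kap * eta = m.
  exists (m / (4 * kap)); first by rewrite divr_gt0 // mulr_gt0.
  by field; rewrite gt_eqF.
have eta1 : 8 * eta <= m by rewrite -etaE; nra.
have keta : 0 < kap * eta by rewrite mulr_gt0.
pose sigma := Num.min (alpha - (kap - 1) * delta) D - 3 * eta.
have [sg1 sg2] : sigma <= alpha - (kap - 1) * delta - 3 * eta /\ sigma <= D - 3 * eta.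
  by rewrite !lerD2r !ge_min !lexx orbT.
have sg3 : (kap - 1) * delta + eta < sigma.
  by rewrite ltrBrDr lt_min; apply/andP; split; lra.
have kd : 0 <= (kap - 1) * delta by rewrite mulr_ge0 //; lra.
exists (eta / 4), sigma, ((kap - 1) * delta + eta), (2 * eta / alpha).
split; [lra|lra| | |].
- by rewrite divr_gt0 ?mulr_gt0 //= ler_pdivrMr // mul1r; lra.
- by rewrite [alpha * _]mulrC divfK ?gt_eqF //; lra.
move=> s [reg1 reg0] k1 k2' k3 k1k E.
have k2k : (k2' <= k)%N by rewrite E -addnA addnCA leq_addr.
have [x xE] : exists x : R, x = k1%:R by eexists.
have x0 : 0 <= x by rewrite xE.
have x1 : x <= kap - 1.
  by rewrite xE kE lerBrDr natr1 ler_nat.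
have xd : x * delta <= (kap - 1) * delta by rewrite ler_wpM2r.
have xd0 : 0 <= x * delta by rewrite mulr_ge0.
exists (x * delta + eta / 2); split.
- lra.
- case: k1 => [|k1] in k1k E xE *; first by have /andP[] := reg0 _ k2k; lra.
  have /andP[+ _] := reg1 k1.+1 k2' k1k k2k.
  by rewrite -xE -DE deltaE; lra.
- by rewrite -DE; apply/andP; split; lra.
- by rewrite -DE; apply/andP; split; lra.
have -> : d%:R = 2 * D :> R by rewrite DE; field.
have -> : 2 * D / 2 = D by field.
have Ds : 0 <= D - sigma by lra.
have mx : (maxn 1 k3)%:R <= kap - x.
  rewrite lerBrDr xE kE -natrD ler_nat.
  by rewrite addn_maxl geq_max add1n k1k /= [leqRHS]E addnC -addnA leq_add2l leq_addl.
apply: (@le_lt_trans _ _ (x * delta + eta / 2 + (D - ((kap - 1) * delta + eta)) +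
  (kap - x) * (D - sigma))).
  by rewrite lerD2l ler_wpM2r.
suff ends : kap * (D - sigma) <= D + (kap - 1) * delta + eta / 4.
  have e1 : D - sigma <= D + eta / 4 by lra.
  (* The two endpoints are weighted by [x] and [kap - 1 - x]. *)
  have : (kap - 1) * ((kap - x) * (D - sigma)) <=
      (kap - 1) * (D + (kap - 1 - x) * delta + eta / 4).
    rewrite [leLHS](_ : _ = x * (D - sigma) + (kap - 1 - x) * (kap * (D - sigma))); last by ring.
    rewrite [leRHS](_ : _ = x * (D + eta / 4) +
      (kap - 1 - x) * (D + (kap - 1) * delta + eta / 4)); last by ring.
    by apply: lerD; apply: ler_wpM2l => //; lra.
  by rewrite ler_pM2l; lra.
have [sE|sE] : sigma = alpha - (kap - 1) * delta - 3 * eta \/ sigma = D - 3 * eta.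
- by rewrite /sigma minEle; case: ifP => _; [left|right].
- by rewrite sE; nra.
- by rewrite sE; nra.
Qed.

(** * Sobolev norms of paths *)

Section sobolev_paths.
Variables (R : realType) (d : nat).
Implicit Types (T e : R) (p : \bar R) (v w : R -> tdistr R d).

Lemma sobolev_norm_ge0 (s : R) p (f : tdistr R d) : (0 <= sobolev_norm s p f)%E.
Proof. by apply: le_ereal_inf_tmp => _ [g _ <-]; exact: Lnorm_ge0. Qed.

Lemma cvg0_within_itvP T t (h : R -> \bar R) : (forall t', (0 <= h t')%E) ->
  (h t' @[t' --> within `[0, T]%classic (nbhs t)] --> 0%E) <->
  (forall e, 0 < e -> exists2 eta, 0 < eta &
     forall t', t' \in `[0, T] -> `|t' - t| < eta -> (h t' <= e%:E)%E).
Proof.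
move=> h0; split=> [/fine_cvgP[hfin /cvgrPdist_le hc] e e0|H].
  have := hc e e0; have := hfin; rewrite !near_withinE => -[e1 /= e10 H1] [e2 /= e20 H2].
  exists (Num.min e1 e2); first by rewrite lt_min e10.
  move=> t' t'T; rewrite distrC lt_min => /andP[lt1 lt2].
  rewrite -(fineK (H1 t' lt1 t'T)) lee_fin.
  by have := H2 t' lt2 t'T; rewrite sub0r normrN; apply: le_trans; exact: ler_norm.
apply/fine_cvgP; split.
  rewrite near_withinE; have [eta eta0 Heta] := H 1 ltr01.
  exists eta => // t'; rewrite /= distrC => tt' t'T.
  by rewrite ge0_fin_numE //; apply: le_lt_trans (Heta t' t'T tt') (ltry _).
apply/cvgrPdist_le => e e0; rewrite near_withinE; have [eta eta0 Heta] := H e e0.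
exists eta => // t'; rewrite /= distrC => tt' t'T.
rewrite sub0r normrN ger0_norm ?fine_ge0 // -lee_fin fineK ?Heta //.
by rewrite ge0_fin_numE //; apply: le_lt_trans (Heta t' t'T tt') (ltry _).
Qed.

Lemma continuous_sobolev2P T (s : R) v : continuous_sobolev T s 2%:E v <->
  (forall t, t \in `[0, T] -> exists A, hs s (v t) A) /\ path_cont s T v.
Proof.
split=> [H|[vb vc] t tT].
  split=> t tT; have [fin /(cvg0_within_itvP T t (fun=> sobolev_norm_ge0 _ _ _)) c] := H t tT.
    exists (fine (sobolev_norm s 2%:E (v t))); apply: sobolev2_hs.
    by rewrite fineK // ge0_fin_numE // sobolev_norm_ge0.
  move=> e e0; have [eta eta0 Heta] := c e e0; exists eta => // t' t'T tt'.
  exact/sobolev2_hs/Heta.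
split; first by have [A vA] := vb t tT; exact: le_lt_trans (hs_sobolev2 vA) (ltry _).
apply/cvg0_within_itvP => [t'|e e0]; first exact: sobolev_norm_ge0.
have [eta eta0 H] := vc t tT e e0; exists eta => // t' t'T tt'.
exact/hs_sobolev2/H.
Qed.

Lemma sobolev_norm_le_path T (s : R) p v t : t \in `[0, T] ->
  (sobolev_norm s p (v t) <= continuous_sobolev_norm T s p v)%E.
Proof. by move=> tT; apply: ereal_sup_ubound; exists t. Qed.

Variables (k : nat) (s : nat -> nat -> R).

Lemma noise_norm_bounded (Xi : noise R d) (M : R) : (noise_norm k s Xi <= M%:E)%E ->
  noise_bounded k s Xi M.
Proof.
move=> XiM k1 k2 tau k1k k2k tau1; apply: sobolev_infty_mult_bounded.
have norm0 l1 l2 : (0 <= continuous_sobolev_norm 1 (s l1 l2) +oo (Xi l1 l2))%E.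
  apply: le_trans (sobolev_norm_ge0 _ _ _) (sobolev_norm_le_path _ _ _ (t := 0) _).
  by rewrite in_itv /= lexx ler01.
apply: le_trans XiM; apply: le_trans (sobolev_norm_le_path _ _ _ tau1) _.
rewrite /noise_norm (bigD1 (Ordinal k1k)) //=.
rewrite -[leLHS]adde0; apply: leeD; last by apply: sume_ge0 => ? _; exact: sume_ge0.
have k2k' : (k2 < k.+1)%N by [].
rewrite (bigD1 (Ordinal k2k')) //= -[leLHS]adde0; apply: leeD => //.
exact: sume_ge0.
Qed.

Lemma noise_space_cont (Xi : noise R d) : noise_space k s Xi -> noise_cont k s Xi.
Proof.
case=> _ H _ k1 k2 k1k k2k tau tau1 e e0; have [_] := H k1 k2 k1k k2k tau tau1.
move=> /(cvg0_within_itvP _ _ (fun=> sobolev_norm_ge0 _ _ _))/(_ e e0)[eta eta0 Heta].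
by exists eta => // tau' tau'1 tt'; exact/sobolev_infty_mult_bounded/Heta.
Qed.

End sobolev_paths.

(** * Fixed points of the Duhamel map *)

Lemma Rintegral_expR (R : realType) (lam c u : R) : 0 < lam -> 0 <= u ->
  \int[@lebesgue_measure R]_(tau in `[0, u]) (c * expR (lam * tau)) =
    c / lam * (expR (lam * u) - 1).
Proof.
move=> lam0; rewrite le_eqVlt => /predU1P[<-|u0].
  by rewrite set_itv1 Rintegral_set1 mulr0 expR0 subrr mulr0.
have D (x : R) : is_derive x (1 : R) (fun x : R => c / lam * expR (lam * x)) (c * expR (lam * x)).
  apply: is_derive_eq; rewrite /GRing.scale /=; field; by rewrite gt_eqF.
have cts (K : R) : continuous (fun x : R => K * expR (lam * x)).
  move=> x; apply: cvgMr; apply: continuous_comp; last exact: continuous_expR.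
  by apply: cvgMr; exact: cvg_id.
rewrite /Rintegral (continuous_FTC2 (F := fun x => c / lam * expR (lam * x)) u0).
- by rewrite /= mulr0 expR0 mulrBr.
- exact: continuous_subspaceT.
- split=> [x _| |]; first exact: (@ex_derive _ _ _ _ _ _ _ (D x)).
    apply: cvg_at_right_filter; exact: cts.
  by apply: cvg_at_left_filter; exact: cts.
- by move=> x _; rewrite derive1E (@derive_val _ _ _ _ _ _ _ (D x)).
Qed.

Section fixed_points.
Variables (R : realType) (d k : nat) (s : nat -> nat -> R).
Variables (alpha sigma b theta C : R).
Hypothesis theta01 : 0 < theta <= 1.
Hypothesis gain : sigma + b + alpha * theta <= alpha.
Hypothesis alpha0 : 0 < alpha.
Hypothesis C0 : 0 <= C.
Hypothesis HC : forall k1 k2 k3, (k1 < k)%N -> k = (k1 + k2 + k3)%N ->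
  product_bounded d (s k1 k2) sigma b C k3.
Local Notation leb := (@lebesgue_measure R).
Implicit Types (Xi : noise R d) (v w : R -> tdistr R d) (M B T t tau e : R).

Definition product_forcing Xi v : forcing R d := fun k1 k2 k3 tau =>
  limit_product (Xi k1 k2 tau) (v tau) k3.

Definition wave_map Xi v : R -> tdistr R d := duhamel k alpha (product_forcing Xi v).

Lemma sub_unit_itv T t : T <= 1 -> t \in `[0, T] -> t \in `[0, 1].
Proof. by move=> T1; rewrite !in_itv /= => /andP[-> tT]; exact: le_trans tT T1. Qed.

Lemma triple_le k1 k2 k3 : k = (k1 + k2 + k3)%N -> (k2 <= k)%N /\ (k3 <= k)%N.
Proof. by move=> ->; split; [rewrite -addnA addnCA leq_addr|rewrite leq_addl]. Qed.

Section one_noise.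
Variables (Xi : noise R d) (M T : R).
Hypotheses (XiM : noise_bounded k s Xi M) (M0 : 0 <= M) (T0 : 0 <= T) (T1 : T <= 1).

Lemma product_forcing_hs v B k1 k2 k3 tau : path_bounded sigma T v B -> 1 <= B ->
  (k1 < k)%N -> k = (k1 + k2 + k3)%N -> tau \in `[0, T] ->
  hs (- b) (product_forcing Xi v k1 k2 k3 tau) (C * M * B ^+ k).
Proof.
move=> vB B1 k1k E tauT; have [k2k k3k] := triple_le E.
have tau1 := sub_unit_itv T1 tauT.
apply: hs_le (limit_product_hs C0 (HC k1k E) (XiM k1k k2k tau1) M0 (vB tau tauT)).
by rewrite ler_wpM2l ?mulr_ge0 // ler_weXn2l.
Qed.

Lemma product_forcing_lip Xi' v w B A' e k1 k2 k3 tau : noise_bounded k s Xi' M ->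
  mult_bounded (s k1 k2) (tdistr_sub (Xi k1 k2 tau) (Xi' k1 k2 tau)) A' -> 0 <= A' ->
  hs sigma (v tau) B -> hs sigma (w tau) B -> 1 <= B ->
  hs sigma (tdistr_sub (v tau) (w tau)) e ->
  (k1 < k)%N -> k = (k1 + k2 + k3)%N -> tau \in `[0, T] ->
  hs (- b) (tdistr_sub (product_forcing Xi v k1 k2 k3 tau) (product_forcing Xi' w k1 k2 k3 tau))
    (C * B ^+ k * (A' + k%:R * M * e)).
Proof.
move=> XiM' XiA' A'0 vB wB B1 vwe k1k E tauT; have [k2k k3k] := triple_le E.
have tau1 := sub_unit_itv T1 tauT.
have e0 := hs_ge0 vwe.
apply: hs_le (limit_product_lip C0 (HC k1k E) (XiM k1k k2k tau1) M0 (XiM' _ _ _ k1k k2k tau1)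
  XiA' A'0 B1 vB wB vwe).
have B0 : 0 <= B by rewrite (le_trans ler01).
apply: ler_pM; rewrite ?mulr_ge0 ?exprn_ge0 ?addr_ge0 ?mulr_ge0 //.
  by rewrite ler_wpM2l // ler_weXn2l.
by rewrite lerD2l -!mulrA ler_wpM2r ?mulr_ge0 // ler_nat.
Qed.

Hypothesis Xic : noise_cont k s Xi.

Lemma product_forcing_cont v B k1 k2 k3 : path_bounded sigma T v B -> 1 <= B ->
  path_cont sigma T v -> (k1 < k)%N -> k = (k1 + k2 + k3)%N ->
  path_cont (- b) T (product_forcing Xi v k1 k2 k3).
Proof.
move=> vB B1 vc k1k E tau tauT e e0; have [k2k k3k] := triple_le E.
have tau1 := sub_unit_itv T1 tauT.
have B0 : 0 <= B by rewrite (le_trans ler01).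
pose D := C * B ^+ k * (1 + k%:R * M) + 1.
have D0 : 0 < D by rewrite ltr_wpDl // !mulr_ge0 ?exprn_ge0 // addr_ge0 // mulr_ge0.
have [z z0 zE] : exists2 z, 0 < z & z = e / D by exists (e / D); rewrite ?divr_gt0.
have [eta1 eta10 H1] := Xic k1k k2k tau1 z0.
have [eta2 eta20 H2] := vc tau tauT z z0.
exists (Num.min eta1 eta2); first by rewrite lt_min eta10.
move=> tau' tau'T; rewrite lt_min => /andP[lt1 lt2].
have tau'1 := sub_unit_itv T1 tau'T.
have A'0 := ltW z0.
have := @limit_product_lip _ _ _ _ _ _ _ C0 (HC k1k E) _ _ _ _ _ _ _ _
  (XiM k1k k2k tau'1) M0 (XiM k1k k2k tau1) (H1 tau' tau'1 lt1) A'0 B1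
  (vB tau' tau'T) (vB tau tauT) (H2 tau' tau'T lt2).
apply: hs_le.
apply: (@le_trans _ _ (C * B ^+ k * (1 + k%:R * M) * z)).
  rewrite -[X in _ <= X]mulrA [(1 + _) * _]mulrDl mul1r.
  apply: ler_pM; rewrite ?mulr_ge0 ?exprn_ge0 ?addr_ge0 ?mulr_ge0 //.
    by rewrite ler_wpM2l // ler_weXn2l.
  by rewrite lerD2l !ler_wpM2r // ler_nat.
by rewrite zE mulrA ler_pdivrMr // mulrC ler_pM2l // lerDl.
Qed.

Lemma product_forcing_integrable v B : path_bounded sigma T v B -> 1 <= B ->
  path_cont sigma T v -> forcing_integrable k T (product_forcing Xi v).
Proof.
move=> vB B1 vc k1 k2 k3 k1k E.
exact: path_cont_cintegrable (product_forcing_cont vB B1 vc k1k E).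
Qed.

Lemma wave_map_bounded v B : path_bounded sigma T v B -> 1 <= B -> path_cont sigma T v ->
  path_bounded sigma T (wave_map Xi v) (multinomial_sum R k * (C * M * B ^+ k * T)).
Proof.
move=> vB B1 vc t tT.
have vi := product_forcing_integrable vB B1 vc.
have B0 : 0 <= B by rewrite (le_trans ler01).
have t01 := tT; rewrite in_itv /= in t01; have /andP[t0 t1] := t01.
have := duhamel_hs theta01 gain alpha0 T0 vi tT (K := fun=> C * M * B ^+ k) _ (integrable_cst_itv _ _).
move=> H; apply: hs_le (H _) => [|k1 k2 k3 k1k E tau tautau].
  have CMB : 0 <= C * M * B ^+ k by rewrite !mulr_ge0 ?exprn_ge0.
  by rewrite ler_wpM2l ?multinomial_sum_ge0 // Rintegral_cst_itv // ler_wpM2l.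
apply: product_forcing_hs => //; move: tautau; rewrite !in_itv /= => /andP[-> h].
exact: le_trans h t1.
Qed.

Lemma wave_map_cont v B : path_bounded sigma T v B -> 1 <= B -> path_cont sigma T v ->
  path_cont sigma T (wave_map Xi v).
Proof.
move=> vB B1 vc.
have B0 : 0 <= B by rewrite (le_trans ler01).
have vi := product_forcing_integrable vB B1 vc.
have CMB : 0 <= C * M * B ^+ k by rewrite !mulr_ge0 ?exprn_ge0.
have := duhamel_cont theta01 gain T0 CMB vi; apply=> k1 k2 k3 k1k E tau tauT.
exact: product_forcing_hs.
Qed.

End one_noise.

(** The distance [e] of the two paths may depend on time: a constant [e] gives the
   contraction on short times, an exponential weight gives uniqueness. *)
Lemma wave_map_diff Xi Xi' M T A' v w B (e : R -> R) t :
  noise_bounded k s Xi M -> noise_bounded k s Xi' M -> 0 <= M -> 0 <= T -> T <= 1 ->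
  noise_cont k s Xi -> noise_cont k s Xi' ->
  noise_bounded k s (noise_sub Xi Xi') A' -> 0 <= A' ->
  path_bounded sigma T v B -> path_bounded sigma T w B -> 1 <= B ->
  path_cont sigma T v -> path_cont sigma T w ->
  t \in `[0, T] ->
  (forall tau, tau \in `[0, T] -> hs sigma (tdistr_sub (v tau) (w tau)) (e tau)) ->
  leb.-integrable `[0, t]%classic (EFin \o e) ->
  hs sigma (tdistr_sub (wave_map Xi v t) (wave_map Xi' w t))
    (multinomial_sum R k * (C * B ^+ k *
      \int[leb]_(tau in `[0, t]) (A' + k%:R * M * e tau))).
Proof.
move=> XiM XiM' M0 T0 T1 Xic Xic' XiA' A'0 vB wB B1 vc wc tT vwe ie.
have vi := product_forcing_integrable XiM M0 T1 Xic vB B1 vc.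
have wi := product_forcing_integrable XiM' M0 T1 Xic' wB B1 wc.
have i1 : leb.-integrable `[0, t]%classic (EFin \o (fun tau => A' + k%:R * M * e tau)).
  have h1 := integrable_cst_itv t A'.
  have h2 : leb.-integrable `[0, t]%classic (EFin \o (fun tau => k%:R * M * e tau)).
    by have /(_ (measurable_itv _)) := fun mD => integrableZl mD (k%:R * M) ie.
  by have /(_ (measurable_itv _)) := fun mD => integrableD mD h1 h2.
rewrite -RintegralZl //.
have := duhamel_diff_hs theta01 gain alpha0 T0 vi wi tT
  (K := fun tau => C * B ^+ k * (A' + k%:R * M * e tau)).
apply => [k1 k2 k3 k1k E tau tautau|].
  have tauT : tau \in `[0, T].
    move: tautau tT; rewrite !in_itv /= => /andP[-> h] /andP[_ h2].
    exact: le_trans h h2.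
  have [k2k k3k] := triple_le E.
  apply: (product_forcing_lip XiM M0 T1 XiM' _ A'0) => //.
  - exact: XiA' (sub_unit_itv T1 tauT).
  - exact: vB.
  - exact: wB.
  - exact: vwe.
by have /(_ (measurable_itv _)) := fun mD => integrableZl mD (C * B ^+ k) i1.
Qed.

Variable M : R.
Hypothesis M0 : 0 <= M.
Hypothesis k0 : (0 < k)%N.

Let L : R := multinomial_sum R k * C.

Let S0 : 0 <= multinomial_sum R k. Proof. exact: multinomial_sum_ge0. Qed.

Let L0 : 0 <= L. Proof. by rewrite mulr_ge0. Qed.

(** On this time scale the Duhamel map preserves the unit ball and contracts by
   one half. *)
Definition life_span : R := (2 * (multinomial_sum R k * C * k%:R * M + 1))^-1.

Let T := life_span.

Let D0 : 0 < L * k%:R * M + 1. 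
Proof. by rewrite ltr_wpDl ?ltr01 // !mulr_ge0. Qed.

Lemma life_span_gt0 : 0 < life_span. Proof. by rewrite invr_gt0 mulr_gt0. Qed.

Lemma life_span_le1 : life_span <= 1.
Proof.
rewrite invf_le1 ?mulr_gt0 //.
have h : 0 <= L * k%:R * M by rewrite !mulr_ge0.
by rewrite -/L; lra.
Qed.

Let T0 : 0 <= T. Proof. exact/ltW/life_span_gt0. Qed.

Let T1 : T <= 1. Proof. exact: life_span_le1. Qed.

Lemma life_span_contract : L * k%:R * M * T <= 2^-1.
Proof.
rewrite ler_pdivrMr ?mulr_gt0 // -/L mulrA mulVf ?mul1r //.
by rewrite lerDl.
Qed.

Lemma noise_bounded_sub0 Xi : noise_bounded k s (noise_sub Xi Xi) 0.
Proof.
move=> k1 k2 tau _ _ _ z S S' _ _ u v.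
rewrite !mul0r big1 ?cabs0 // => x _; rewrite big1 // => y _.
by rewrite /noise_sub /tdistr_sub subrr mulr0 mulr0 mul0r.
Qed.

Lemma wave_map_contract Xi Xi' A' v w e t :
  noise_bounded k s Xi M -> noise_bounded k s Xi' M ->
  noise_cont k s Xi -> noise_cont k s Xi' ->
  noise_bounded k s (noise_sub Xi Xi') A' -> 0 <= A' ->
  path_bounded sigma T v 1 -> path_bounded sigma T w 1 ->
  path_cont sigma T v -> path_cont sigma T w -> t \in `[0, T] ->
  (forall tau, tau \in `[0, T] -> hs sigma (tdistr_sub (v tau) (w tau)) e) ->
  hs sigma (tdistr_sub (wave_map Xi v t) (wave_map Xi' w t)) (L * A' + e / 2).
Proof.
move=> XiM XiM' Xic Xic' XiA' A'0 vB wB vc wc tT vwe.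
have e0 := hs_ge0 (vwe t tT).
have t01 := tT; rewrite in_itv /= in t01; have /andP[t0 t1] := t01.
have := wave_map_diff XiM XiM' M0 T0 T1 Xic Xic' XiA' A'0 vB wB
  (lexx 1) vc wc tT vwe (integrable_cst_itv _ _).
rewrite Rintegral_cst_itv // expr1n mulr1; apply: hs_le.
rewrite mulrA -/L; apply: (@le_trans _ _ (L * ((A' + k%:R * M * e) * T))).
  by rewrite ler_wpM2l // ler_wpM2l // addr_ge0 // !mulr_ge0.
rewrite mulrDl mulrDr; apply: lerD; first by rewrite ler_wpM2l // ler_piMr.
rewrite (_ : L * _ = L * k%:R * M * T * e); last by ring.
by rewrite mulrC ler_wpM2l // life_span_contract.
Qed.

Definition picard Xi (i : nat) : R -> tdistr R d :=
  iter i (wave_map Xi) (fun _ _ => 0).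

Definition solution Xi (t : R) : tdistr R d := tlim (fun i => picard Xi i t).

Section one_noise.
Variable Xi : noise R d.
Hypotheses (XiM : noise_bounded k s Xi M) (Xic : noise_cont k s Xi).

Lemma picard_path i : path_bounded sigma T (picard Xi i) 1 /\ path_cont sigma T (picard Xi i).
Proof.
elim: i => [|i [IHb IHc]].
  split=> [t tT|t tT e e0]; first exact: hs_le ler01 (hs0 _).
  exists 1 => // t' _ _; apply: hs_le (ltW e0) (eq_hs _ (hs0 _)) => n.
  by rewrite /tdistr_sub subrr.
split; last exact: (wave_map_cont XiM M0 T0 T1 Xic IHb (lexx 1) IHc).
apply: path_bounded_le (wave_map_bounded XiM M0 T0 T1 Xic IHb (lexx 1) IHc).
rewrite expr1n mulr1 (_ : _ * _ = L * M * T); last by rewrite /L; ring.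
apply: (@le_trans _ _ (L * k%:R * M * T)); last first.
  by apply: le_trans life_span_contract _; rewrite invf_le1 // ler1n.
rewrite !ler_wpM2r // ler_peMr // ler1n //.
Qed.

Let pic_b i := (picard_path i).1.
Let pic_c i := (picard_path i).2.

Lemma picard_step i t : t \in `[0, T] ->
  hs sigma (tdistr_sub (picard Xi i.+1 t) (picard Xi i t)) (dyad R i).
Proof.
elim: i t => [|i IH] t tT.
  rewrite /dyad expr0 invr1; apply: eq_hs (pic_b 1 tT) => n.
  by rewrite /tdistr_sub subr0.
have := wave_map_contract XiM XiM Xic Xic (noise_bounded_sub0 Xi) (lexx 0)
  (pic_b i.+1) (pic_b i) (pic_c i.+1) (pic_c i) tT IH.
by rewrite mulr0 add0r /dyad exprSr invfM.
Qed.

Lemma picard_dist i j t : t \in `[0, T] -> (i <= j)%N ->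
  hs sigma (tdistr_sub (picard Xi j t) (picard Xi i t)) (2 * dyad R i).
Proof.
move=> tT ij.
suff H p : hs sigma (tdistr_sub (picard Xi (i + p) t) (picard Xi i t))
    (2 * dyad R i - 2 * dyad R (i + p)).
  rewrite -(subnKC ij); apply: hs_le (H _).
  by rewrite gerBl mulr_ge0 // ltW // dyad_gt0.
elim: p => [|p IH].
  rewrite addn0 subrr; apply: (eq_hs _ (hs0 _)) => n.
  by rewrite /tdistr_sub subrr.
rewrite addnS; apply: hs_le (hs_sub_trans (picard_step (i + p) tT) IH).
rewrite /dyad exprS invfM; apply: le_of_eq.
by move: (2 ^+ (i + p))^-1 => ?; field.
Qed.

Lemma dyad_small e : 0 < e -> exists N0, forall i, (N0 <= i)%N -> 2 * dyad R i <= e.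
Proof.
move=> e0.
have /cvgrPdist_le/(_ _ (divr_gt0 e0 (ltr0Sn _ 1))) [N0 _ H] := @cvg_dyad R.
exists N0 => i iN; have := H i iN.
by rewrite sub0r normrN (ger0_norm (ltW (dyad_gt0 R i))) ler_pdivlMr // mulrC.
Qed.

Lemma picard_cauchy t : t \in `[0, T] -> hs_cauchy sigma (fun i => picard Xi i t).
Proof.
move=> tT e e0; have [N0 HN0] := dyad_small e0; exists N0 => i j Ni Nj.
have [ij|/ltnW ji] := leqP i j.
  by apply: hs_subC; exact: hs_le (HN0 i Ni) (picard_dist tT ij).
exact: hs_le (HN0 j Nj) (picard_dist tT ji).
Qed.

Lemma solution_dist i t : t \in `[0, T] ->
  hs sigma (tdistr_sub (solution Xi t) (picard Xi i t)) (2 * dyad R i).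
Proof.
move=> tT.
apply: (@hs_pointwise_lim _ _ _ (fun j => tdistr_sub (picard Xi j t) (picard Xi i t))).
  move=> n; apply: cvg_trans (tlim_pointwise (picard_cauchy tT) n).
  apply: near_eq_cvg; apply: nearW => j; congr cabs.
  by rewrite /tdistr_sub opprB addrA subrK.
by exists i => j ij; exact: picard_dist.
Qed.

Lemma solution_bounded : path_bounded sigma T (solution Xi) 1.
Proof.
move=> t tT; apply: hs_pointwise_lim (tlim_pointwise (picard_cauchy tT)) _.
by exists 0%N => i _; exact: pic_b.
Qed.

Lemma solution_cont : path_cont sigma T (solution Xi).
Proof.
move=> t tT e e0.
have e3 : 0 < e / 3 by rewrite divr_gt0.
have [i Hi] := dyad_small e3.
have [eta eta0 H] := pic_c i tT e3.
exists eta => // t' t'T tt'.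
have h1 := hs_le (Hi i (leqnn i)) (solution_dist i t'T).
have h2 := hs_le (Hi i (leqnn i)) (hs_subC (solution_dist i tT)).
apply: hs_le (hs_sub_trans (hs_sub_trans h1 (H t' t'T tt')) h2).
by apply: le_of_eq; field.
Qed.

Lemma solution_fixed t : t \in `[0, T] -> solution Xi t = wave_map Xi (solution Xi) t.
Proof.
move=> tT; apply/funext => n; apply/eqP; rewrite -subr_eq0; apply/eqP.
apply: (@hs_eq0 _ _ sigma (tdistr_sub (solution Xi t) (wave_map Xi (solution Xi) t))).
move=> e e0; have e2 : 0 < e / 2 by rewrite divr_gt0.
have [i Hi] := dyad_small e2.
have h1 := hs_le (Hi i.+1 (leqW (leqnn i))) (solution_dist i.+1 tT).
have h2 := wave_map_contract XiM XiM Xic Xic (noise_bounded_sub0 Xi) (lexx 0)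
  (pic_b i) solution_bounded (pic_c i) solution_cont tT
  (fun tau tauT => hs_le (Hi i (leqnn i)) (hs_subC (solution_dist i tauT))).
apply: hs_le (hs_sub_trans h1 h2).
by rewrite mulr0 add0r; lra.
Qed.

(** Uniqueness holds in balls of any radius: in the norm weighted by
   [exp (- lambda t)] the Duhamel map contracts when lambda is large. *)
Lemma solution_unique w : (exists B, path_bounded sigma T w B) -> path_cont sigma T w ->
  (forall t, t \in `[0, T] -> w t = wave_map Xi w t) ->
  forall t, t \in `[0, T] -> w t = solution Xi t.
Proof.
move=> [B1 wB1] wc wfix t tT.
pose B := Num.max 1 B1.
have B11 : 1 <= B by rewrite le_max lexx.
have wB : path_bounded sigma T w B by apply: path_bounded_le wB1; rewrite le_max lexx orbT.
have vB : path_bounded sigma T (solution Xi) B := path_bounded_le B11 solution_bounded.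
have B0 : 0 <= B by rewrite (le_trans ler01).
pose K0 := L * B ^+ k * k%:R * M.
have K00 : 0 <= K0 by rewrite !mulr_ge0 ?exprn_ge0.
pose lam := 2 * K0 + 1.
have lam0 : 0 < lam by rewrite ltr_wpDl // mulr_ge0.
have iexp c u : leb.-integrable `[0, u]%classic (EFin \o (fun tau => c * expR (lam * tau))).
  apply: continuous_compact_integrable; first exact: segment_compact.
  apply: continuous_subspaceT => x; apply: cvgMr; apply: continuous_comp; last exact: continuous_expR.
  by apply: cvgMr; exact: cvg_id.
have H i u : u \in `[0, T] ->
    hs sigma (tdistr_sub (w u) (solution Xi u)) (2 * B * dyad R i * expR (lam * u)).
  elim: i u => [|i IH] u uT.
    apply: hs_le (hsB (wB u uT) (vB u uT)).
    rewrite /dyad expr0 invr1 mulr1 (_ : B + B = 2 * B * 1); last by ring.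
    rewrite ler_wpM2l ?mulr_ge0 // -expR0 ler_expR mulr_ge0 ?(ltW lam0) //.
    by move: uT; rewrite in_itv /= => /andP[].
  rewrite (wfix u uT) (solution_fixed uT).
  have := wave_map_diff XiM XiM M0 T0 T1 Xic Xic
    (noise_bounded_sub0 Xi) (lexx 0) wB vB B11 wc solution_cont uT IH (iexp _ _).
  apply: hs_le.
  have u0 : 0 <= u by move: uT; rewrite in_itv /= => /andP[].
  under eq_Rintegral do rewrite add0r mulrA.
  rewrite Rintegral_expR // mulrA -/L mulrA.
  set c := 2 * B * dyad R i.
  have c0 : 0 <= c by rewrite !mulr_ge0 // ltW // dyad_gt0.
  have E1 : 1 <= expR (lam * u) by rewrite -expR0 ler_expR mulr_ge0 // ltW.
  rewrite (_ : _ * (_ - 1) = K0 / lam * c * (expR (lam * u) - 1)); last by rewrite /K0 /L; ring.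
  apply: (@le_trans _ _ (2^-1 * c * expR (lam * u))).
    apply: ler_pM; rewrite ?subr_ge0 //.
    - by rewrite mulr_ge0 // divr_ge0 // ltW.
    - by rewrite ler_wpM2r // ler_pdivrMr // /lam; lra.
    - by rewrite gerBl.
  by rewrite /c /dyad exprS invfM; apply: le_of_eq; ring.
apply/funext => n; apply/eqP; rewrite -subr_eq0; apply/eqP.
apply: (@hs_eq0 _ _ sigma (tdistr_sub (w t) (solution Xi t))) => e e0.
pose q := B * expR (lam * t).
have q0 : 0 < q by rewrite mulr_gt0 ?expR_gt0 // (lt_le_trans ltr01).
have [i Hi] := dyad_small (divr_gt0 e0 q0).
apply: hs_le (H i t tT).
have := Hi i (leqnn i); rewrite ler_pdivlMr //; apply: le_trans.
by apply: le_of_eq; rewrite /q; ring.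
Qed.

End one_noise.

(** The distance [e] of two fixed points satisfies [e <= L A' + e / 2]. *)
Lemma solution_lipschitz Xi Xi' A' t :
  noise_bounded k s Xi M -> noise_bounded k s Xi' M ->
  noise_cont k s Xi -> noise_cont k s Xi' ->
  noise_bounded k s (noise_sub Xi Xi') A' -> 0 <= A' -> t \in `[0, T] ->
  hs sigma (tdistr_sub (solution Xi t) (solution Xi' t)) (2 * L * A').
Proof.
move=> XiM XiM' Xic Xic' XiA' A'0.
have H i u : u \in `[0, T] ->
    hs sigma (tdistr_sub (solution Xi u) (solution Xi' u)) (2 * L * A' + 2 * dyad R i).
  elim: i u => [|i IH] u uT.
    apply: hs_le (hsB (solution_bounded XiM Xic uT) (solution_bounded XiM' Xic' uT)).
    have LA : 0 <= 2 * L * A' by rewrite !mulr_ge0.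
    by rewrite /dyad expr0 invr1; lra.
  rewrite (solution_fixed XiM Xic uT) (solution_fixed XiM' Xic' uT).
  have := wave_map_contract XiM XiM' Xic Xic' XiA' A'0 (solution_bounded XiM Xic)
    (solution_bounded XiM' Xic') (solution_cont XiM Xic) (solution_cont XiM' Xic') uT IH.
  apply: hs_le; rewrite /dyad exprS invfM; apply: le_of_eq.
  by field.
move=> tT S uS; apply/ler_addgt0Pr => e e0.
have [i Hi] := dyad_small e0.
apply: le_trans (H i t tT S uS) _.
by rewrite lerD2l Hi.
Qed.

Lemma solution_is_solution Xi : noise_bounded k s Xi M -> noise_cont k s Xi ->
  is_solution k alpha sigma T Xi (solution Xi).
Proof.
move=> XiM Xic.
have vB := solution_bounded XiM Xic.
have vc := solution_cont XiM Xic.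
split.
  by apply/continuous_sobolev2P; split => // t tT; exists 1; exact: vB.
exists (product_forcing Xi (solution Xi)); split.
- move=> k1 k2 k3 k1k E tau tauT; have [k2k _] := triple_le E.
  exact: (is_product_limit C0 (HC k1k E) (XiM _ _ _ k1k k2k (sub_unit_itv T1 tauT)) M0 (vB _ tauT)).
- exact: (product_forcing_integrable XiM M0 T1 Xic vB (lexx 1) vc).
- move=> t n tT.
  by rewrite [LHS](congr1 (fun f => f n) (solution_fixed XiM Xic tT)).
Qed.

Lemma is_solution_unique Xi w : noise_bounded k s Xi M -> noise_cont k s Xi ->
  is_solution k alpha sigma T Xi w -> forall t, t \in `[0, T] -> w t = solution Xi t.
Proof.
move=> XiM Xic [/continuous_sobolev2P[wb wc] [F [Fprod _ wE]]].
have [B B1 wB] := path_cont_bounded T0 wc wb.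
have FE k1 k2 k3 tau : (k1 < k)%N -> k = (k1 + k2 + k3)%N -> tau \in `[0, T] ->
    F k1 k2 k3 tau = product_forcing Xi w k1 k2 k3 tau.
  move=> k1k E tauT; have [k2k _] := triple_le E.
  exact: (is_product_unique C0 (HC k1k E) (XiM _ _ _ k1k k2k (sub_unit_itv T1 tauT)) M0 (wB _ tauT)
    (Fprod _ _ _ k1k E _ tauT)).
apply: (solution_unique XiM Xic _ wc); first by exists B.
move=> t tT; apply/funext => n; rewrite wE //; congr (- _).
apply: eq_bigr => k1 _; apply: eq_bigr => k2 _; apply: eq_bigr => k3 /eqP E; congr (_ * _).
by congr Complex; apply: eq_Rintegral => tau; rewrite inE /= => tautau;
  rewrite FE //; move: tautau tT; rewrite !in_itv /= => /andP[-> h] /andP[_]; exact: le_trans.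
Qed.

End fixed_points.

Theorem theorem3p4 (R : realType) (d k : nat) (alpha beta : R)
  (d_ge1 : (1 <= d)%N) (k_ge2 : (2 <= k)%N)
  (alpha_gt0 : 0 < alpha)
  (beta_gt : Num.max (d%:R / 2 - d%:R / (2 * k%:R))
                     (d%:R / 2 - alpha / (2 * k%:R)) < beta)
  (beta_le : beta <= d%:R / 2)
  (alpha_gt : (k%:R - 1) * (d%:R / 2 - (k%:R - 1) / k%:R * beta) < alpha)
  (alpha_gt3 : (3 <= k)%N ->
     (k%:R - 1) * (d%:R / 2)
       - (k%:R ^+ 2 - 3 * k%:R + 3) / (k%:R - 1) * beta < alpha) :
  exists2 eps : R, 0 < eps &
  forall s : nat -> nat -> R, regularities d k s beta eps ->
  exists2 sigma : R, 0 < sigma &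
  exists T : R -> R, forall M : R,
    0 < T M <= 1 /\
    exists V : noise R d -> R -> tdistr R d,
      (forall Xi, noise_space k s Xi -> (noise_norm k s Xi <= M%:E)%E ->
         is_unique_solution k alpha sigma (T M) Xi (V Xi)) /\
      (forall Xi, noise_space k s Xi -> (noise_norm k s Xi <= M%:E)%E ->
         forall e : R, 0 < e -> exists2 delta : R, 0 < delta &
         forall Xi', noise_space k s Xi' -> (noise_norm k s Xi' <= M%:E)%E ->
           (noise_norm k s (noise_sub Xi' Xi) < delta%:E)%E ->
           (continuous_sobolev_norm (T M) sigma 2%:E
              (fun t => tdistr_sub (V Xi' t) (V Xi t)) < e%:E)%E).
Proof.
have k0 : (0 < k)%N := ltnW k_ge2.
have [eps [sigma [b [theta [eps0 sigma0 theta01 gain adm]]]]] :=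
  exponents_exist k_ge2 alpha_gt0 beta_gt beta_le alpha_gt.
exists eps => // s reg; exists sigma => //.
have [C C0 HC] := product_constant (adm s reg).
exists (fun M => life_span k C (Num.max M 0)) => M.
have M0 : 0 <= Num.max M 0 by rewrite le_max lexx orbT.
split; first by rewrite life_span_gt0 // life_span_le1.
have bounded Xi : (noise_norm k s Xi <= M%:E)%E -> noise_bounded k s Xi (Num.max M 0).
  move=> XiM; apply: noise_norm_bounded; apply: le_trans XiM _.
  by rewrite lee_fin le_max lexx.
exists (solution k alpha); split.
  move=> Xi XiZ /bounded XiM; have Xic := noise_space_cont XiZ; split.
    exact: (solution_is_solution theta01 gain alpha_gt0 C0 HC M0 k0 XiM Xic).
  by move=> w; exact: (is_solution_unique theta01 gain alpha_gt0 C0 HC M0 k0 XiM Xic).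
move=> Xi XiZ /bounded XiM e e0.
have Xic := noise_space_cont XiZ.
pose L := 2 * (multinomial_sum R k * C).
have L0 : 0 <= L by rewrite !mulr_ge0 // multinomial_sum_ge0.
have [delta delta0 deltaE] : exists2 delta, 0 < delta & delta = e / (2 * (L + 1)).
  by exists (e / (2 * (L + 1))) => //; rewrite divr_gt0 // mulr_gt0 // ltr_wpDl.
exists delta => // Xi' Xi'Z /bounded Xi'M /ltW/noise_norm_bounded XiXi'.
have Xi'c := noise_space_cont Xi'Z.
apply: (@le_lt_trans _ _ (e / 2)%:E); last by rewrite lte_fin gtr_pMr // invf_lt1 // ltr1n.
apply: ge_ereal_sup => _ [t tT <-]; apply: hs_sobolev2.
have := solution_lipschitz theta01 gain alpha_gt0 C0 HC M0 k0 Xi'M XiM Xi'c Xic XiXi' (ltW delta0) tT.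
apply: hs_le; rewrite -/L deltaE mulrA ler_pdivrMr ?mulr_gt0 ?ltr_wpDl //.
by rewrite (_ : e / 2 * _ = L * e + e) ?lerDl ?(ltW e0) //; field.
Qed.
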